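(* If $(\mathbf{P},\mathbf{F})\sim SMBS(\mathbf{m},\mathbf{c},\mathbf{F_0})$ and, conditionally on $(\mathbf{P},\mathbf{F})$, $S=(S_t)_{t\ge0}\sim SM(\mathbf{P},\mathbf{F})$ (started at the fixed state $l_0$), then marginally $S\sim RSM(\mathbf{m},\mathbf{c},\mathbf{F_0})$.
   Context: $E$ is a non-empty finite or countably infinite set, with a fixed element $l_0\in E$. $I\{\cdot\}$ denotes an indicator. $x_{a:b}=(x_a,\dots,x_b)$ if $a\le b$, and the empty sequence if $a>b$. A non-decreasing function on the integers and its associated measure are denoted by the same symbol; e.g. $F(x)=F((-\infty,x])$, and $(a,b]$ denotes a set of integers. Empty sums are $0$ and empty products are $1$. Semi-Markov processes. A characteristic couple is a pair $(\mathbf{P},\mathbf{F})$ where $\mathbf{P}=(P^{i,j})_{i,j\in E}$ is a transition matrix on $E$ with $P^{i,i}=0$ for all $i$, and $\mathbf{F}=(F^i)_{i\in E}$ is a collection of probability distributions on the positive integers. The $i$-th row of $\mathbf{P}$ is identified with the probability measure $P^i(\{j\})=P^{i,j}$ on $E$. A Markov renewal process starting at $l_0$ with characteristic couple $(\mathbf{P},\mathbf{F})$ is a process $(L_n,T_n)_{n\ge 0}$ with $L_0=l_0$ a.s. and $$\mathbb{P}(L_{n+1}=j,T_n\le t\mid L_n=i,L_{0:n-1},T_{0:n-1},(\mathbf{P},\mathbf{F}))=F^i(t)P^{i,j}$$ for all $n\ge0$, $t\ge1$, $i,j\in E$. With $\tau_0=0$, $\tau_{n+1}=\sum_{h=0}^nT_h$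 and $N(t)=\sum_{n\ge1}I\{\tau_n\le t\}$, the process $S_t=L_{N(t)}$, $t=0,1,2,\dots$, is the associated semi-Markov process, written $S\sim SM(\mathbf{P},\mathbf{F})$. Beta-Stacy process. Given $c(t)>0$ for all integers $t>0$ and a probability distribution $F_0$ with support on the positive integers, a random distribution $F$ is $BS(c,F_0)$ if there are independent random variables $(U_t)_{t\ge1}$ with $U_t\sim Beta(c(t)F_0(\{t\}),c(t)F_0((t,+\infty)))$ and $F((t,+\infty))=\prod_{k=1}^t(1-U_k)$ for all integers $t\ge0$. It is assumed that $F_0((t,+\infty))>0$ for all $t\ge 0$, and $Beta(0,b)$ with $b>0$ is read as the point mass at $0$. Dirichlet process. For a measure $m$ on $E$ with $0<m(E)<\infty$, a random probability measure $P$ on $E$ is $Dir(m)$ if $(P(A_1),\dots,P(A_n))\sim Dirichlet(m(A_1),\dots,m(A_n))$ for every finite partition $A_1,\dots,A_n$ of $E$ (coordinates with zero parameter are a.s. $0$). Semi-Markov beta-Stacy process. For each $i\in E$ let $m^i$ be a measure on $E$ with $0<m^i(E)<\infty$ and $m^i(\{i\})=0$, let $c^i(t)>0$ for all integers $t>0$, and let $F_0^i$ be a distribution with support on the positive integers; put $\mathbf{m}=(m^i)_{i\in E}$, $\mathbf{c}=(c^i)_{i\in E}$, $\mathbf{F_0}=(F_0^i)_{i\in E}$. A random characteristic couple satisfies $(\mathbf{P},\mathbf{F})\sim SMBS(\mathbf{m},\mathbf{c},\mathbf{F_0})$ if: $\mathbf{P}$ and $\mathbf{F}$ are independent; the rows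 $P^i$, $i\in E$, are independent; the $F^i$, $i\in E$, are independent; $P^i\sim Dir(m^i)$ for all $i$; and $F^i\sim BS(c^i,F_0^i)$ for all $i$. Path statistics of $S_{0:t}$. $l(t)=\max\{k\in\{0,\dots,t\}:S_t=S_{t-1}=\cdots=S_{t-k}\}$ and $x(t)=l(t)+1$. For $i\ne j$, $M^{i,j}(t)=\sum_{k=1}^tI\{S_{k-1}=i,S_k=j\}$. $N^{i,t}(A)$ is the number of completed visits to $i$ in $S_{0:t}$ (maximal constant stretches at $i$ that end with a jump at or before time $t$) with length in $A$. Reinforced semi-Markov process. An $E$-valued process $S=(S_t)_{t\ge0}$ satisfies $S\sim RSM(\mathbf{m},\mathbf{c},\mathbf{F_0})$ if $\mathbb{P}(S_0=l_0)=1$ and $\mathbb{P}(S_{t+1}=j\mid S_{0:t})=k_t(S_{0:t};j)$ a.s. for all $j\in E$ and $t\ge0$, where, if $S_t=i\ne j$, $$k_t(S_{0:t};i)= \frac{c^{i}(x(t))F_0^i((x(t),+\infty))+N^{i,t}((x(t),+\infty))}{c^i(x(t))F_0^i([x(t),+\infty))+N^{i,t}([x(t),+\infty))},$$ $$k_t(S_{0:t};j)= \frac{c^i(x(t))F_0^i(\{x(t)\})+N^{i,t}(\{x(t)\})}{c^i(x(t))F_0^i([x(t),+\infty))+N^{i,t}([x(t),+\infty))} \cdot \frac{m^i(\{j\})+M^{i,j}(t)}{m^i(E)+\sum_{h\neq i} M^{i,h}(t)}.$$ *)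

(* Defs.v *)
From HB Require Import structures.
From mathcomp Require Import all_boot all_order all_algebra finmap.
From mathcomp Require Import all_classical all_reals all_analysis.
From mathcomp Require Import measurable_realfun.

Set Implicit Arguments.
Unset Strict Implicit.
Unset Printing Implicit Defensive.

Import Order.TTheory GRing.Theory Num.Theory.
Import numFieldNormedType.Exports.

Local Open Scope classical_set_scope.
Local Open Scope ring_scope.

Definition rv_events d (Omega : measurableType d) d' (T : measurableType d')
    (X : Omega -> T) : set (set Omega) :=
  preimage_set_system [set: Omega] X measurable.

(* A random probability measure on T is a probability kernel from Omega to T;
   the information it carries is that of all its values k(.)(A). *)
Definition kernel_events d (Omega : measurableType d) d' (T : measurableType d')
    (R : realType) (k : R.-pker Omega ~> T) : set (set Omega) :=
  \bigcup_(A in @measurable _ T) rv_events (fun w => k w A).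

(* Mutual independence of the sigma-algebras <<s G i >>, i in D. *)
Definition independent d (Omega : measurableType d) (R : realType)
    (Pr : probability Omega R) (I : choiceType) (D : set I)
    (G : I -> set (set Omega)) : Prop :=
  forall (J : {fset I}) (A : I -> set Omega),
    [set` J] `<=` D ->
    (forall i, i \in J -> <<s G i >> (A i)) ->
    Pr (\bigcap_(i in [set` J]) A i) = (\prod_(i <- J) Pr (A i))%E.

(* Y is a version of the conditional probability of A given <<s G >>. *)
Definition is_cond_prob d (Omega : measurableType d) (R : realType)
    (Pr : probability Omega R) (G : set (set Omega)) (A : set Omega)
    (Y : Omega -> \bar R) : Prop :=
  [/\ measurable_fun [set: g_sigma_algebraType G] Y,
      Pr.-integrable [set: Omega] Y &
      forall B, <<s G >> B -> (\int[Pr]_(w in B) Y w = Pr (A `&` B))%E].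

(* The library's beta_prob only has natural-number parameters. *)
Definition Beta_fun (R : realType) (a b : R) : R :=
  \int[lebesgue_measure]_(x in `]0, 1[) (x `^ (a - 1) * (1 - x) `^ (b - 1)).

Definition beta_law (R : realType) (a b : R) (A : set R) : \bar R :=
  if a == 0 then \d_(0 : R) A
  else (\int[lebesgue_measure]_(x in A `&` `]0%R, 1%R[)
    (x `^ (a - 1) * (1 - x) `^ (b - 1) / Beta_fun a b)%:E)%E.

Definition Gamma_fun (R : realType) (a : R) : R :=
  \int[lebesgue_measure]_(x in `]0, +oo[) (x `^ (a - 1) * expR (- x)).

Definition gamma_law (R : realType) (a : R) (A : set R) : \bar R :=
  if a == 0 then \d_(0 : R) A
  else (\int[lebesgue_measure]_(x in A `&` `]0%R, +oo[)
    (x `^ (a - 1) * expR (- x) / Gamma_fun a)%:E)%E.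

(* X has the Dirichlet distribution with parameters alpha_j >= 0, not all zero,
   in the form given by Ferguson (1973), which covers zero parameters: the law
   of (Z_j / sum_k Z_k)_j for independent Z_j ~ Gamma(alpha_j, 1), where
   Gamma(0, 1) is the point mass at 0. *)
Definition is_dirichlet d (Omega : measurableType d) (R : realType)
    (Pr : probability Omega R) (n : nat) (alpha : 'I_n -> R)
    (X : Omega -> n.-tuple R) : Prop :=
  exists (d' : measure_display) (Omega' : measurableType d')
         (Q : probability Omega' R) (Z : 'I_n -> {RV Q >-> R}),
  [/\ independent Q [set: 'I_n] (fun j => rv_events (Z j)),
      forall j (A : set R), measurable A ->
        Q (Z j @^-1` A) = gamma_law (alpha j) A &
      forall B : set (n.-tuple R), measurable B ->
        Pr (X @^-1` B) =
        Q ((fun w => [tuple Z j w / \sum_(k < n) Z k w | j < n]) @^-1` B)].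

Definition is_Dir d (Omega : measurableType d) (R : realType)
    (Pr : probability Omega R) dE (E : measurableType dE)
    (m : {measure set E -> \bar R}) (P : R.-pker Omega ~> E) : Prop :=
  forall (n : nat) (A : 'I_n -> set E),
    (forall j, measurable (A j)) ->
    trivIset [set: 'I_n] A ->
    \bigcup_j A j = [set: E] ->
    is_dirichlet Pr (fun j => fine (m (A j)))
      (fun w => [tuple fine (P w (A j)) | j < n]).

Definition is_BS d (Omega : measurableType d) (R : realType)
    (Pr : probability Omega R) (c : nat -> R) (F0 : probability nat R)
    (F : R.-pker Omega ~> nat) : Prop :=
  exists U : nat -> {RV Pr >-> R},
  [/\ independent Pr [set t | (0 < t)%N] (fun t => rv_events (U t)),
      forall t (A : set R), (0 < t)%N -> measurable A ->
        Pr (U t @^-1` A) =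
        beta_law (c t * fine (F0 [set t]))
                 (c t * fine (F0 [set u | (t < u)%N])) A &
      {ae Pr, forall w, forall t : nat,
        F w [set u | (t < u)%N] =
        (\prod_(1 <= k < t.+1) (1 - U k w))%:E}].

(* P i w = w-th value of the i-th row of the transition matrix, F i w = w-th
   value of the i-th distribution; both are probability measures by typing. *)
Definition char_couple d (Omega : measurableType d) (R : realType)
    dE (E : measurableType dE)
    (P : E -> R.-pker Omega ~> E) (F : E -> R.-pker Omega ~> nat) : Prop :=
  forall w i, (P i w [set i] = 0)%E /\ (F i w [set 0%N] = 0)%E.

Definition family_events d (Omega : measurableType d) (R : realType)
    (I : Type) d' (T : measurableType d') (k : I -> R.-pker Omega ~> T) :
    set (set Omega) :=
  \bigcup_i kernel_events (k i).

Record SMBS d (Omega : measurableType d) (R : realType)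
    (Pr : probability Omega R) dE (E : measurableType dE)
    (m : E -> {measure set E -> \bar R}) (c : E -> nat -> R)
    (F0 : E -> probability nat R)
    (P : E -> R.-pker Omega ~> E) (F : E -> R.-pker Omega ~> nat) : Prop := {
  SMBS_couple : char_couple P F;
  SMBS_indep_PF : independent Pr [set: bool]
    (fun b => if b then family_events P else family_events F);
  SMBS_indep_rows : independent Pr [set: E] (fun i => kernel_events (P i));
  SMBS_indep_F : independent Pr [set: E] (fun i => kernel_events (F i));
  SMBS_Dir : forall i, is_Dir Pr (m i) (P i);
  SMBS_BS : forall i, is_BS Pr (c i) (F0 i) (F i)
}.

(* Generates the sigma-algebra of L_{0:n}, T_{0:n-1} and (P, F). *)
Definition renewal_history d (Omega : measurableType d) (R : realType)
    dE (E : measurableType dE)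
    (P : E -> R.-pker Omega ~> E) (F : E -> R.-pker Omega ~> nat)
    (L : nat -> Omega -> E) (T : nat -> Omega -> nat) (n : nat) :
    set (set Omega) :=
  (family_events P `|` family_events F) `|`
  (\bigcup_(k in [set k | (k <= n)%N]) rv_events (L k) `|`
   \bigcup_(k in [set k | (k < n)%N]) rv_events (T k)).

(* The requirement on {L_n = i}, for all i, is expressed by evaluating the
   conditional probability at the random state i = L_n. *)
Definition markov_renewal d (Omega : measurableType d) (R : realType)
    (Pr : probability Omega R) dE (E : measurableType dE) (l0 : E)
    (P : E -> R.-pker Omega ~> E) (F : E -> R.-pker Omega ~> nat)
    (L : nat -> {RV Pr >-> E}) (T : nat -> {RV Pr >-> nat}) : Prop :=
  [/\ (Pr (L 0%N @^-1` [set l0]) = 1)%E,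
      forall n w, (0 < T n w)%N &
      forall (n t : nat) (j : E), (0 < t)%N ->
        is_cond_prob Pr (renewal_history P F L T n)
          [set w | L n.+1 w = j /\ (T n w <= t)%N]
          (fun w => F (L n w) w [set u | (u <= t)%N] *
                    P (L n w) w [set j])%E].

Definition tau (T : nat -> nat) (n : nat) : nat := (\sum_(h < n) T h)%N.

(* N(t) = sum_{n >= 1} I{tau_n <= t}; only finitely many terms are nonzero
   when all the holding times are positive. *)
Definition renewal_count (T : nat -> nat) (t : nat) : nat :=
  \big[addn/0%N]_(n \in [set n | (0 < n)%N]) (tau T n <= t)%N.

(* Conditionally on (P, F), S ~ SM(P, F).  The equality with L_{N(t)} is almost
   sure since only the conditional law of S given (P, F) is prescribed. *)
Definition cond_SM d (Omega : measurableType d) (R : realType)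
    (Pr : probability Omega R) dE (E : measurableType dE) (l0 : E)
    (P : E -> R.-pker Omega ~> E) (F : E -> R.-pker Omega ~> nat)
    (S : nat -> {RV Pr >-> E}) : Prop :=
  exists (L : nat -> {RV Pr >-> E}) (T : nat -> {RV Pr >-> nat}),
    markov_renewal l0 P F L T /\
    {ae Pr, forall w, forall t : nat,
      S t w = L (renewal_count (fun n => T n w) t) w}.

Definition path_l (E : eqType) (s : nat -> E) (t : nat) : nat :=
  (\max_(k < t.+1 | [forall h : 'I_t.+1, (h <= k) ==> (s (t - h) == s t)]) k)%N.

Definition path_x (E : eqType) (s : nat -> E) (t : nat) : nat :=
  (path_l s t).+1.

Definition path_M (E : eqType) (s : nat -> E) (t : nat) (i j : E) : nat :=
  (\sum_(1 <= k < t.+1) ((s k.-1 == i) && (s k == j)))%N.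

(* The path visits i exactly during the times a, ..., a + len - 1 (maximal
   stretch) and has left i by time t. *)
Definition completed_visit (E : eqType) (s : nat -> E) (t : nat) (i : E)
    (a len : nat) : bool :=
  [&& (0 < len)%N, (a + len <= t)%N,
      [forall u : 'I_len, s (a + u)%N == i],
      s (a + len)%N != i & (a == 0%N) || (s a.-1 != i)].

Definition path_N (E : eqType) (s : nat -> E) (t : nat) (i : E)
    (A : set nat) : nat :=
  #|[pred v : 'I_t.+1 * 'I_t.+1 |
      completed_visit s t i v.1 v.2 && (nat_of_ord v.2 \in A)]|.

Definition RSM_kernel (R : realType) dE (E : measurableType dE)
    (m : E -> {measure set E -> \bar R}) (c : E -> nat -> R)
    (F0 : E -> probability nat R) (t : nat) (s : nat -> E) (j : E) : R :=
  let i := s t in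
  let x := path_x s t in
  let gt_x := [set u | (x < u)%N] in
  let ge_x := [set u | (x <= u)%N] in
  let D := c i x * fine (F0 i ge_x) + (path_N s t i ge_x)%:R in
  if j == i then
    (c i x * fine (F0 i gt_x) + (path_N s t i gt_x)%:R) / D
  else
    (c i x * fine (F0 i [set x]) + (path_N s t i [set x])%:R) / D *
    ((fine (m i [set j]) + (path_M s t i j)%:R) /
     (fine (m i [set: E]) + \sum_(h \in [set h | h != i]) ((path_M s t i h)%:R : R))).

Definition RSM d (Omega : measurableType d) (R : realType)
    (Pr : probability Omega R) dE (E : measurableType dE) (l0 : E)
    (m : E -> {measure set E -> \bar R}) (c : E -> nat -> R)
    (F0 : E -> probability nat R) (S : nat -> {RV Pr >-> E}) : Prop :=
  (Pr (S 0%N @^-1` [set l0]) = 1)%E /\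
  forall (t : nat) (j : E),
    is_cond_prob Pr
      (\bigcup_(k in [set k | (k <= t)%N]) rv_events (S k))
      (S t.+1 @^-1` [set j])
      (fun w => (RSM_kernel m c F0 t (fun u => S u w) j)%:E).

(* Main.v *)
Require Import Defs.
From mathcomp Require Import all_boot all_order all_algebra finmap.
From mathcomp Require Import all_classical all_reals all_analysis.
From mathcomp Require Import measurable_realfun.
From mathcomp Require Import ring lra.

(** The law of the sojourns and jumps of S given (P, F) makes the probability
    of {S_0 = s_0, ..., S_t = s_t} the expectation of a product over the visited
    states i of two factors: one in the row P^i (a monomial in the P^{i,j}), one
    in F^i (through the beta-Stacy variables, a product over y of monomials
    U_y^p (1 - U_y)^q).  By independence this expectation factorizes, and one
    more step of the path changes a single exponent in at most one beta moment
    and one Dirichlet moment; the resulting ratios are the two fractions of the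
    reinforced kernel.  For beta laws the ratio comes from integration by parts.
    For Dirichlet laws, 1 / S^(N+1) with S a sum of independent gamma variables
    is a mixture of the exponentials e^(-uS); this shows that
    E[prod_i X_i^(k_i) * X_j] = (alpha_j + k_j) K with K independent of j, and
    summing over j identifies K. *)

Set Implicit Arguments.
Unset Strict Implicit.
Unset Printing Implicit Defensive.

Import Order.TTheory GRing.Theory Num.Theory.
Import numFieldNormedType.Exports.

Local Open Scope classical_set_scope.
Local Open Scope ring_scope.

(** * Integrals, laws and independence *)

(** The kernel has its shape because the sojourn in progress at time t is censored. If x is the age
    of the visit to i, counting time t itself, a path probability carries the tail F^i((x-1, oo))
    instead of a mass. A further stay turns it into F^i((x, oo)), a jump to j into F^i({x}) P^{i,j}.
    In beta-Stacy variables these tails and masses are F^i((x-1, oo)) times 1 - U_x or U_x, so only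
    the moment of U_x moves, and its exponents before the step count the completed visits to i of
    length x and of length greater than x. The step is a product identity, not a quotient, and is
    checked on single histories: as E is countable, the histories up to t form countably many atoms
    of the conditioning sigma-algebra, and no division by a null probability occurs. Expectations
    are integrals of nonnegative functions in the extended reals, and both sides of each recursion
    contain the same normalizing constant, so the Beta and Gamma constants are carried along without
    being computed. *)

Section transfer.
Local Open Scope ereal_scope.
Context (R : realType) d (T : measurableType d) (X : T -> R).
Hypotheses (mX : measurable_fun [set: T] X) (X0 : forall x, (0 <= X x)%R).

Let mXE : measurable_fun [set: T] (EFin \o X).
Proof. exact/measurable_EFinP. Qed.

Let h := nnsfun_approx measurableT mXE.

Import HBNNSimple.

(** The simple functions [h n] are built from [X] alone. The right-hand side therefore sees [phi],
    [mu] and [Y] only through the weighted masses of the pulled-back level sets of [h n]. *)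
Let integral_comp_limE d1 (T1 : measurableType d1)
    (mu : {measure set T1 -> \bar R}) (phi : T1 -> T) (Y : T1 -> R) :
  measurable_fun [set: T1] phi -> measurable_fun [set: T1] Y ->
  (forall x, (0 <= Y x)%R) ->
  \int[mu]_x (X (phi x) * Y x)%:E =
  limn (fun n => \sum_(r \in range (h n))
    r%:E * \int[mu]_(x in phi @^-1` (h n @^-1` [set r])) (Y x)%:E).
Proof.
move=> mphi mY Y0.
have mphiB B : measurable B -> measurable (phi @^-1` B).
  by move=> mB; rewrite -[X in measurable X]setTI; exact: mphi.
have hphi n : measurable_fun [set: T1] (fun x => h n (phi x)).
  by apply: measurableT_comp => //; exact: measurable_funP.
transitivity (limn (fun n => \int[mu]_x (h n (phi x) * Y x)%:E)).
  rewrite -monotone_convergence//.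
  - apply: eq_integral => x _; apply/esym/cvg_lim => //.
    under eq_fun do rewrite EFinM.
    rewrite EFinM; apply: cvgeZr => //.
    by apply: (cvg_nnsfun_approx measurableT mXE) => // y _; rewrite lee_fin.
  - by move=> n; apply/measurable_EFinP/measurable_funM.
  - by move=> n x _; rewrite lee_fin mulr_ge0.
  - move=> x _ m n mn; rewrite lee_fin ler_wpM2r//.
    exact/lefP/nd_nnsfun_approx.
congr (limn _); apply/funext => n.
under eq_integral => x _.
  rewrite (fimfunE (h n)) EFinM -fsumEFin// ge0_mule_fsuml; last first.
    by move=> r; have := nnfun_muleindic_ge0 (h n) r (phi x); rewrite -EFinM.
  over.
have mI r : measurable_fun [set: T1] (fun x => \1_(h n @^-1` [set r]) (phi x) : R).
  by apply: measurableT_comp => //; exact: measurable_indic.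
have I0 r x : (0 <= r * \1_(h n @^-1` [set r]) (phi x))%R.
  by have := nnfun_muleindic_ge0 (h n) r (phi x); rewrite -EFinM lee_fin.
rewrite ge0_integral_fsum//=; last 2 first.
- move=> r; apply: emeasurable_funM; apply/measurable_EFinP => //.
  exact: measurable_funM.
- by move=> r x _; rewrite -EFinM lee_fin mulr_ge0// I0.
apply: eq_fsbigr => r /set_mem [y _ yr].
have r0 : (0 <= r)%R by rewrite -yr.
under eq_integral do rewrite -EFinM -mulrA EFinM.
rewrite ge0_integralZl//; last 2 first.
- by apply/measurable_EFinP/measurable_funM.
- by move=> x _; rewrite lee_fin mulr_ge0.
congr (_ * _); rewrite [RHS]integral_mkcond.
apply: eq_integral => x _; rewrite patchE indicE.
have -> : (x \in phi @^-1` (h n @^-1` [set r])) = (phi x \in h n @^-1` [set r]).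
  by apply/idP/idP => /set_mem xr; apply/mem_set.
by case: ifP; rewrite ?mul1r// mul0r.
Qed.

(** Weighted image measures that agree on measurable sets give the same limit of sums. Constant
    weights yield a change of law, a density times an indicator yields an integral against that
    density, and identity maps into a coarser sigma-algebra yield the conditioning identity. *)
Lemma integral_transfer d1 d2 (T1 : measurableType d1) (T2 : measurableType d2)
    (mu1 : {measure set T1 -> \bar R}) (mu2 : {measure set T2 -> \bar R})
    (phi1 : T1 -> T) (phi2 : T2 -> T) (Y1 : T1 -> R) (Y2 : T2 -> R) :
  measurable_fun [set: T1] phi1 -> measurable_fun [set: T2] phi2 ->
  measurable_fun [set: T1] Y1 -> measurable_fun [set: T2] Y2 ->
  (forall x, (0 <= Y1 x)%R) -> (forall x, (0 <= Y2 x)%R) ->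
  (forall B, measurable B ->
    \int[mu1]_(x in phi1 @^-1` B) (Y1 x)%:E =
    \int[mu2]_(x in phi2 @^-1` B) (Y2 x)%:E) ->
  \int[mu1]_x (X (phi1 x) * Y1 x)%:E = \int[mu2]_x (X (phi2 x) * Y2 x)%:E.
Proof.
move=> mphi1 mphi2 mY1 mY2 Y10 Y20 Y12.
rewrite !integral_comp_limE//; congr (limn _); apply/funext => n.
by apply: eq_fsbigr => r _; rewrite Y12.
Qed.

Let integral_cst1 d1 (T1 : measurableType d1) (mu : {measure set T1 -> \bar R})
    (D : set T1) : measurable D -> \int[mu]_(x in D) (cst 1%R x)%:E = mu D.
Proof.
move=> mD; rewrite -[RHS]mul1e -(integral_cst mu mD 1%E).
exact: eq_integral.
Qed.

Let preimage_measurable d1 (T1 : measurableType d1) (phi : T1 -> T) B :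
  measurable_fun [set: T1] phi -> measurable B -> measurable (phi @^-1` B).
Proof. by move=> mphi mB; rewrite -[X in measurable X]setTI; exact: mphi. Qed.

Lemma eq_integral_law d1 d2 (T1 : measurableType d1) (T2 : measurableType d2)
    (mu1 : {measure set T1 -> \bar R}) (mu2 : {measure set T2 -> \bar R})
    (phi1 : T1 -> T) (phi2 : T2 -> T) :
  measurable_fun [set: T1] phi1 -> measurable_fun [set: T2] phi2 ->
  (forall B, measurable B -> mu1 (phi1 @^-1` B) = mu2 (phi2 @^-1` B)) ->
  \int[mu1]_x (X (phi1 x))%:E = \int[mu2]_x (X (phi2 x))%:E.
Proof.
move=> mphi1 mphi2 mu12.
under eq_integral do rewrite -[X (phi1 _)]mulr1.
under [RHS]eq_integral do rewrite -[X (phi2 _)]mulr1.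
apply: (integral_transfer _ _ _ _ _ (Y1 := cst 1%R) (Y2 := cst 1%R)) => //.
by move=> B mB; rewrite !integral_cst1 ?mu12//; exact: preimage_measurable.
Qed.

Lemma integral_density_law d1 (T1 : measurableType d1)
    (mu : {measure set T1 -> \bar R}) (nu : {measure set T -> \bar R})
    (phi : T1 -> T) (D : set T) (f : T -> R) :
  measurable_fun [set: T1] phi -> measurable D -> measurable_fun [set: T] f ->
  (forall x, (0 <= f x)%R) ->
  (forall B, measurable B ->
    mu (phi @^-1` B) = \int[nu]_(x in B `&` D) (f x)%:E) ->
  \int[mu]_x (X (phi x))%:E = \int[nu]_(x in D) (X x * f x)%:E.
Proof.
move=> mphi mD mf f0 law.
have patchD (g : T -> R) : (fun x => (g x * \1_D x)%:E) = (EFin \o g) \_ D.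
  apply/funext => x; rewrite patchE indicE.
  by case: ifP => _; rewrite ?mulr1// mulr0.
under eq_integral do rewrite -[X _]mulr1.
rewrite (integral_transfer (mu2 := nu) (phi2 := id) (Y1 := cst 1%R)
  (Y2 := fun x => f x * \1_D x)%R)//.
- by rewrite [RHS]integral_mkcond -(patchD (fun x => X x * f x)%R);
    under eq_integral do rewrite mulrA.
- by apply: measurable_funM => //; exact: measurable_indic.
- by move=> x; rewrite mulr_ge0.
- move=> B mB; rewrite integral_cst1 ?law//; last exact: preimage_measurable.
  by rewrite integral_mkcondr -patchD.
Qed.

End transfer.

Lemma measurable_fun_sub_sigma d (Omega : measurableType d)
    (G : set (set Omega)) d' (T : measurableType d') (X : Omega -> T) :
  <<s G >> `<=` measurable ->
  measurable_fun [set: g_sigma_algebraType G] X ->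
  measurable_fun [set: Omega] X.
Proof. by move=> sG mX _ B mB; apply: sG; exact: mX. Qed.

Section sub_sigma.
Local Open Scope ereal_scope.
Context (R : realType) d (Omega : measurableType d)
  (Pr : {measure set Omega -> \bar R}) (G : set (set Omega)).
Hypothesis sG : <<s G >> `<=` @measurable _ Omega.

Lemma integral_eq_sub_sigma (X Y Z : Omega -> R) :
  measurable_fun [set: g_sigma_algebraType G] X -> (forall x, (0 <= X x)%R) ->
  measurable_fun [set: Omega] Y -> (forall x, (0 <= Y x)%R) ->
  measurable_fun [set: Omega] Z -> (forall x, (0 <= Z x)%R) ->
  (forall B, <<s G >> B ->
    \int[Pr]_(x in B) (Y x)%:E = \int[Pr]_(x in B) (Z x)%:E) ->
  \int[Pr]_x (X x * Y x)%:E = \int[Pr]_x (X x * Z x)%:E.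
Proof.
move=> mX X0 mY Y0 mZ Z0 YZ.
have mid : @measurable_fun _ _ Omega (g_sigma_algebraType G) setT id.
  by move=> _ B mB; rewrite setTI; exact: sG.
exact: (integral_transfer mX X0 mid mid).
Qed.

End sub_sigma.

Lemma ge0_integralZl_real (R : realType) d (T : measurableType d)
    (mu : {measure set T -> \bar R}) (D : set T) (k : R) (g : T -> R) :
  measurable D -> 0 <= k -> measurable_fun D g -> (forall x, D x -> 0 <= g x) ->
  (\int[mu]_(x in D) (k * g x)%:E = k%:E * \int[mu]_(x in D) (g x)%:E)%E.
Proof.
move=> mD k0 mg g0; rewrite -ge0_integralZl_EFin//.
exact/measurable_EFinP.
Qed.

(** * Expectations of products over independent sigma-algebras *)

Section independence.
Local Open Scope ereal_scope.
Context (R : realType) d (Omega : measurableType d) (Pr : probability Omega R)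
  (I : choiceType) (D : set I) (G : I -> set (set Omega)).
Hypothesis GI : independent Pr D G.
Hypothesis sG : forall i, D i -> <<s G i >> `<=` @measurable _ Omega.

Let indep_integral_indic (J : seq I) (A : I -> set Omega) :
  uniq J -> {in J, forall i, D i} -> {in J, forall i, <<s G i >> (A i)} ->
  \int[Pr]_w (\prod_(i <- J) \1_(A i) w)%:E = \prod_(i <- J) Pr (A i).
Proof.
move=> uJ JD JA.
pose K : {fset I} := [fset i in J]%fset.
have EJ : [set` J] = [set` K].
  by apply/seteqP; split => i /=; rewrite inE.
have mA : measurable (\bigcap_(i in [set` J]) A i).
  apply: fin_bigcap_measurable => //.
  by move=> i /= iJ; apply: (sG (JD _ iJ)); exact: JA.
transitivity (\int[Pr]_w (\1_(\bigcap_(i in [set` J]) A i) w)%:E).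
  apply: eq_integral => w _; congr EFin.
  have [wA|wA] := pselect ((\bigcap_(i in [set` J]) A i) w).
    rewrite indicE mem_set// big_seq big1// => i iJ.
    by rewrite indicE mem_set//; exact: wA.
  rewrite indicE memNset//.
  have [i iJ Ai] : exists2 i, i \in J & ~ A i w.
    apply: contrapT => H; apply: wA => i /= iJ; apply: contrapT => Ai.
    by apply: H; exists i.
  by rewrite (big_rem i)//= indicE memNset// mul0r.
rewrite integral_indic// setIT EJ.
transitivity (\prod_(i <- K) Pr (A i)); last first.
  by rewrite (perm_big J)//; apply: uniq_perm => // i; rewrite inE.
apply: GI; first by rewrite -EJ => i /= /JD.
by move=> i; rewrite inE => /JA.
Qed.

(* Indicators of independent events are traded for functions one index at a
   time: with the other factors fixed, both sides are measures in the event. *)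
Lemma indep_integral_prod (X : I -> Omega -> R) (J : seq I) :
  uniq J -> {in J, forall i, D i} ->
  {in J, forall i, measurable_fun [set: g_sigma_algebraType (G i)] (X i)} ->
  (forall i w, (0 <= X i w)%R) ->
  {in J, forall i, \int[Pr]_w (X i w)%:E < +oo} ->
  \int[Pr]_w (\prod_(i <- J) X i w)%:E = \prod_(i <- J) \int[Pr]_w (X i w)%:E.
Proof.
move=> uJ JD mX X0 Xfin.
(* [J1] lists the factors that are general functions, [J2] those still frozen as indicators. The
   induction is on [J1], for all [J2], and an empty [J2] gives the claim. *)
suff H (J1 J2 : seq I) (A : I -> set Omega) : uniq (J1 ++ J2) ->
    {subset J1 <= J} -> {subset J2 <= J} ->
    {in J2, forall i, <<s G i >> (A i)} ->
    \int[Pr]_w ((\prod_(i <- J1) X i w) * \prod_(i <- J2) \1_(A i) w)%:E =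
    (\prod_(i <- J1) \int[Pr]_w (X i w)%:E) * \prod_(i <- J2) Pr (A i).
  have := H J [::] (fun=> set0); rewrite cats0 big_nil mule1 => <- //.
  by under [RHS]eq_integral do rewrite big_nil mulr1.
have mXO i : i \in J -> measurable_fun [set: Omega] (X i).
  by move=> iJ; exact: (measurable_fun_sub_sigma (sG (JD _ iJ)) (mX _ iJ)).
elim: J1 J2 A => [|j J1 IH] J2 A /=.
  move=> u2 _ s2 A2; rewrite big_nil mul1e.
  under eq_integral do rewrite big_nil mul1r.
  by apply: indep_integral_indic => // i /s2 /JD.
move=> /andP[jJ12 u12] s1 s2 A2.
have jJ : j \in J by apply: s1; rewrite mem_head.
have {}s1 : {subset J1 <= J} by move=> i iJ1; apply: s1; rewrite inE iJ1 orbT.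
have [jJ1 jJ2] : j \notin J1 /\ j \notin J2.
  by move: jJ12; rewrite mem_cat negb_or => /andP.
(* This product is the expected value of all factors but [X j]. It must be finite because it is used
   below as the real constant [fine C]. *)
have Cfin : (\prod_(i <- J1) \int[Pr]_w (X i w)%:E) * \prod_(i <- J2) Pr (A i)
    \is a fin_num.
  apply: fin_numM.
    rewrite big_seq; elim/big_ind: _ => //; first exact: fin_numM.
    move=> i iJ1; rewrite ge0_fin_numE ?integral_ge0//; last first.
      by move=> w _; rewrite lee_fin.
    by apply: Xfin; exact: s1.
  rewrite big_seq; elim/big_ind: _ => //; first exact: fin_numM.
  move=> i iJ2; apply: fin_num_measure.
  by apply: (sG (JD _ (s2 _ iJ2))); exact: A2.
have C0 : 0 <= (\prod_(i <- J1) \int[Pr]_w (X i w)%:E) * \prod_(i <- J2) Pr (A i).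
  apply: mule_ge0; elim/big_ind: _ => //; first exact: mule_ge0.
    by move=> i _; apply: integral_ge0 => w _; rewrite lee_fin.
  exact: mule_ge0.
set C := (_ * _) in Cfin C0.
under eq_integral do rewrite big_cons -mulrA.
rewrite (@integral_eq_sub_sigma _ _ _ _ (G j) (sG (JD _ jJ)) (X j) _
  (fun=> fine C))//; first last.
- move=> B GB; rewrite integral_cst; last exact: sG (JD _ jJ) _ GB.
  rewrite fineK//.
  (* Freezing [X j] at the event [B] puts [j] into the event list, and the induction hypothesis
     evaluates the remaining factors over [B]. *)
  pose A' i := if i == j then B else A i.
  have A'E i : i \in J2 -> A' i = A i.
    by rewrite /A'; case: eqP => // -> iJ2; move: jJ2; rewrite iJ2.
  have -> : C * Pr B = \prod_(i <- J1) \int[Pr]_w (X i w)%:E *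
      \prod_(i <- j :: J2) Pr (A' i).
    rewrite big_cons {1}/A' eqxx muleCA [in LHS]muleC; congr (_ * _).
    rewrite /C; congr (_ * _); rewrite big_seq [RHS]big_seq.
    by apply: eq_bigr => i /A'E ->.
  rewrite -IH//; last 3 first.
  + by rewrite uniq_catC /= mem_cat negb_or jJ1 jJ2 uniq_catC.
  + by move=> i; rewrite inE => /predU1P[->//|/s2].
  + by move=> i; rewrite inE /A'; case: eqP => [-> _ //|_ /= /A2].
  rewrite integral_mkcond; apply: eq_integral => w _.
  rewrite patchE big_cons {1}/A' eqxx indicE.
  have -> : (\prod_(i <- J2) \1_(A' i) w = \prod_(i <- J2) \1_(A i) w :> R)%R.
    by rewrite big_seq [RHS]big_seq; apply: eq_bigr => i /A'E ->.
  by case: ifPn => _; rewrite ?mul1r// mul0r mulr0.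
- by move=> _; exact: fine_ge0.
- by move=> w; apply: mulr_ge0; apply: prodr_ge0.
- apply: measurable_funM.
    by apply: measurable_prod => i /s1; exact: mXO.
  apply: measurable_prod => i iJ2; apply: measurable_indic.
  by apply: (sG (JD _ (s2 _ iJ2))); exact: A2.
- exact: mX.
under eq_integral do rewrite EFinM.
rewrite ge0_integralZr//; last 3 first.
- by apply/measurable_EFinP; exact: mXO.
- by move=> w _; rewrite lee_fin.
- by rewrite fineK.
by rewrite fineK// big_cons -muleA.
Qed.
End independence.

(** * Integration by parts for beta and gamma integrals *)

Lemma is_derive1_powR (R : realType) (a x : R) : 0 < x ->
  is_derive x 1 (fun y : R => y `^ a) (a * x `^ (a - 1)).
Proof.
move=> x0; have xI : x \in `]0, +oo[ by rewrite in_itv/= x0.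
by apply: DeriveDef; [exact: derivable_powR|rewrite -derive1E powR_derive1].
Qed.

(** The derivative of [H] is split into two nonnegative parts so that monotone convergence applies
    to each over the growing segments. The equality then holds in the extended reals without
    integrability near the open ends; only the boundary terms need a limit. *)
Lemma ge0_integral_FTC2_bigcup (R : realType) (h1 h2 H : R -> R)
    (a b : nat -> R) (l : R) :
  nonincreasing_seq a -> nondecreasing_seq b -> (forall n, a n < b n) ->
  (forall n x, x \in `[a n, b n] -> 0 <= h1 x /\ 0 <= h2 x) ->
  (forall n x, x \in `[a n, b n] ->
    [/\ {for x, continuous h1}, {for x, continuous h2} &
        is_derive x 1 H (h1 x - h2 x)]) ->
  H (b n) - H (a n) @[n --> \oo] --> l ->
  (\int[lebesgue_measure]_(x in \bigcup_n `[a n, b n]%classic) (h1 x)%:E =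
   \int[lebesgue_measure]_(x in \bigcup_n `[a n, b n]%classic) (h2 x)%:E + l%:E)%E.
Proof.
move=> ia nb ab h0 hH Hl.
have ci (h : R -> R) n : (forall x, x \in `[a n, b n] -> {for x, continuous h}) ->
    {within `[a n, b n]%classic, continuous h}.
  by move=> hc; apply: continuous_in_subspaceT => x /[!inE]; exact: hc.
have c1 n : {within `[a n, b n]%classic, continuous h1}.
  by apply: ci => x /hH[].
have c2 n : {within `[a n, b n]%classic, continuous h2}.
  by apply: ci => x /hH[].
have int (h : R -> R) n : {within `[a n, b n]%classic, continuous h} ->
    lebesgue_measure.-integrable `[a n, b n] (EFin \o h).
  by move=> ch; apply: continuous_compact_integrable => //; exact: segment_compact.
have nI : nondecreasing_seq (fun n => `[a n, b n]%classic).
  move=> p q pq; rewrite subsetEset; apply: subset_itv; rewrite bnd_simp.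
    exact: ia.
  exact: nb.
have lim (h : R -> R) : (forall n, {within `[a n, b n]%classic, continuous h}) ->
    (forall n x, x \in `[a n, b n] -> 0 <= h x) ->
    (\int[lebesgue_measure]_(x in `[a n, b n]) (h x)%:E @[n --> \oo] -->
    \int[lebesgue_measure]_(x in \bigcup_n `[a n, b n]%classic) (h x)%:E)%E.
  move=> ch hh; apply: ge0_nondecreasing_set_cvg_integral => //.
  by move=> n; exact: measurable_int (int _ _ (ch n)).
have E n : (\int[lebesgue_measure]_(x in `[a n, b n]) (h1 x)%:E =
    \int[lebesgue_measure]_(x in `[a n, b n]) (h2 x)%:E + (H (b n) - H (a n))%:E)%E.
  have FTC : (\int[lebesgue_measure]_(x in `[a n, b n]) (h1 x - h2 x)%:E =
      (H (b n))%:E - (H (a n))%:E)%E.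
    apply: continuous_FTC2 => //.
    - by move=> x; apply: continuousB; [exact: c1|exact: c2].
    - have cH x : x \in `[a n, b n] -> {for x, continuous H}.
        by move=> /hH[_ _ [dH _]]; apply/differentiable_continuous/derivable1_diffP.
      split.
      + by move=> x /subset_itv_oo_cc /hH[_ _ []].
      + by apply: cvg_at_right_filter; apply: cH; rewrite in_itv/= lexx ltW.
      + by apply: cvg_at_left_filter; apply: cH; rewrite in_itv/= lexx ltW.
    - by move=> x /subset_itv_oo_cc /hH[_ _ []]; rewrite derive1E.
  have -> : (\int[lebesgue_measure]_(x in `[a n, b n]) (h1 x)%:E =
      \int[lebesgue_measure]_(x in `[a n, b n])
        ((h2 x)%:E + (h1 x - h2 x)%:E))%E.
    by apply: eq_integral => x _; rewrite -EFinD addrC subrK.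
  rewrite integralD//=; [|exact: (int _ _ (c2 n))|].
    rewrite FTC. by rewrite EFinB.
  apply: (int (h1 \- h2)) => x; apply: continuousB; [exact: c1|exact: c2].
have l1 := lim h1 c1 (fun n x xI => (h0 n x xI).1).
have l2 := lim h2 c2 (fun n x xI => (h0 n x xI).2).
have Hl' : ((H (b n) - H (a n))%:E @[n --> \oo] --> l%:E)%E.
  by apply: cvg_EFin => //; exact: nearW.
rewrite (_ : (fun n => _) = (fun n => \int[lebesgue_measure]_(x in `[a n, b n])
  (h2 x)%:E + (H (b n) - H (a n))%:E)%E) in l1; last exact/funext.
apply: cvg_unique l1 _ => //; apply: cvgeD => //.
by rewrite fin_num_adde_defl.
Qed.

Lemma cvg_expRN_natM (R : realType) (k : R) : 0 < k ->
  expR (- (k * n.+1%:R)) @[n --> \oo] --> 0.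
Proof.
move=> k0; have k1 : `|expR (- k)| < 1.
  by rewrite ger0_norm ?expR_ge0// expR_lt1 oppr_lt0.
have := cvg_expr k1; rewrite -cvg_shiftS; apply: cvg_trans.
by apply: near_eq_cvg; apply: nearW => n /=; rewrite -mulNr expRM_natr.
Qed.

(** The function x^a e^(-v x) has the difference of the two integrands as derivative and vanishes at
    both ends of the half-line. *)
Lemma gamma_integral_by_parts (R : realType) (a v : R) : 0 < a -> 0 < v ->
  (\int[lebesgue_measure]_(x in `]0%R, +oo[)
     (a * x `^ (a - 1) * expR (- (v * x)))%:E =
   \int[lebesgue_measure]_(x in `]0%R, +oo[)
     (v * x `^ a * expR (- (v * x)))%:E)%E.
Proof.
move=> a0 v0.
(* The left endpoint e^(-(n+1)) has a-th power e^(-a(n+1)), so the boundary term there tends to 0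
   for every a > 0. *)
pose p (n : nat) : R := expR (- (1 * n.+1%:R)); pose q (n : nat) : R := n.+2%:R.
have p0 n : 0 < p n by exact: expR_gt0.
have cp : p n @[n --> \oo] --> 0 by exact: cvg_expRN_natM.
have pqE : `]0, +oo[%classic = \bigcup_n `[p n, q n]%classic :> set R.
  apply/seteqP; split => x /=; last first.
    move=> [n _ /=]; rewrite !in_itv/= => /andP[pnx _].
    by rewrite andbT (lt_le_trans _ pnx).
  rewrite in_itv/= andbT => x0.
  have : \forall n \near \oo, p n <= x /\ x <= q n.
    near=> n; split; first by near: n; apply: (cvgr_le _ cp).
    apply: ltW; apply: (lt_le_trans (truncnS_gt x)); rewrite ler_nat.
    by do 2 apply: leqW; near: n; exact: nbhs_infty_ge.
  move=> [N _ /(_ N (leqnn _)) [pN qN]]; exists N => //=.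
  by rewrite in_itv/= pN qN.
rewrite pqE.
have x0 n x : x \in `[p n, q n] -> 0 < x.
  by rewrite in_itv/= => /andP[pnx _]; rewrite (lt_le_trans _ pnx).
pose H (x : R) := x `^ a * expR (- (v * x)).
have DE (x : R) : is_derive x 1 (fun y : R => expR (- (v * y))) (- v * expR (- (v * x))).
  have D : is_derive x 1 (-%R \o (v \*: id)) (- v).
    by apply: is_derive_eq; rewrite /GRing.scale/= mulr1.
  have := @is_derive1_comp R expR (-%R \o (v \*: id)) x _ _
    (is_derive_expR (- (v * x))) D.
  by rewrite mulrC.
have cE (x : R) : {for x, continuous (fun y : R => expR (- (v * y)))}.
  by apply/differentiable_continuous/derivable1_diffP; case: (DE x).
have cP (b x : R) : 0 < x -> {for x, continuous (fun y : R => y `^ b)}.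
  by move=> /(is_derive1_powR b)[? _]; exact/differentiable_continuous/derivable1_diffP.
rewrite (ge0_integral_FTC2_bigcup (H := H) (l := 0)
  (h2 := fun x => v * x `^ a * expR (- (v * x)))) ?adde0//.
- by move=> m n mn; rewrite /p ler_expR lerN2 !mul1r ler_nat ltnS.
- by move=> m n mn; rewrite /q ler_nat !ltnS.
- move=> n; apply: (@lt_le_trans _ _ 1); last by rewrite /q ler1n.
  by rewrite /p expR_lt1 oppr_lt0 mul1r ltr0n.
- move=> n x /x0 xp; split; rewrite !mulr_ge0 ?powR_ge0 ?expR_ge0 ?ltW//.
- move=> n x /x0 xp; split.
  + apply: continuousM; last exact: cE.
    apply: continuousM; first exact: cst_continuous.
    exact: cP.
  + apply: continuousM; last exact: cE.
    apply: continuousM; first exact: cst_continuous.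
    exact: cP.
  + have D1 := is_derive1_powR a xp; have D2 := DE x.
    have DH := is_deriveM D1 D2.
    have HE : H = ((fun y : R => y `^ a) * (fun y : R => expR (- (v * y)))).
      by [].
    rewrite HE; apply: is_derive_eq.
    by rewrite /GRing.scale/=; ring.
- have H0 x : 0 <= H x by rewrite mulr_ge0 ?powR_ge0 ?expR_ge0.
  have Hp : H (p n) @[n --> \oo] --> 0.
    apply: (@squeeze_cvgr _ _ _ _ (fun=> 0) (fun n => expR (- (a * n.+1%:R)))).
    + apply: nearW => n; rewrite H0/= /H {1}/p -expRM -[leRHS]mulr1.
      rewrite mul1r mulNr [n.+1%:R * a]mulrC ler_wpM2l ?expR_ge0// expR_le1.
      by rewrite oppr_le0 mulr_ge0// ltW.
    + exact: cvg_cst.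
    + exact: cvg_expRN_natM.
  have Hq : H (q n) @[n --> \oo] --> 0.
    (* From ln y < y at y = v q / (2 a) follows q^a <= K e^(v q / 2): half of the exponent absorbs
       the power, and K e^(-v q / 2) remains. *)
    pose K := expR (- (a * ln (v / (2 * a)))).
    apply: (@squeeze_cvgr _ _ _ _ (fun=> 0)
        (fun n => K * expR (- ((v / 2) * n.+1%:R)))).
    + apply: nearW => n; rewrite H0/=.
      have qn : 0 < q n by rewrite ltr0n.
      rewrite /H /powR gt_eqF// /K -!expRD ler_expR.
      have va : v / (2 * a) \is Num.pos by rewrite posrE divr_gt0// mulr_gt0.
      have qp : q n \is Num.pos by rewrite posrE.
      have := ln_sublinear (mulr_gt0 va qn); rewrite (lnM va qp).
      rewrite -(ltr_pM2l a0) => /ltW.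
      have -> : a * (v / (2 * a) * q n) = v / 2 * q n.
        by field; rewrite gt_eqF.
      have /(ler_wpM2l (ltW (divr_gt0 v0 (ltr0Sn R 1)))) : n.+1%:R <= q n.
        by rewrite ler_nat.
      rewrite [a * (_ + _)]mulrDr.
      have -> : v * q n = v / 2 * q n + v / 2 * q n by field.
      move: (a * ln _) (a * ln _) (v / 2 * _) (v / 2 * _).
      move=> x1 x2 x3 x4 hq hl; lra.
    + exact: cvg_cst.
    + rewrite -[X in _ --> X](mulr0 K); apply: cvgMl_tmp.
      by apply: cvg_expRN_natM; rewrite divr_gt0.
  by rewrite -(subr0 0); apply: cvgB.
Unshelve. all: by end_near. Qed.

Lemma beta_integral_by_parts (R : realType) (a b : R) : 0 < a -> 0 < b ->
  (\int[lebesgue_measure]_(x in `]0%R, 1%R[)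
     (a * x `^ (a - 1) * (1 - x) `^ b)%:E =
   \int[lebesgue_measure]_(x in `]0%R, 1%R[)
     (b * x `^ a * (1 - x) `^ (b - 1))%:E)%E.
Proof.
move=> a0 b0.
(* On [p, 1 - p] with p = e^(-(n+1)) the boundary terms are at most e^(-a(n+1)) and e^(-b(n+1)), the
   other factor being at most 1. The bound p < 1/2 comes from e > 2. *)
pose p (n : nat) : R := expR (- (1 * n.+1%:R)); pose q (n : nat) : R := 1 - p n.
have p0 n : 0 < p n by exact: expR_gt0.
have p12 n : p n < 2^-1.
  have e2 : 2 < expR (1 : R) by have := @expR_gt1Dx R 1; rewrite oner_eq0; apply.
  rewrite /p expRN ltf_pV2 ?posrE ?expR_gt0//; apply: (lt_le_trans e2).
  by rewrite ler_expR mul1r ler1n.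
have cp : p n @[n --> \oo] --> 0 by exact: cvg_expRN_natM.
have pqE : `]0, 1[%classic = \bigcup_n `[p n, q n]%classic :> set R.
  apply/seteqP; split => x /=; last first.
    move=> [n _ /=]; rewrite !in_itv/= => /andP[pnx xq].
    by rewrite (lt_le_trans _ pnx)//= (le_lt_trans xq)// /q gtrBl.
  rewrite in_itv/= => /andP[x0 x1].
  have : \forall n \near \oo, p n <= x /\ p n <= 1 - x.
    by near=> n; split; near: n; apply: (cvgr_le _ cp); rewrite ?subr_gt0.
  move=> [N _ /(_ N (leqnn _)) [pN qN]]; exists N => //=.
  by rewrite in_itv/= pN/= /q lerBrDr -lerBrDl.
rewrite pqE.
have x0 n x : x \in `[p n, q n] -> 0 < x /\ 0 < 1 - x.
  rewrite in_itv/= => /andP[pnx xq]; rewrite (lt_le_trans _ pnx)//.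
  by rewrite subr_gt0 (le_lt_trans xq)// /q gtrBl.
pose H (x : R) := x `^ a * (1 - x) `^ b.
have DE (c x : R) : 0 < 1 - x ->
    is_derive x 1 (fun y : R => (1 - y) `^ c) (- (c * (1 - x) `^ (c - 1))).
  move=> x1; have D : is_derive x 1 (cst (1 : R) \- id) (- 1).
    by apply: is_derive_eq; rewrite sub0r.
  have := @is_derive1_comp R (fun y => y `^ c) (cst (1 : R) \- id) x _ _
    (is_derive1_powR c x1) D.
  by rewrite mulrN1.
have cE (c x : R) : 0 < 1 - x -> {for x, continuous (fun y : R => (1 - y) `^ c)}.
  by move=> /(DE c)[? _]; exact/differentiable_continuous/derivable1_diffP.
have cP (c x : R) : 0 < x -> {for x, continuous (fun y : R => y `^ c)}.
  by move=> /(is_derive1_powR c)[? _]; exact/differentiable_continuous/derivable1_diffP.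
rewrite (ge0_integral_FTC2_bigcup (H := H) (l := 0)
  (h2 := fun x => b * x `^ a * (1 - x) `^ (b - 1))) ?adde0//.
- by move=> m n mn; rewrite /p ler_expR lerN2 !mul1r ler_nat ltnS.
- by move=> m n mn; rewrite /q lerD2l lerN2 /p ler_expR lerN2 !mul1r ler_nat ltnS.
- by move=> n; rewrite /q; have := p12 n; lra.
- move=> n x /x0[xp xq]; split; rewrite !mulr_ge0 ?powR_ge0 ?expR_ge0 ?ltW//.
- move=> n x /x0[xp xq]; split.
  + apply: continuousM; last exact: cE.
    by apply: continuousM; [exact: cst_continuous|exact: cP].
  + apply: continuousM; last exact: cE.
    by apply: continuousM; [exact: cst_continuous|exact: cP].
  + have D1 := is_derive1_powR a xp; have D2 := DE b x xq.
    have HE : H = ((fun y : R => y `^ a) * (fun y : R => (1 - y) `^ b)) by [].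
    rewrite HE; apply: is_derive_eq.
    by rewrite /GRing.scale/=; ring.
- have H0 x : 0 <= H x by rewrite mulr_ge0 ?powR_ge0 ?expR_ge0.
  have le1 (c x : R) : 0 < c -> 0 <= x -> x <= 1 -> x `^ c <= 1.
    move=> c0 y0 y1; have -> : 1 = 1 `^ c :> R by rewrite powR1.
    by apply: ge0_ler_powR; rewrite ?nnegrE// ltW.
  have p1 n : p n <= 1 by have := p12 n; lra.
  have q0 n : 0 <= q n by rewrite subr_ge0.
  have q1 n : q n <= 1 by rewrite gerBl ltW.
  have Hp : H (p n) @[n --> \oo] --> 0.
    apply: (@squeeze_cvgr _ _ _ _ (fun=> 0) (fun n => expR (- (a * n.+1%:R)))).
    + apply: nearW => n; rewrite H0/= /H -[leRHS]mulr1.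
      apply: ler_pM; rewrite ?powR_ge0//; last exact: le1 b0 (q0 n) (q1 n).
      by rewrite /p -expRM mul1r mulNr mulrC.
    + exact: cvg_cst.
    + exact: cvg_expRN_natM.
  have Hq : H (q n) @[n --> \oo] --> 0.
    apply: (@squeeze_cvgr _ _ _ _ (fun=> 0) (fun n => expR (- (b * n.+1%:R)))).
    + apply: nearW => n; rewrite H0/= /H -[leRHS]mul1r.
      apply: ler_pM; rewrite ?powR_ge0//; first exact: le1 a0 (q0 n) (q1 n).
      by rewrite /q subKr /p -expRM mul1r mulNr mulrC.
    + exact: cvg_cst.
    + exact: cvg_expRN_natM.
  by rewrite -(subr0 0); apply: cvgB.
Unshelve. all: by end_near. Qed.

Lemma integral_expRN (R : realType) (s : R) : 0 < s ->
  (\int[lebesgue_measure]_(x in `]0%R, +oo[) (s * expR (- (s * x)))%:E = 1)%E.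
Proof.
move=> s0.
rewrite integral_itv_obnd_cbnd; last first.
  apply/measurable_EFinP/measurable_funM => //; apply: measurableT_comp => //.
  apply: measurableT_comp => //; exact: measurable_funM.
rewrite -(integral_exponential_pdf s0) [LHS]integral_mkcond.
apply: eq_integral => x _; rewrite patchE mem_setE in_itv/= andbT.
case: (leP 0 x) => x0; last by rewrite lt0_exponential_pdf.
by rewrite exponential_pdfE// mulNr.
Qed.

(** Integration by parts with exponent N + 1 and rate s gives (N+1) I_N = s I_(N+1). The
    cancellation [kI] takes place in the extended reals and delivers finiteness together with the
    value. *)
Lemma integral_expr_expRN (R : realType) (N : nat) (s : R) : 0 < s ->
  (\int[lebesgue_measure]_(x in `]0%R, +oo[) (x ^+ N * expR (- (s * x)))%:E =
   (N`!%:R / s ^+ N.+1)%:E)%E.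
Proof.
move=> s0.
have mE M : measurable_fun (`]0, +oo[%classic : set R)
    (fun x : R => (x ^+ M * expR (- (s * x)))%:E).
  apply/measurable_EFinP/measurable_funM.
    exact: measurable_funX.
  apply: measurable_funTS; apply: measurableT_comp => //.
  by apply: measurableT_comp => //; exact: measurable_funM.
have E0 M (x : R) : x \in `]0, +oo[ -> 0 <= x ^+ M * expR (- (s * x)).
  by rewrite in_itv/= andbT => x0; rewrite mulr_ge0 ?expR_ge0// exprn_ge0// ltW.
have kI (k y : R) (z : \bar R) : 0 < k -> (k%:E * z = (k * y)%:E)%E -> z = y%:E.
  move=> k0; case: z => [z| |].
  - by rewrite -EFinM => -[] /(mulfI (lt0r_neq0 k0)) ->.
  - by rewrite gt0_muley.
  - by rewrite gt0_muleNy.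
have kZ M (k : R) : 0 < k ->
    (k%:E * \int[lebesgue_measure]_(x in `]0%R, +oo[) (x ^+ M * expR (- (s * x)))%:E =
    \int[lebesgue_measure]_(x in `]0%R, +oo[) (k * x ^+ M * expR (- (s * x)))%:E)%E.
  move=> k0; rewrite -ge0_integralZl//.
  - by apply: eq_integral => x _; rewrite -EFinM mulrA.
  - exact: mE.
  - by move=> x x0; rewrite lee_fin; exact: E0.
  - by rewrite lee_fin ltW.
elim: N => [|N IH].
  apply: (kI s) => //; rewrite kZ// fact0 expr1 mul1r divff ?gt_eqF//.
  rewrite -(integral_expRN s0); apply: eq_integral => x _.
  by rewrite expr0 mulr1.
apply: (kI s) => //; rewrite kZ//.
transitivity (N.+1%:R%:E * (N`!%:R / s ^+ N.+1)%:E)%E; last first.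
  rewrite -EFinM; congr EFin; rewrite factS natrM [s ^+ N.+2]exprS.
  have sN : s ^+ N.+1 != 0 by rewrite expf_neq0// gt_eqF.
  move: sN; move: (s ^+ _) N.+1%:R N`!%:R => u k l u0; field.
  by rewrite u0 gt_eqF.
rewrite -IH kZ//.
have := @gamma_integral_by_parts R N.+1%:R s (ltr0Sn _ _) s0.
have -> : (\int[lebesgue_measure]_(x in `]0%R, +oo[)
    (N.+1%:R * x `^ (N.+1%:R - 1) * expR (- (s * x)))%:E =
  \int[lebesgue_measure]_(x in `]0%R, +oo[)
    (N.+1%:R * x ^+ N * expR (- (s * x)))%:E)%E.
  apply: eq_integral => x; rewrite inE/= in_itv/= andbT => x0.
  by rewrite -natr1 addrK powR_mulrn// ltW.
move=> ->; apply: eq_integral => x; rewrite inE/= in_itv/= andbT => x0.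
by rewrite powR_mulrn// ltW.
Qed.

(** * Moments of beta and Dirichlet laws *)

Section beta_moments.
Context (R : realType).

Lemma measurable_powR_onem (c : R) :
  measurable_fun [set: R] (fun x : R => (1 - x) `^ c).
Proof.
apply: (measurableT_comp (measurable_powR c) (g := fun x : R => 1 - x)).
exact: measurable_funB.
Qed.

(* A beta law only charges [0, 1]; the indicator makes the monomial nonnegative
   everywhere. *)
Definition beta_monomial (p q : nat) (x : R) : R :=
  x ^+ p * (1 - x) ^+ q * \1_(`[0, 1]%classic : set R) x.

Lemma measurable_beta_monomial p q : measurable_fun [set: R] (beta_monomial p q).
Proof.
apply: measurable_funM; last exact: measurable_indic.
apply: measurable_funM; apply: measurable_funX => //.
exact: measurable_funB.
Qed.

Lemma beta_monomial_itv01 p q x : 0 <= beta_monomial p q x <= 1.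
Proof.
rewrite /beta_monomial indicE mem_setE in_itv/=.
case: (boolP (0 <= x <= 1)) => [/andP[x0 x1]|_]; last by rewrite mulr0 lexx ler01.
rewrite mulr1 mulr_ge0 ?exprn_ge0 ?subr_ge0//=.
by rewrite mulr_ile1 ?exprn_ile1 ?exprn_ge0 ?subr_ge0// gerBl.
Qed.

Lemma beta_monomial_split p q x :
  beta_monomial p q x = beta_monomial p.+1 q x + beta_monomial p q.+1 x.
Proof. by rewrite /beta_monomial [x ^+ p.+1]exprS [(1 - x) ^+ q.+1]exprS; ring. Qed.

Context d (Omega : measurableType d) (Pr : probability Omega R).
Variables (U : {RV Pr >-> R}) (a b : R).
Hypotheses (a0 : 0 <= a) (b0 : 0 < b).
Hypothesis lawU : forall A : set R, measurable A ->
  Pr (U @^-1` A) = beta_law a b A.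

Let e p q : \bar R := (\int[Pr]_w (beta_monomial p q (U w))%:E)%E.

Let mU p q : measurable_fun [set: Omega] (fun w => beta_monomial p q (U w)).
Proof. by apply: measurableT_comp => //; exact: measurable_beta_monomial. Qed.

Let m0 p q x : 0 <= beta_monomial p q x.
Proof. by have /andP[] := beta_monomial_itv01 p q x. Qed.

Lemma beta_moment_fin p q : (\int[Pr]_w (beta_monomial p q (U w))%:E)%E
  \is a fin_num.
Proof.
rewrite ge0_fin_numE ?integral_ge0//; last by move=> w _; rewrite lee_fin.
apply: (@le_lt_trans _ _ (\int[Pr]_w (cst 1%E w))%E); last first.
  by rewrite integral_cst//= mul1e (le_lt_trans (probability_le1 _ _))// ltry.
apply: ge0_le_integral => //.
- by move=> w _; rewrite lee_fin.
- exact/measurable_EFinP.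
- by move=> w _; rewrite lee_fin; have /andP[] := beta_monomial_itv01 p q (U w).
Qed.

Let f x : R := x `^ (a - 1) * (1 - x) `^ (b - 1) / Beta_fun a b.

Let Beta_ge0 : 0 <= Beta_fun a b.
Proof.
apply: Rintegral_ge0 => x _; rewrite mulr_ge0// powR_ge0//.
Qed.

Let f0 x : 0 <= f x.
Proof. by rewrite !mulr_ge0 ?powR_ge0 ?invr_ge0. Qed.

Let mf : measurable_fun [set: R] f.
Proof.
apply: measurable_funM => //.
by apply: measurable_funM => //; exact: measurable_powR_onem.
Qed.

Let beta_moment_lebesgue (g : R -> R) : a != 0 -> measurable_fun [set: R] g ->
  (forall x, 0 <= g x) ->
  (\int[Pr]_w (g (U w))%:E = \int[lebesgue_measure]_(x in `]0%R, 1%R[)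
     (g x * (x `^ (a - 1) * (1 - x) `^ (b - 1) / Beta_fun a b))%:E)%E.
Proof.
move=> an0 mg g0.
have H := @integral_density_law R _ (measurableTypeR R) g mg g0 _ _ Pr
  (@lebesgue_measure R) U `]0, 1[%classic f.
apply: H => //; first exact: (measurable_funPT U).
by move=> B mB; have := lawU mB; rewrite /beta_law (negbTE an0).
Qed.

(** Both sides are integrals of the parts formula with parameters a + p and b + q, multiplied by the
    same inverse of [Beta_fun a b]. For a = 0 the law is the point mass at 0 and both sides
    vanish. *)
Let beta_by_parts p q : ((a + p%:R)%:E * e p q.+1 = (b + q%:R)%:E * e p.+1 q)%E.
Proof.
have [az|an0] := eqVneq a 0.
  have eE p' q' : e p' q' = (0 ^+ p')%:E.
    rewrite /e (eq_integral_law (mu2 := \d_(0 : R)) (phi2 := id)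
      (measurable_beta_monomial p' q') (m0 p' q'))//; last first.
      by move=> B mB; have := lawU mB; rewrite /beta_law az eqxx.
    rewrite integral_dirac//; last first.
      by apply/measurable_EFinP; exact: measurable_beta_monomial.
    rewrite diracT mul1e /beta_monomial subr0 expr1n mulr1 indicE mem_set ?mulr1//.
    by rewrite /= in_itv/= lexx ler01.
  rewrite !eE az add0r -!EFinM; congr EFin; rewrite [0 ^+ p.+1]exprS mul0r mulr0.
  by case: p => [|p]; rewrite ?mul0r// exprS mul0r mulr0.
have ap : 0 < a + p%:R by rewrite ltr_pwDl// lt_neqAle eq_sym an0.
have bq : 0 < b + q%:R by rewrite ltr_pwDl.
have mh p' q' : measurable_fun [set: R] (fun x => beta_monomial p' q' x * f x).
  by apply: measurable_funM => //; exact: measurable_beta_monomial.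
have mg (c c' k : R) : measurable_fun [set: R]
    (fun x => k * x `^ c * (1 - x) `^ c').
  apply: measurable_funM; last exact: measurable_powR_onem.
  by apply: measurable_funM.
have g0 (c c' k : R) x : 0 < k -> 0 <= k * x `^ c * (1 - x) `^ c'.
  by move=> k0; rewrite !mulr_ge0 ?powR_ge0// ltW.
have B0 : 0 <= (Beta_fun a b)^-1 by rewrite invr_ge0.
have I1 (k : R) p' q' : 0 < k -> (k%:E * e p' q' =
    \int[lebesgue_measure]_(x in `]0%R, 1%R[) (k * (beta_monomial p' q' x * f x))%:E)%E.
  move=> k0; rewrite ge0_integralZl_real//.
  - by rewrite /e beta_moment_lebesgue//; exact: measurable_beta_monomial.
  - exact: ltW.
  - apply: measurable_funTS; exact: mh.
  - by move=> x _; exact: (mulr_ge0 (m0 _ _ _) (f0 x)).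
have I2 (c c' k : R) : 0 < k ->
    (\int[lebesgue_measure]_(x in `]0%R, 1%R[)
      ((Beta_fun a b)^-1 * (k * x `^ c * (1 - x) `^ c'))%:E =
    ((Beta_fun a b)^-1)%:E * \int[lebesgue_measure]_(x in `]0%R, 1%R[)
      (k * x `^ c * (1 - x) `^ c')%:E)%E.
  move=> k0; rewrite ge0_integralZl_real//.
  - apply: measurable_funTS; exact: mg.
  - by move=> x _; exact: g0.
have powE (c : R) n x : 0 < x -> x `^ (c + n%:R) = x `^ c * x ^+ n.
  move=> x0; rewrite powRD; last by rewrite (gt_eqF x0) implybT.
  by rewrite (powR_mulrn n (ltW x0)).
transitivity (((Beta_fun a b)^-1)%:E * \int[lebesgue_measure]_(x in `]0%R, 1%R[)
    ((a + p%:R) * x `^ (a + p%:R - 1) * (1 - x) `^ (b + q%:R))%:E)%E.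
  rewrite I1// -I2//.
  apply: eq_integral => x; rewrite inE/= in_itv/= => /andP[x0 x1].
  have y0 : 0 < 1 - x by rewrite subr_gt0.
  rewrite /beta_monomial indicE mem_set/=; last by rewrite in_itv/= !ltW.
  have -> : a + p%:R - 1 = a - 1 + p%:R by ring.
  have -> : b + q%:R = b - 1 + q.+1%:R by rewrite -natr1; ring.
  by rewrite !powE// /f; congr EFin; ring.
rewrite beta_integral_by_parts// I1// -I2//.
apply: eq_integral => x; rewrite inE/= in_itv/= => /andP[x0 x1].
have y0 : 0 < 1 - x by rewrite subr_gt0.
rewrite /beta_monomial indicE mem_set/=; last by rewrite in_itv/= !ltW.
have -> : a + p%:R = a - 1 + p.+1%:R by rewrite -natr1; ring.
have -> : b + q%:R - 1 = b - 1 + q%:R by ring.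
rewrite !powE// /f; congr EFin.
rewrite -natr1; ring.
Qed.

Let eD p q : (e p q = e p.+1 q + e p q.+1)%E.
Proof.
rewrite /e -ge0_integralD//.
- by apply: eq_integral => w _; rewrite beta_monomial_split.
- by move=> w _; rewrite lee_fin.
- exact/measurable_EFinP.
- by move=> w _; rewrite lee_fin.
- exact/measurable_EFinP.
Qed.

(** Together with [eD], the parts identity is a linear system for e(p+1, q) and e(p, q+1) in terms
    of e(p, q), and solving it gives both ratios at once. Finiteness of the moments lets it be
    solved over the reals. *)
Lemma beta_moment_step p q :
  ((a + b + (p + q)%:R)%:E * e p.+1 q = (a + p%:R)%:E * e p q)%E /\
  ((a + b + (p + q)%:R)%:E * e p q.+1 = (b + q%:R)%:E * e p q)%E.
Proof.
have := beta_by_parts p q; have := eD p q; rewrite /e.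
rewrite -(fineK (beta_moment_fin p.+1 q)) -(fineK (beta_moment_fin p q.+1)).
rewrite -(fineK (beta_moment_fin p q)) -!EFinM -!EFinD.
move: (fine _) (fine _) (fine _) => x y z [->] [zx].
by rewrite natrD; split; congr EFin; move: zx; lra.
Qed.
End beta_moments.

Lemma beta_law_itv01 (R : realType) d (Omega : measurableType d)
    (Pr : probability Omega R) (U : {RV Pr >-> R}) (a b : R) :
  (forall A : set R, measurable A -> Pr (U @^-1` A) = beta_law a b A) ->
  {ae Pr, forall w, 0 <= U w <= 1}.
Proof.
move=> lawU; exists (U @^-1` ~` `[0, 1]%classic); split.
- by apply: measurable_funPTI; exact: measurableC.
- rewrite lawU; last exact: measurableC.
  rewrite /beta_law; case: ifP => _.
    by rewrite diracE memNset//= in_itv/= lexx ler01; exact.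
  rewrite (_ : _ `&` _ = set0) ?integral_set0//.
  apply/seteqP; split => x //= [] /[swap] /subset_itv_oo_cc /[swap].
  by rewrite /= => /negP; rewrite in_itv/= => /negPf ->.
- by move=> w /= /negP; rewrite in_itv/=; move/negP.
Qed.

(** * Gamma moments with an exponential weight *)

Section gamma_moments.
Context (R : realType).

(** The factor e^(-u x) is the share of one gamma variable in e^(-u S). The indicator makes the
    function nonnegative everywhere and changes nothing where gamma laws live. *)
Definition gamma_monomial (k : nat) (u x : R) : R :=
  x ^+ k * expR (- (u * x)) * \1_(`[0, +oo[%classic : set R) x.

Lemma measurable_gamma_monomial k u :
  measurable_fun [set: R] (gamma_monomial k u).
Proof.
apply: measurable_funM; last exact: measurable_indic.
apply: measurable_funM; first exact: measurable_funX.
by apply: measurableT_comp => //; apply: measurableT_comp.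
Qed.

Lemma gamma_monomial_ge0 k u x : 0 <= gamma_monomial k u x.
Proof.
rewrite /gamma_monomial indicE mem_setE in_itv/= andbT.
case: (leP 0 x) => [x0|_]; last by rewrite mulr0.
by rewrite mulr1 mulr_ge0 ?exprn_ge0// expR_ge0.
Qed.

Context d (Q : measurableType d) (Pr : probability Q R).
Variables (Z : {RV Pr >-> R}) (a : R).
Hypotheses (a0 : 0 <= a).
Hypothesis lawZ : forall A : set R, measurable A ->
  Pr (Z @^-1` A) = gamma_law a A.

Let f x : R := x `^ (a - 1) * expR (- x) / Gamma_fun a.

Let Gamma_ge0 : 0 <= Gamma_fun a.
Proof.
by apply: Rintegral_ge0 => x _; rewrite mulr_ge0 ?powR_ge0// expR_ge0.
Qed.

Let f0 x : 0 <= f x.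
Proof. by rewrite /f !mulr_ge0 ?powR_ge0 ?invr_ge0 ?expR_ge0. Qed.

Let mf : measurable_fun [set: R] f.
Proof.
apply: measurable_funM => //; apply: measurable_funM => //.
by apply: measurableT_comp.
Qed.

Lemma gamma_law_ge0 : {ae Pr, forall w, 0 <= Z w}.
Proof.
exists (Z @^-1` `]-oo, 0[%classic); split.
- exact: measurable_funPTI.
- rewrite lawZ// /gamma_law; case: ifP => _.
    by rewrite diracE memNset//= in_itv/= ltxx.
  rewrite (_ : _ `&` _ = set0) ?integral_set0//.
  apply/seteqP; split => x //=; rewrite !in_itv/= andbT => -[x0].
  by rewrite ltNge ltW.
- by move=> w /= /negP; rewrite -ltNge in_itv.
Qed.

Lemma gamma_law_gt0 : 0 < a -> {ae Pr, forall w, 0 < Z w}.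
Proof.
move=> ap; exists (Z @^-1` `]-oo, 0]%classic); split.
- exact: measurable_funPTI.
- rewrite lawZ// /gamma_law gt_eqF//.
  rewrite (_ : _ `&` _ = set0) ?integral_set0//.
  apply/seteqP; split => x //=; rewrite !in_itv/= andbT => -[x0].
  by rewrite ltNge x0.
- by move=> w /= /negP; rewrite -leNgt in_itv.
Qed.

(** The weight e^(-u x) merges with the density into the rate 1 + u, and the parts formula applies
    with exponent a + k. The factor 1 + u depends on neither a nor k, which makes different
    coordinates comparable. *)
Lemma gamma_moment_step k u : 0 <= u ->
  ((1 + u)%:E * \int[Pr]_w (gamma_monomial k.+1 u (Z w))%:E =
   (a + k%:R)%:E * \int[Pr]_w (gamma_monomial k u (Z w))%:E)%E.
Proof.
move=> u0; have [az|an0] := eqVneq a 0.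
  have eE k' : (\int[Pr]_w (gamma_monomial k' u (Z w))%:E = (0 ^+ k')%:E)%E.
    rewrite (eq_integral_law (mu2 := \d_(0 : R)) (phi2 := id)
      (measurable_gamma_monomial k' u) (gamma_monomial_ge0 k' u))//; last first.
      by move=> B mB; have := lawZ mB; rewrite /gamma_law az eqxx.
    rewrite integral_dirac//; last first.
      by apply/measurable_EFinP; exact: measurable_gamma_monomial.
    rewrite diracT mul1e /gamma_monomial mulr0 oppr0 expR0 indicE.
    by rewrite mem_set ?mulr1//= in_itv/= lexx.
  rewrite !eE az add0r -!EFinM; congr EFin; rewrite [0 ^+ k.+1]exprS mul0r mulr0.
  by case: k => [|k]; rewrite ?mul0r// exprS mul0r mulr0.
have ak : 0 < a + k%:R by rewrite ltr_pwDl// lt_neqAle eq_sym an0.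
have v0 : 0 < 1 + u by rewrite ltr_pwDl.
have mE (v : R) : measurable_fun [set: R] (fun x : R => expR (- (v * x))).
  by apply: measurableT_comp => //; apply: measurableT_comp.
have eE k' : (\int[Pr]_w (gamma_monomial k' u (Z w))%:E =
    \int[lebesgue_measure]_(x in `]0%R, +oo[) (gamma_monomial k' u x * f x)%:E)%E.
  have H := @integral_density_law R _ (measurableTypeR R) (gamma_monomial k' u)
    (measurable_gamma_monomial k' u) (gamma_monomial_ge0 k' u) _ _ Pr
    (@lebesgue_measure R) Z `]0, +oo[%classic f.
  apply: H => //; first exact: (measurable_funPT Z).
  by move=> B mB; have := lawZ mB; rewrite /gamma_law (negbTE an0).
have G0 : 0 <= (Gamma_fun a)^-1 by rewrite invr_ge0.
have I1 (c : R) k' : 0 < c -> (c%:E * \int[Pr]_w (gamma_monomial k' u (Z w))%:E =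
    \int[lebesgue_measure]_(x in `]0%R, +oo[) (c * (gamma_monomial k' u x * f x))%:E)%E.
  move=> c0; rewrite ge0_integralZl_real//.
  - by rewrite eE.
  - exact: ltW.
  - apply: measurable_funTS; apply: measurable_funM => //.
    exact: measurable_gamma_monomial.
  - by move=> x _; exact: (mulr_ge0 (gamma_monomial_ge0 _ _ _) (f0 x)).
have I2 (b c : R) : 0 < c ->
    (\int[lebesgue_measure]_(x in `]0%R, +oo[)
      ((Gamma_fun a)^-1 * (c * x `^ b * expR (- ((1 + u) * x))))%:E =
    ((Gamma_fun a)^-1)%:E * \int[lebesgue_measure]_(x in `]0%R, +oo[)
      (c * x `^ b * expR (- ((1 + u) * x)))%:E)%E.
  move=> c0; rewrite ge0_integralZl_real//.
  - apply: measurable_funTS; apply: measurable_funM; last exact: mE.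
    exact: measurable_funM.
  - by move=> x _; rewrite !mulr_ge0 ?powR_ge0 ?expR_ge0// ltW.
have powE (c : R) n x : 0 < x -> x `^ (c + n%:R) = x `^ c * x ^+ n.
  move=> x0; rewrite powRD; last by rewrite (gt_eqF x0) implybT.
  by rewrite (powR_mulrn n (ltW x0)).
have expE x : expR (- ((1 + u) * x)) = expR (- (u * x)) * expR (- x).
  by rewrite -expRD; congr expR; ring.
transitivity (((Gamma_fun a)^-1)%:E * \int[lebesgue_measure]_(x in `]0%R, +oo[)
    ((1 + u) * x `^ (a + k%:R) * expR (- ((1 + u) * x)))%:E)%E.
  rewrite I1// -I2//.
  apply: eq_integral => x; rewrite inE/= in_itv/= andbT => x0.
  rewrite /gamma_monomial indicE mem_set/=; last by rewrite in_itv/= ltW.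
  have -> : a + k%:R = a - 1 + k.+1%:R by rewrite -natr1; ring.
  by rewrite powE// /f expE; congr EFin; ring.
rewrite -gamma_integral_by_parts// I1// -I2//.
apply: eq_integral => x; rewrite inE/= in_itv/= andbT => x0.
rewrite /gamma_monomial indicE mem_set/=; last by rewrite in_itv/= ltW.
have -> : a + k%:R - 1 = a - 1 + k%:R by ring.
by rewrite powE// /f expE; congr EFin; ring.
Qed.

(** The moment of order 0 is at most 1. An infinite moment of order k + 1 would make the left side
    of the recursion infinite while its right side is finite by induction. *)
Lemma gamma_moment_fin k u : 0 <= u ->
  (\int[Pr]_w (gamma_monomial k u (Z w))%:E < +oo)%E.
Proof.
move=> u0; elim: k => [|k IH].
  apply: (@le_lt_trans _ _ (\int[Pr]_w (cst 1%E w))%E); last first.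
    by rewrite integral_cst//= mul1e (le_lt_trans (probability_le1 _ _))// ltry.
  apply: ge0_le_integral => //.
  - by move=> w _; rewrite lee_fin gamma_monomial_ge0.
  - apply/measurable_EFinP; apply: measurableT_comp => //.
    exact: measurable_gamma_monomial.
  - move=> w _; rewrite lee_fin /gamma_monomial expr0 mul1r indicE mem_setE in_itv/= andbT.
    case: (leP 0 (Z w)) => [z0|_]; last by rewrite mulr0.
    by rewrite mulr1 expR_le1 oppr_le0 mulr_ge0.
have := gamma_moment_step k u0.
have v0 : 0 < 1 + u by rewrite ltr_pwDl.
case: (\int[Pr]_w (gamma_monomial k.+1 u (Z w))%:E)%E => [r|E|//].
  by rewrite ltry.
have : ((a + k%:R)%:E * \int[Pr]_w (gamma_monomial k u (Z w))%:E < +oo)%E.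
  by rewrite lte_mul_pinfty// lee_fin addr_ge0.
by rewrite -E gt0_muley.
Qed.

End gamma_moments.

Lemma measurable_fun_invr (R : realType) :
  measurable_fun [set: R] (fun x : R => x^-1).
Proof.
(* Inversion is reduced to the real power function; at 0 both sides take the value 0. *)
rewrite (_ : (fun _ => _) = fun x : R => x * (x ^+ 2) `^ (-1)); last first.
  apply/funext => x; rewrite powR_inv1 ?sqr_ge0//.
  have [->|x0] := eqVneq x 0; first by rewrite mul0r invr0.
  by rewrite expr2 invfM mulrA divff// mul1r.
apply: measurable_funM => //.
apply: (measurableT_comp (measurable_powR (-1)) (g := fun x : R => x ^+ 2)).
exact: measurable_funX.
Qed.

(** * Dirichlet moments through ratios of gamma variables *)

Section dirichlet.
Context (R : realType) (n : nat) (alpha : 'I_n -> R).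
Hypotheses (alpha0 : forall j, 0 <= alpha j) (alpha_gt0 : 0 < \sum_j alpha j).

(* The absolute value is harmless, as the coordinates will be nonnegative, and
   it makes the monomial nonnegative on all tuples. *)
Definition tuple_monomial (k : 'I_n -> nat) (x : n.-tuple R) : R :=
  `|\prod_(i < n) tnth x i ^+ k i|.

Lemma measurable_tuple_monomial k :
  measurable_fun [set: n.-tuple R] (tuple_monomial k).
Proof.
apply: measurableT_comp => //; apply: measurable_prod => i _.
by apply: measurable_funX; exact: measurable_tnth.
Qed.

Lemma tuple_monomial_ge0 k x : 0 <= tuple_monomial k x.
Proof. exact: normr_ge0. Qed.

Section gamma_ratios.
Local Open Scope ereal_scope.
Context d (T : measurableType d) (Q : probability T R) (Z : 'I_n -> {RV Q >-> R}).
Hypothesis indepZ : independent Q [set: 'I_n] (fun j => rv_events (Z j)).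
Hypothesis lawZ : forall j (A : set R), measurable A ->
  Q (Z j @^-1` A) = gamma_law (alpha j) A.

Let ratio w := [tuple (Z j w / \sum_(k < n) Z k w)%R | j < n].

(** Some [alpha j] is positive, and that gamma variable alone makes the sum positive. So the ratios
    are almost surely genuine proportions. *)
Let aeZ : {ae Q, forall w, (forall j, 0 <= Z j w)%R /\ (0 < \sum_j Z j w)%R}.
Proof.
have [j0 aj0] : exists j, (0 < alpha j)%R.
  apply: contrapT => H; have := alpha_gt0.
  rewrite big1 ?ltxx// => j _; apply/eqP; rewrite eq_le alpha0 andbT leNgt.
  by apply/negP => aj; apply: H; exists j.
have H0 : {ae Q, forall w, forall j, (0 <= Z j w)%R}.
  by apply: filter_forall => j; exact: (gamma_law_ge0 (lawZ j)).
have H1 := gamma_law_gt0 (lawZ j0) aj0.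
apply: filterS2 H0 H1 => w Z0 Zj0; split=> //.
by rewrite (bigD1 j0)//= ltr_pwDl// sumr_ge0.
Qed.

(** By independence this is E[prod_i Z_i^(k_i) e^(-u S)], with S the sum of the Z_i. The product
    form lets a single exponent be raised. *)
Let L (k : 'I_n -> nat) (u : R) :=
  \prod_(i < n) \int[Q]_w (gamma_monomial (k i) u (Z i w))%:E.

Let mgam (k : 'I_n -> nat) : measurable_fun [set: T * measurableTypeR R]
  (fun wu => \prod_(i < n) gamma_monomial (k i) wu.2 (Z i wu.1))%R.
Proof.
apply: measurable_prod => i _.
have mZ : measurable_fun [set: T * measurableTypeR R] (fun wu => Z i wu.1).
  exact: measurableT_comp.
have mI : measurable_fun [set: R] (\1_(`[0%R, +oo[%classic : set R) : R -> R).
  exact: measurable_indic.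
apply: measurable_funM; last exact: (measurableT_comp mI mZ).
apply: measurable_funM; first exact: measurable_funX.
apply: measurableT_comp => //; apply: measurableT_comp => //.
by apply: measurable_funM => //; exact: measurable_snd.
Qed.

Let L_E k u : (0 <= u)%R ->
  \int[Q]_w (\prod_(i < n) gamma_monomial (k i) u (Z i w))%:E = L k u.
Proof.
move=> u0; rewrite /L.
have -> // := @indep_integral_prod R _ T Q 'I_n setT (fun j => rv_events (Z j))
  indepZ _ (fun i w => gamma_monomial (k i) u (Z i w)) (index_enum _).
- move=> i _; apply: smallest_sub; first exact: sigma_algebra_measurable.
  by move=> _ [B mB <-]; rewrite setTI; exact: measurable_funPTI.
- exact: index_enum_uniq.
- move=> i _ _ B mB; rewrite setTI; apply: sub_sigma_algebra.
  exists (gamma_monomial (k i) u @^-1` B).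
    by rewrite -[X in measurable X]setTI; exact: measurable_gamma_monomial.
  by rewrite setTI.
- by move=> i w; exact: gamma_monomial_ge0.
- by move=> i _; exact: (gamma_moment_fin (alpha0 i) (lawZ i)).
Qed.

Let incr (k : 'I_n -> nat) j i : nat := (k i + (i == j))%N.

Let L_incr k j u : (0 <= u)%R ->
  (1 + u)%:E * L (incr k j) u = (alpha j + (k j)%:R)%:E * L k u.
Proof.
move=> u0; rewrite /L (bigD1 j)//= [in RHS](bigD1 j)//= !muleA.
rewrite {1}/incr eqxx addn1 (gamma_moment_step (alpha0 j) (lawZ j))//.
by congr (_ * _); apply: eq_bigr => i /negPf ij; rewrite /incr ij addn0.
Qed.

Let mratio : measurable_fun [set: T] ratio.
Proof.
apply/measurable_fun_tnthP => i.
rewrite (_ : _ \o _ = fun w => (Z i w / \sum_(k < n) Z k w)%R); last first.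
  by apply/funext => w /=; rewrite tnth_mktuple.
apply: measurable_funM => //.
apply: (measurableT_comp (@measurable_fun_invr R)).
exact: measurable_sum.
Qed.

Let mtm k : measurable_fun [set: T] (fun w => tuple_monomial k (ratio w)).
Proof. exact: (measurableT_comp (measurable_tuple_monomial k) mratio). Qed.

Let moment k := \int[Q]_w (tuple_monomial k (ratio w))%:E.

Let G k N (wu : T * measurableTypeR R) : R :=
  ((wu.2 ^+ N * \1_(`]0%R, +oo[%classic : set R) wu.2) *
   \prod_(i < n) gamma_monomial (k i) wu.2 (Z i wu.1))%R.

Let mG k N : measurable_fun [set: T * measurableTypeR R] (fun wu => (G k N wu)%:E).
Proof.
apply/measurable_EFinP; apply: measurable_funM => //.
have mI : measurable_fun [set: R] (\1_(`]0%R, +oo[%classic : set R) : R -> R).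
  exact: measurable_indic.
apply: measurable_funM; last exact: (measurableT_comp mI measurable_snd).
by apply: measurable_funX; exact: measurable_snd.
Qed.

Let G0 k N wu : (0 <= G k N wu)%R.
Proof.
rewrite /G indicE mem_setE in_itv/= andbT mulr_ge0//; last first.
  by apply: prodr_ge0 => i _; exact: gamma_monomial_ge0.
by case: (ltP 0%R wu.2) => u0; rewrite ?mulr0// mulr_ge0// exprn_ge0// ltW.
Qed.

Let incr_sum k j N : (\sum_i k i = N)%N -> (\sum_i incr k j i = N.+1)%N.
Proof.
move=> kN; rewrite big_split/= kN (bigD1 j)//= eqxx big1 ?addn0 ?addn1//.
by move=> i /negPf ->.
Qed.

Let integral_G k N w : (forall j, 0 <= Z j w)%R -> (0 < \sum_j Z j w)%R ->
  (\sum_i k i = N.+1)%N ->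
  \int[lebesgue_measure]_u (G k N (w, u))%:E =
  N`!%:R%:E * (tuple_monomial k (ratio w))%:E.
Proof.
move=> Z0 S0 kN; set S := (\sum_j Z j w)%R in S0 *.
have c0 : (0 <= \prod_(i < n) Z i w ^+ k i)%R.
  by apply: prodr_ge0 => i _; exact: exprn_ge0.
transitivity (\int[lebesgue_measure]_(u in `]0%R, +oo[)
    ((\prod_(i < n) Z i w ^+ k i) * (u ^+ N * expR (- (S * u))))%:E).
  rewrite [RHS]integral_mkcond; apply: eq_integral => u _.
  rewrite patchE /G/= indicE; case: ifP => [|_]; last by rewrite mulr0 mul0r.
  rewrite inE/= in_itv/= andbT => u0; rewrite mulr1 mulrCA; congr (_ * _)%:E.
  rewrite /S mulr_suml -sumrN expR_sum -big_split/=; apply: eq_bigr => i _.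
  rewrite /gamma_monomial indicE mem_set ?mulr1 ?[(u * _)%R]mulrC//=.
  by rewrite in_itv/= andbT.
rewrite ge0_integralZl_real//; last 2 first.
- apply: measurable_funTS; apply: measurable_funM; first exact: measurable_funX.
  by apply: measurableT_comp => //; apply: measurableT_comp.
- by move=> u; rewrite /= in_itv/= andbT => u0; rewrite mulr_ge0 ?expR_ge0// exprn_ge0// ltW.
rewrite integral_expr_expRN// -!EFinM; congr EFin.
rewrite /tuple_monomial mulrCA; congr (_ * _)%R.
under [in RHS]eq_bigr do rewrite tnth_mktuple expr_div_n.
rewrite ger0_norm; last first.
  by apply: prodr_ge0 => i _; rewrite divr_ge0 ?exprn_ge0// ltW.
by rewrite big_split/= prodfV -kN -expr_sum.
Qed.

(* 1 / S^(N+1) = (1 / N!) * int_0^oo u^N e^(-uS) du, and e^(-uS) is a product of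
   functions of the independent Z_i. *)
Let moment_mixture k j N : (\sum_i k i = N)%N ->
  N`!%:R%:E * moment (incr k j) =
  \int[lebesgue_measure]_(u in `]0%R, +oo[) ((u ^+ N)%:E * L (incr k j) u).
Proof.
move=> /(incr_sum j) kN.
rewrite /moment -ge0_integralZl_real//; last first.
  by move=> w _; exact: tuple_monomial_ge0.
transitivity (\int[Q]_w \int[lebesgue_measure]_u (G (incr k j) N (w, u))%:E).
  apply: ge0_ae_eq_integral => //.
  - apply/measurable_EFinP; exact: measurable_funM.
  - apply: (measurable_fun_fubini_tonelli_F
      (fun wu => (G (incr k j) N wu)%:E)) => //.
    by move=> wu; rewrite lee_fin.
  - by move=> w _; rewrite lee_fin mulr_ge0// tuple_monomial_ge0.
  - by move=> w _; apply: integral_ge0 => u _; rewrite lee_fin.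
  - by apply: filterS aeZ => w [Z0 S0] _; rewrite integral_G// EFinM.
rewrite (fubini_tonelli (fun wu => (G (incr k j) N wu)%:E))//; last first.
  by move=> wu; rewrite lee_fin.
rewrite [RHS]integral_mkcond; apply: eq_integral => u _.
rewrite patchE; case: ifP => [|u0]; last first.
  by rewrite integral0_eq// => w _; rewrite /G/= indicE u0 mulr0 mul0r.
rewrite inE/= in_itv/= andbT => u0.
rewrite -L_E ?ltW// -ge0_integralZl_real//; last 3 first.
- by rewrite exprn_ge0// ltW.
- apply: measurable_prod => i _.
  exact: (measurableT_comp (measurable_gamma_monomial _ _)).
- by move=> w _; apply: prodr_ge0 => i _; exact: gamma_monomial_ge0.
apply: eq_integral => w _; rewrite /G/= indicE mem_set ?mulr1//=.
by rewrite in_itv/= u0.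
Qed.

Let mL k : measurable_fun (`]0%R, +oo[%classic : set (measurableTypeR R)) (L k).
Proof.
apply: (eq_measurable_fun (fun u =>
    \int[Q]_w (\prod_(i < n) gamma_monomial (k i) u (Z i w))%:E)).
  by move=> u; rewrite inE/= in_itv/= andbT => u0; rewrite L_E// ltW.
apply: measurable_funTS.
apply: (measurable_fun_fubini_tonelli_G (m1 := Q)
  (fun wu => (\prod_(i < n) gamma_monomial (k i) wu.2 (Z i wu.1))%:E)).
- by apply/measurable_EFinP; exact: mgam.
- by move=> wu; rewrite lee_fin; apply: prodr_ge0 => i _; exact: gamma_monomial_ge0.
Qed.

Let L0 k u : 0 <= L k u.
Proof.
apply: prode_ge0 => i _; apply: integral_ge0 => w _.
by rewrite lee_fin gamma_monomial_ge0.
Qed.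

(** K is 1/N! times the integral of u^N [L k u] / (1 + u): raising coordinate [j] multiplies [L] by
    (alpha_j + k_j) / (1 + u), whose denominator does not involve [j]. K stays an extended real and
    is never cancelled. *)
Let moment_incr k N : (\sum_i k i = N)%N -> exists K, forall j,
  moment (incr k j) = (alpha j + (k j)%:R)%:E * K.
Proof.
move=> kN; pose K := \int[lebesgue_measure]_(u in `]0%R, +oo[)
  ((u ^+ N / (1 + u))%:E * L k u).
exists ((N`!%:R^-1)%:E * K) => j.
have Nf : (N`!%:R != 0 :> R)%R by rewrite pnatr_eq0 -lt0n fact_gt0.
transitivity ((N`!%:R^-1)%:E * (N`!%:R%:E * moment (incr k j))).
  by rewrite muleA -EFinM mulVf// mul1e.
rewrite (moment_mixture _ kN) muleCA; congr (_ * _).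
rewrite /K -ge0_integralZl//.
- apply: eq_integral => u; rewrite inE/= in_itv/= andbT => u0.
  have v0 : (1 + u != 0)%R by rewrite gt_eqF// ltr_pwDl// ltW.
  rewrite muleCA -(L_incr _ _ (ltW u0)) muleA -EFinM.
  by rewrite -mulrA mulVf// mulr1.
- apply: emeasurable_funM; last exact: mL.
  apply/measurable_EFinP; apply: measurable_funTS; apply: measurable_funM.
    exact: measurable_funX.
  apply: (measurableT_comp (@measurable_fun_invr R)).
  exact: measurable_funD.
- move=> u; rewrite /= in_itv/= andbT => u0; rewrite mule_ge0// lee_fin.
  by rewrite divr_ge0 ?addr_ge0 ?exprn_ge0// ltW.
- by rewrite lee_fin addr_ge0.
Qed.

(** Almost surely the ratios sum to 1. The mixture formula treats total degree N + 1, hence at least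
    1, so [moment k], possibly of degree 0, is reached through its raised versions. *)
Let moment_split k : moment k = \sum_j moment (incr k j).
Proof.
rewrite /moment -ge0_integral_sum//; last 2 first.
- by move=> j; exact/measurable_EFinP.
- by move=> j w _; rewrite lee_fin tuple_monomial_ge0.
apply: ge0_ae_eq_integral => //.
- exact/measurable_EFinP.
- by apply: emeasurable_sum => j; exact/measurable_EFinP.
- by move=> w _; rewrite lee_fin tuple_monomial_ge0.
- by move=> w _; apply: sume_ge0 => j _; rewrite lee_fin tuple_monomial_ge0.
apply: filterS aeZ => w [Z0 S0] _; rewrite sumEFin; congr EFin.
have incrE j : tuple_monomial (incr k j) (ratio w) =
    (tuple_monomial k (ratio w) * (Z j w / \sum_i Z i w))%R.
  rewrite /tuple_monomial -[X in (_ * X)%R]ger0_norm; last first.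
    by rewrite divr_ge0// ltW.
  rewrite -normrM; congr `|_|%R.
  rewrite (bigD1 j)//= [in RHS](bigD1 j)//= tnth_mktuple {1}/incr eqxx addn1 exprSr.
  rewrite [RHS]mulrAC; congr (_ * _)%R.
  by apply: eq_bigr => i /negPf ij; rewrite /incr ij addn0.
under eq_bigr do rewrite incrE.
by rewrite -mulr_sumr -mulr_suml divff ?mulr1// gt_eqF.
Qed.

Lemma gamma_ratio_moment_step k j :
  ((\sum_i alpha i)%R + (\sum_i k i)%:R)%:E * moment (incr k j) =
  (alpha j + (k j)%:R)%:E * moment k.
Proof.
have [K KE] := moment_incr (erefl (\sum_i k i)%N).
rewrite KE muleCA moment_split; congr (_ * _).
under [RHS]eq_bigr do rewrite KE.
rewrite -ge0_sume_distrl; last by move=> i _; rewrite lee_fin addr_ge0.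
by rewrite sumEFin big_split/= natr_sum.
Qed.
End gamma_ratios.

Lemma dirichlet_moment_step d (Omega : measurableType d) (Pr : probability Omega R)
    (X : Omega -> n.-tuple R) (k : 'I_n -> nat) (j : 'I_n) :
  measurable_fun [set: Omega] X -> is_dirichlet Pr alpha X ->
  ((\sum_i alpha i + (\sum_i k i)%:R)%:E *
     \int[Pr]_w (tuple_monomial (fun i => k i + (i == j))%N (X w))%:E =
   (alpha j + (k j)%:R)%:E * \int[Pr]_w (tuple_monomial k (X w))%:E)%E.
Proof.
move=> mX [d' [T [Q [Z [indepZ lawZ lawX]]]]].
have mratio : measurable_fun [set: T]
    (fun w => [tuple Z j w / \sum_(k < n) Z k w | j < n]).
  apply/measurable_fun_tnthP => i.
  rewrite (_ : _ \o _ = fun w => (Z i w / \sum_(k < n) Z k w)%R); last first.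
    by apply/funext => w /=; rewrite tnth_mktuple.
  apply: measurable_funM => //.
  apply: (measurableT_comp (@measurable_fun_invr R)).
  exact: measurable_sum.
have tr k' : (\int[Pr]_w (tuple_monomial k' (X w))%:E =
    \int[Q]_w (tuple_monomial k' [tuple Z j w / \sum_(k < n) Z k w | j < n])%:E)%E.
  apply: (eq_integral_law (measurable_tuple_monomial k') (tuple_monomial_ge0 k')) => //.
by rewrite !tr gamma_ratio_moment_step.
Qed.

End dirichlet.

(** * Path statistics and renewal sequences *)

Section paths.
Local Open Scope nat_scope.
Context (E : eqType).
Implicit Types (s : nat -> E) (t : nat) (i j : E).

(** The maximum defining [path_l] is opened only here. Afterwards it is used through these three
    properties, which determine it. *)
Lemma path_l_unique s t m : m <= t ->
  (forall h, h <= m -> s (t - h) = s t) -> (m < t -> s (t - m.+1) != s t) ->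
  path_l s t = m.
Proof.
move=> mt sm sm1; apply/eqP; rewrite eqn_leq; apply/andP; split; last first.
  apply: (bigop.bigmax_sup (Ordinal (mt : m < t.+1))) => //=.
  by apply/forallP => h; apply/implyP => hm; rewrite sm.
apply/bigop.bigmax_leqP => k /forallP kP; rewrite leqNgt; apply/negP => mk.
have mt1 : m < t by apply: leq_trans mk _; rewrite -ltnS.
by have := kP (Ordinal (mt1 : m.+1 < t.+1)); rewrite /= mk/= (negPf (sm1 mt1)).
Qed.

Lemma path_lP s t : [/\ path_l s t <= t,
  forall h, h <= path_l s t -> s (t - h) = s t &
  path_l s t < t -> s (t - (path_l s t).+1) != s t].
Proof.
suff [m [mt sm sm1]] : exists m, [/\ m <= t,
    forall h, h <= m -> s (t - h) = s t & m < t -> s (t - m.+1) != s t].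
  by rewrite (path_l_unique mt sm sm1).
elim: t => [|t [m [mt sm sm1]]].
  by exists 0; split => // h; rewrite leqn0 => /eqP ->.
have [st|st] := eqVneq (s t.+1) (s t); last first.
  exists 0; split => //; first by move=> h; rewrite leqn0 => /eqP ->; rewrite subn0.
  by rewrite subSS subn0 eq_sym.
exists m.+1; split => //.
  by move=> [|h]; rewrite ?subn0// ltnS subSS => /sm ->.
by rewrite ltnS subSS st.
Qed.

Lemma path_x0 s : path_x s 0 = 1.
Proof. by rewrite /path_x; have [/[!leqn0]/eqP ->] := path_lP s 0. Qed.

Lemma path_xS s t :
  path_x s t.+1 = if s t.+1 == s t then (path_x s t).+1 else 1.
Proof.
have [lt sl sl1] := path_lP s t; rewrite /path_x.
have [st|st] := eqVneq (s t.+1) (s t); congr _.+1; apply: path_l_unique => //.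
- by move=> [|h]; rewrite ?subn0// ltnS subSS => /sl ->.
- by rewrite ltnS subSS st.
- by move=> h; rewrite leqn0 => /eqP ->; rewrite subn0.
- by rewrite subSS subn0 eq_sym.
Qed.

Lemma path_M0 s i j : path_M s 0 i j = 0.
Proof. by rewrite /path_M big_geq. Qed.

Lemma path_MS s t i j :
  path_M s t.+1 i j = path_M s t i j + ((s t == i) && (s t.+1 == j)).
Proof. by rewrite /path_M big_nat_recr. Qed.

Lemma path_N0 s i A : path_N s 0 i A = 0.
Proof.
apply: eq_card0 => -[[a ha] [l hl]]; rewrite inE /completed_visit /=.
by case: l hl => [|l] hl //=; rewrite addnS.
Qed.

(** The bound on the end of the visit is removed, so the dependence on [t] is confined to
    [a + l <= t]. *)
Let visit s i a l : bool :=
  [&& 0 < l, [forall u : 'I_l, s (a + u) == i], s (a + l) != i &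
      (a == 0) || (s a.-1 != i)].

Let completed_visitE s t i a l :
  completed_visit s t i a l = (a + l <= t) && visit s i a l.
Proof. by rewrite /completed_visit /visit andbCA. Qed.

(** A common square of side [T] makes the counts at [t] and [t.+1] sums over the same index range,
    to be compared term by term. *)
Let path_N_sum s t i A T : t < T -> path_N s t i A =
  \sum_(a < T) \sum_(l < T) ((a + l <= t) && visit s i a l && (nat_of_ord l \in A)).
Proof.
move=> tT; rewrite /path_N -sum1_card big_mkcond/=.
transitivity (\sum_(a < t.+1) \sum_(l < t.+1)
    ((a + l <= t) && visit s i a l && (nat_of_ord l \in A))).
  rewrite pair_bigA/=; apply: eq_bigr => -[a l] _/=.
  by rewrite inE/= completed_visitE; case: ifP.
rewrite (big_ord_widen T (fun a => \sum_(l < t.+1)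
  ((a + l <= t) && visit s i a l && (nat_of_ord l \in A))))// big_mkcond/=.
apply: eq_bigr => a _; case: ltnP => [at1|ta].
  rewrite (big_ord_widen T (fun l =>
    ((a + l <= t) && visit s i a l && (l \in A) : nat)))// big_mkcond/=.
  apply: eq_bigr => l _; case: ltnP => // tl.
  by rewrite leqNgt (leq_trans tl) ?leq_addl.
by rewrite big1// => l _; rewrite leqNgt (leq_trans ta) ?leq_addr.
Qed.

(** A visit that ends exactly at [t.+1] is the sojourn in progress at [t], which forces its
    length. *)
Let visit_endE s t i l : l <= t.+1 -> visit s i (t.+1 - l) l =
  [&& s t == i, s t.+1 != i & l == path_x s t].
Proof.
move=> lt1; rewrite /visit subnK//; have [lt sl sl1] := path_lP s t.
apply/and4P/and3P => [[l0 /forallP sv st1 sa]|[/eqP st st1 /eqP ->]].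
  case: l l0 lt1 sv sa => // m _ mt sv sa; rewrite subSS in sv sa.
  have sti : s t = i by have /eqP := sv ord_max; rewrite /= subnK.
  split => //; first exact/eqP.
  rewrite /path_x eqSS eq_sym; apply/eqP; apply: path_l_unique => //.
    move=> h hm; have hm' : m - h < m.+1 by rewrite ltnS leq_subr.
    have /eqP := sv (Ordinal hm'); rewrite /= sti => <-; congr s.
    by rewrite addnBA// subnK.
  move=> mt'; case/orP: sa => [|]; first by rewrite subn_eq0 leqNgt mt'.
  by rewrite subnS sti.
rewrite subSS; split => //.
  apply/forallP => -[u /=]; rewrite ltnS => ul.
  rewrite -st -(sl (path_l s t - u)) ?leq_subr//; apply/eqP; congr s.
  by rewrite subnBA// addnC addnBA// addnC.
have [lt'|] := ltnP (path_l s t) t; last by rewrite -subn_eq0 => ->.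
by rewrite -subnS -st sl1// orbT.
Qed.

Lemma path_NS s t i A : path_N s t.+1 i A = path_N s t i A +
  [&& s t == i, s t.+1 != i & path_x s t \in A].
Proof.
rewrite !(@path_N_sum _ _ _ _ t.+2)//.
(* Passing to [t.+1] adds the pairs with a + l = t + 1. The new sum runs over [l] first, since [l]
   determines a = t + 1 - l. *)
transitivity (\sum_(a < t.+2) \sum_(l < t.+2)
    ((a + l <= t) && visit s i a l && (nat_of_ord l \in A)) +
  \sum_(l < t.+2) \sum_(a < t.+2)
    ((a + l == t.+1) && visit s i a l && (nat_of_ord l \in A))).
  rewrite [X in _ = _ + X]exchange_big -big_split/=; apply: eq_bigr => a _.
  rewrite -big_split/=; apply: eq_bigr => l _.
  rewrite leq_eqVlt ltnS; case: eqP => [->|_]; last by rewrite addn0.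
  by rewrite ltnn.
congr (_ + _).
transitivity (\sum_(l < t.+2)
    [&& s t == i, s t.+1 != i, nat_of_ord l == path_x s t & nat_of_ord l \in A]).
  apply: eq_bigr => l _.
  have lt1 : l <= t.+1 by rewrite -ltnS.
  have al : t.+1 - l < t.+2 by rewrite ltnS leq_subr.
  rewrite (bigD1 (Ordinal al))//= subnK// eqxx visit_endE//= big1 ?addn0.
    by rewrite -!andbA.
  move=> a aN; case: eqP => //= atl; case/eqP: aN.
  by apply/val_inj/eqP; rewrite /= -(eqn_add2r l) atl subnK.
have xt : path_x s t < t.+2 by rewrite /path_x !ltnS; have [] := path_lP s t.
rewrite (bigD1 (Ordinal xt))//= eqxx big1 ?addn0//.
move=> l lx; rewrite (_ : (nat_of_ord l == path_x s t) = false) ?andbF//.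
by apply/negbTE; apply: contra lx => /eqP lx; apply/eqP/val_inj.
Qed.

End paths.

Section path_congruence.
Local Open Scope nat_scope.
Context (E : eqType) (s s' : nat -> E).

Lemma eq_path_x t : (forall u, u <= t -> s u = s' u) ->
  path_x s t = path_x s' t.
Proof.
elim: t => [|t IH] ss'; first by rewrite !path_x0.
by rewrite !path_xS IH ?ss'// => u ut; apply: ss'; exact: leqW.
Qed.

Lemma eq_path_M t i j : (forall u, u <= t -> s u = s' u) ->
  path_M s t i j = path_M s' t i j.
Proof.
elim: t => [|t IH] ss'; first by rewrite !path_M0.
by rewrite !path_MS IH ?ss'// => u ut; apply: ss'; exact: leqW.
Qed.

Lemma eq_path_N t i A : (forall u, u <= t -> s u = s' u) ->
  path_N s t i A = path_N s' t i A.
Proof.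
elim: t => [|t IH] ss'; first by rewrite !path_N0.
rewrite !path_NS IH ?(eq_path_x (t := t)) ?ss'//.
- by move=> u ut; apply: ss'; exact: leqW.
- by move=> u ut; apply: ss'; exact: leqW.
Qed.

End path_congruence.

Lemma path_NU (E : eqType) (s : nat -> E) t i (A B : set nat) :
  A `&` B = set0 -> (path_N s t i (A `|` B) = path_N s t i A + path_N s t i B)%N.
Proof.
move=> AB; elim: t => [|t IH]; first by rewrite !path_N0.
rewrite !path_NS IH addnACA; congr addn; rewrite in_setU.
have [xA|xA] := boolP (path_x s t \in A); have [xB|xB] := boolP (path_x s t \in B);
  rewrite ?andbT ?andbF ?addn0//.
have : (A `&` B) (path_x s t) by split; exact: set_mem.
by rewrite AB.
Qed.

(** * Counting renewals and reading a path off a renewal sequence *)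

Section renewal_count.
Local Open Scope nat_scope.
Variable T : nat -> nat.
Hypothesis T0 : forall n, 0 < T n.

Lemma tauS n : tau T n.+1 = tau T n + T n.
Proof. by rewrite /tau big_ord_recr. Qed.

Lemma leq_tau m n : m <= n -> tau T m <= tau T n.
Proof.
move=> /subnK <-; elim: (n - m) => // k IH.
by rewrite addSn tauS (leq_trans IH)// leq_addr.
Qed.

Lemma renewal_count_unique n t : tau T n <= t -> t < tau T n.+1 ->
  renewal_count T t = n.
Proof.
move=> tn tn1; rewrite /renewal_count.
(* The indicators summed by [renewal_count] are therefore 1 exactly for 1 <= k <= n, which leaves n
   terms. *)
have le k : (tau T k <= t) = (k <= n).
  apply/idP/idP => [|kn]; last exact: leq_trans (leq_tau kn) tn.
  by apply: contraTT; rewrite -!ltnNge => nk; exact: leq_trans tn1 (leq_tau nk).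
rewrite (fsbigE (iota 1 n)).
- rewrite big_seq_cond (eq_bigl (fun k => k \in iota 1 n)); last first.
    move=> k; rewrite mem_iota; case: (ltnP 0 k) => //= k0.
    by rewrite mem_set// andbT.
  rewrite (eq_bigr (fun=> 1)); last first.
    by move=> k; rewrite mem_iota add1n ltnS le => /andP[_ ->].
  by rewrite -big_seq big_const_seq count_predT size_iota iter_addn_0 mul1n.
- exact: iota_uniq.
- by move=> k /=; rewrite mem_iota => /andP[].
- move=> k /= k0; rewrite le mem_iota k0 add1n ltnS.
  by case: (k <= n).
Qed.
End renewal_count.

Section path_of_renewal.
Local Open Scope nat_scope.
Context (E : eqType) (l : nat -> E) (T : nat -> nat).
Hypothesis T0 : forall n, 0 < T n.

Fixpoint path_jumps (s : nat -> E) (t : nat) : nat :=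
  if t is u.+1 then path_jumps s u + (s u.+1 != s u) else 0.

(* Describes the jumps of the path s up to time t, but not the length of the
   sojourn in progress at time t. *)
Fixpoint jump_event (s : nat -> E) (t : nat) : Prop :=
  if t is u.+1 then
    jump_event s u /\ (s u.+1 != s u ->
      l (path_jumps s u).+1 = s u.+1 /\ T (path_jumps s u) = path_x s u)
  else l 0 = s 0.

(** The age [path_x s t] counts time [t] itself, hence the total [t.+1]: the sojourn in progress
    began at the renewal time [tau]. *)
Lemma jump_eventP s t : jump_event s t ->
  l (path_jumps s t) = s t /\ tau T (path_jumps s t) + path_x s t = t.+1.
Proof.
elim: t => [|t IH] /=; first by rewrite path_x0 /tau big_ord0.
move=> [/IH [ls lt]]; rewrite path_xS.
have [-> _|_ /(_ isT) [l1 T1]] := eqVneq (s t.+1) (s t).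
  by rewrite addn0 addnS lt.
by rewrite /= !addn1 tauS T1 lt.
Qed.

(** Censoring leaves only a lower bound on the holding time in progress. Distinct successive states
    make every renewal visible as a change of the path; otherwise two sojourns would merge. *)
Lemma path_of_renewalP s t : (forall n, l n.+1 != l n) ->
  (forall u, u <= t -> l (renewal_count T u) = s u) <->
  (jump_event s t /\ path_x s t <= T (path_jumps s t)).
Proof.
move=> ll.
have N_t u : jump_event s u -> path_x s u <= T (path_jumps s u) ->
    renewal_count T u = path_jumps s u.
  move=> /jump_eventP [_ tx] xT; apply: renewal_count_unique => //.
    by rewrite -ltnS -tx /path_x addnS ltnS leq_addr.
  by rewrite tauS -ltnS -tx ltnS leq_add2l.
elim: t => [|t IH].
  have N0 : renewal_count T 0 = 0.
    by apply: renewal_count_unique => //; rewrite ?tauS /tau big_ord0// add0n.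
  split=> [/(_ 0 isT)|[/= l0 _] u]; first by rewrite N0 path_x0.
  by rewrite leqn0 => /eqP ->; rewrite N0.
split=> [sl|].
  have [/IH [jt xt] slt] : (forall u, u <= t -> l (renewal_count T u) = s u) /\
      l (renewal_count T t.+1) = s t.+1.
    by split => [u ut|]; apply: sl => //; exact: leqW.
  have [ls tx] := jump_eventP jt.
  (* An age equal to the holding time means a renewal at t + 1, hence a jump; a smaller age means
     that the path stays. *)
  rewrite /= path_xS; move: xt; rewrite leq_eqVlt => /predU1P[xT|xT].
    have N1 : renewal_count T t.+1 = (path_jumps s t).+1.
      by apply: renewal_count_unique; rewrite // !tauS -xT tx// -addn1 leq_add2l.
    have st : s t.+1 != s t by rewrite -slt N1 -ls.
    by rewrite (negPf st) -N1 slt xT.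
  have N1 : renewal_count T t.+1 = path_jumps s t.
    apply: renewal_count_unique; first by rewrite -tx leq_addr.
    by rewrite tauS -tx ltn_add2l.
  by rewrite -slt N1 ls eqxx addn0.
move=> [/[dup] jS [jt jump] xS].
have NS := N_t _ jS xS.
have : path_x s t <= T (path_jumps s t).
  move: xS; rewrite path_xS/=; have [st|st] := eqVneq (s t.+1) (s t).
    by rewrite addn0 => /ltnW.
  by have [_ ->] := jump st.
move=> xt u; rewrite leq_eqVlt ltnS => /predU1P[->|ut].
  by rewrite NS; have [] := jump_eventP jS.
by move: u ut; apply/IH.
Qed.

End path_of_renewal.

(** * Path probabilities of a semi-Markov process *)

Lemma rv_events_measurable_fun d (Omega : measurableType d) (G : set (set Omega))
    d' (T : measurableType d') (X : Omega -> T) :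
  rv_events X `<=` G -> measurable_fun [set: g_sigma_algebraType G] X.
Proof.
move=> XG _ B mB; rewrite setTI; apply: sub_sigma_algebra; apply: XG.
by exists B => //; rewrite setTI.
Qed.

Section kernel_values.
Context d (Omega : measurableType d) (R : realType) d' (T : measurableType d')
  (k : R.-pker Omega ~> T).
Implicit Types (w : Omega) (A B : set T).

Lemma pker_le1 w A : measurable A -> (k w A <= 1)%E.
Proof.
by move=> mA; rewrite -(prob_kernel (s := k) w); apply: le_measure; rewrite ?inE.
Qed.

Lemma pker_fin w A : measurable A -> k w A \is a fin_num.
Proof. by move=> mA; rewrite ge0_fin_numE// (le_lt_trans (pker_le1 w mA))// ltry. Qed.

Lemma pker_itv01 w A : measurable A -> 0 <= fine (k w A) <= 1.
Proof.
by move=> mA; rewrite fine_ge0//= -lee_fin fineK ?pker_fin// pker_le1.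
Qed.

Lemma pkerU w A B : measurable A -> measurable B -> A `&` B = set0 ->
  fine (k w (A `|` B)) = fine (k w A) + fine (k w B).
Proof.
by move=> mA mB AB; rewrite measureU// fineD// pker_fin.
Qed.

Lemma measurable_pker A (G : set (set Omega)) : measurable A ->
  kernel_events k `<=` G ->
  measurable_fun [set: g_sigma_algebraType G] (fun w => fine (k w A)).
Proof.
move=> mA kG.
have mk : measurable_fun [set: g_sigma_algebraType G] (fun w => k w A).
  by apply: rv_events_measurable_fun => B [C mC <-]; apply: kG; exists A => //; exists C.
exact: (measurableT_comp (fine_measurable measurableT) mk).
Qed.

Lemma kernel_events_measurable : kernel_events k `<=` @measurable _ Omega.
Proof.
by move=> _ [A mA [B mB <-]]; apply: measurable_kernel.
Qed.

End kernel_values.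

(** * One renewal step, integrated against a function of the past *)

Section markov_renewal_steps.
Context (R : realType) d (Omega : measurableType d) (Pr : probability Omega R)
  dE (E : measurableType dE).
Hypotheses (E_countable : countable [set: E])
  (E_discrete : forall A : set E, measurable A).
Context (l0 : E) (P : E -> R.-pker Omega ~> E) (F : E -> R.-pker Omega ~> nat)
  (L : nat -> {RV Pr >-> E}) (T : nat -> {RV Pr >-> nat}).
Hypotheses (PF_couple : char_couple P F) (LT : markov_renewal l0 P F L T).

Let hist n := renewal_history P F L T n.

Lemma renewal_history_measurable n : <<s hist n >> `<=` @measurable _ Omega.
Proof.
apply: smallest_sub; first exact: sigma_algebra_measurable.
move=> A [[[i _ /kernel_events_measurable//]|[i _ /kernel_events_measurable//]]|].
by move=> [[k _]|[k _]] [B mB <-]; rewrite setTI; exact: measurable_funPTI.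
Qed.

Section step.
Variables (n : nat) (i : E) (H : Omega -> R).
Hypotheses (mH : measurable_fun [set: g_sigma_algebraType (hist n)] H)
  (H01 : forall w, 0 <= H w <= 1) (Hi : forall w, H w != 0 -> L n w = i).

Let p A w := fine (P i w A).
Let f A w := fine (F i w A).

Let H0 w : 0 <= H w. Proof. by have /andP[] := H01 w. Qed.
Let p0 A w : 0 <= p A w. Proof. exact: fine_ge0. Qed.
Let f0 A w : 0 <= f A w. Proof. exact: fine_ge0. Qed.

Let mHO : measurable_fun [set: Omega] H.
Proof. exact: (measurable_fun_sub_sigma (@renewal_history_measurable n)). Qed.

Let mp A : measurable_fun [set: Omega] (p A).
Proof.
apply: (@measurable_fun_sub_sigma _ _ (@measurable _ Omega)).
  by apply: smallest_sub => //; exact: sigma_algebra_measurable.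
by apply: measurable_pker => //; exact: kernel_events_measurable.
Qed.

Let mf A : measurable_fun [set: Omega] (f A).
Proof.
apply: (@measurable_fun_sub_sigma _ _ (@measurable _ Omega)).
  by apply: smallest_sub => //; exact: sigma_algebra_measurable.
by apply: measurable_pker => //; exact: kernel_events_measurable.
Qed.

Let mT (B : set nat) : measurable [set w | B (T n w)].
Proof. exact: (measurable_funPTI (T n) (_ : measurable B)). Qed.

Let mL (B : set E) : measurable [set w | B (L n.+1 w)].
Proof. exact: (measurable_funPTI (L n.+1) (E_discrete B)). Qed.

(* H weights a past in which L n = i. *)
Let step_le_state t j :
  (\int[Pr]_w (H w * \1_([set w | L n.+1 w = j /\ (T n w <= t)%N]) w)%:E =
   \int[Pr]_w (H w * (f [set u | (u <= t)%N] w * p [set j] w))%:E)%E.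
Proof.
(* The renewal property is prescribed for t >= 1 only. At t = 0 both sides are 0, as holding times
   are positive and [F i] has no mass at 0. *)
case: t => [|t].
  rewrite !integral0_eq// => w _; congr EFin.
    rewrite (_ : f _ w = 0) ?mul0r ?mulr0//.
    have [_ F0] := PF_couple w i.
    rewrite /f (_ : [set u | _] = [set 0%N]) ?F0//.
    by apply/seteqP; split => u /=; rewrite leqn0 => /eqP.
  rewrite indicE memNset ?mulr0//= => -[_].
  by have [_ T0 _] := LT; rewrite leqNgt T0.
have [_ _ /(_ n t.+1 j isT) [mY _ Ycond]] := LT.
have mA : measurable [set w | L n.+1 w = j /\ (T n w <= t.+1)%N].
  exact: (measurableI _ _ (mL [set j]) (mT [set u | (u <= t.+1)%N])).
pose Z w := fine (F (L n w) w [set u | (u <= t.+1)%N] * P (L n w) w [set j])%E.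
have ZE w : Z w = fine (F (L n w) w [set u | (u <= t.+1)%N]) *
    fine (P (L n w) w [set j]).
  by rewrite /Z fineM// pker_fin.
transitivity (\int[Pr]_w (H w * Z w)%:E)%E.
  apply: (integral_eq_sub_sigma (@renewal_history_measurable n)) => //.
  - apply: (measurable_fun_sub_sigma (@renewal_history_measurable n)).
    exact: (measurableT_comp (fine_measurable measurableT) mY).
  - by move=> w; rewrite ZE mulr_ge0// fine_ge0.
  - move=> B GB; have mB := renewal_history_measurable GB.
    rewrite integral_indic//; apply: (etrans (esym (Ycond _ GB))).
    apply: eq_integral => w _.
    by rewrite /Z fineK// fin_numM// pker_fin.
apply: eq_integral => w _; congr EFin; have [->|/Hi Lw] := eqVneq (H w) 0.
  by rewrite !mul0r.
by rewrite ZE Lw.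
Qed.

(** This is [step_le_state] summed over the next state. The injection [g] into the naturals turns
    the sum into a series, in which codes of no state contribute 0, and the row [P i] has total mass
    1. *)
Lemma renewal_step_le t :
  (\int[Pr]_w (H w * \1_([set w | (T n w <= t)%N]) w)%:E =
   \int[Pr]_w (H w * f [set u | (u <= t)%N] w)%:E)%E.
Proof.
have /countable_injP[g g_inj] := E_countable.
have {}g_inj : injective g by move=> x y; apply: g_inj; rewrite inE.
pose A k := [set w | g (L n.+1 w) = k].
have mA k : measurable (A k) by exact: (mL [set j | g j = k]).
have mTt := mT [set u | (u <= t)%N].
have A_T : \bigcup_k A k = setT.
  by apply/seteqP; split => // w _; exists (g (L n.+1 w)).
pose q k w := p [set j | g j = k] w.
have sum_q w : (\sum_(k <oo) (q k w)%:E = 1)%E.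
  rewrite -(prob_kernel (s := P i) w).
  rewrite -(_ : \bigcup_k [set j | g j = k] = setT); last first.
    by apply/seteqP; split => // j _; exists (g j).
  rewrite measure_bigcup//; last by move=> k k' _ _ [j [/= <- <-]].
  rewrite [RHS]eseries_mkcond; apply: eq_eseriesr => k _.
  by rewrite in_setT /q /p fineK ?pker_fin.
rewrite -[X in (\int[_]_(w in X) _)%E]A_T ge0_integral_bigcup//=; last 3 first.
- by rewrite A_T; apply/measurable_EFinP; apply: measurable_funM.
- by move=> w _; rewrite lee_fin mulr_ge0.
- by move=> k k' _ _ [w [/= <- <-]].
transitivity (\sum_(k <oo) \int[Pr]_w (H w * (f [set u | (u <= t)%N] w * q k w))%:E)%E.
  apply: eq_eseriesr => k _.
  rewrite integral_mkcond.
  have [[j gj]|gN] := pselect (exists j, g j = k).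
    rewrite (_ : q k = p [set j]); last first.
      rewrite /q; congr p; apply/seteqP; split => j' /=; last by move=> ->.
      by rewrite -gj => /g_inj.
    rewrite -step_le_state; apply: eq_integral => w _.
    rewrite patchE !indicE.
    have [wA|wA] := boolP (w \in A k).
      congr (H w * (_ : bool)%:R)%:E; apply/idP/idP => /set_mem wT; apply/mem_set.
        by split=> //; apply: g_inj; rewrite gj; exact: set_mem.
      by case: wT.
    rewrite memNset ?mulr0// => -[Lj _]; move/negP: wA; apply; apply/mem_set.
    by rewrite /A /= Lj.
  rewrite !integral0_eq// => w _.
    rewrite (_ : q k w = 0) ?mulr0// /q /p (_ : [set _ | _] = set0) ?measure0//.
    by apply/seteqP; split => // j /= gj; apply: gN; exists j.
  rewrite patchE memNset//= => gL; apply: gN; by exists (L n.+1 w).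
rewrite -integral_nneseries//; last 2 first.
- move=> k; apply/measurable_EFinP; apply: measurable_funM => //.
  by apply: measurable_funM => //; exact: mp.
- by move=> k w _; rewrite lee_fin !mulr_ge0//; exact: p0.
apply: eq_integral => w _.
under eq_eseriesr do rewrite mulrA EFinM.
rewrite nneseriesZl; last by move=> k _; rewrite lee_fin; exact: p0.
by rewrite sum_q mule1.
Qed.

Let integral_itv01_fin (K : Omega -> R) : measurable_fun [set: Omega] K ->
  (forall w, 0 <= K w <= 1) -> (\int[Pr]_w (K w)%:E)%E \is a fin_num.
Proof.
move=> mK K01; rewrite ge0_fin_numE; last first.
  by apply: integral_ge0 => w _; rewrite lee_fin; have /andP[] := K01 w.
apply: (@le_lt_trans _ _ (\int[Pr]_w (cst 1%E w))%E); last first.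
  by rewrite integral_cst//= mul1e (le_lt_trans (probability_le1 _ _))// ltry.
apply: ge0_le_integral => //.
- by move=> w _; rewrite lee_fin; have /andP[] := K01 w.
- exact/measurable_EFinP.
- by move=> w _; rewrite lee_fin; have /andP[] := K01 w.
Qed.

Let mul01 (x y : R) : 0 <= x <= 1 -> 0 <= y <= 1 -> 0 <= x * y <= 1.
Proof. by move=> /andP[x0 x1] /andP[y0 y1]; rewrite mulr_ge0// mulr_ile1. Qed.

Let addIe (x y z : \bar R) :
  (z \is a fin_num -> x + z = y + z -> x = y)%E.
Proof. by move=> zf xy; rewrite -(addeK x zf) xy addeK. Qed.

(** Difference of the bounds t and t - 1 on the holding time. The subtracted integral is finite
    because [H] and the kernel values lie in [0, 1]. *)
Lemma renewal_step_eq t j : (0 < t)%N ->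
  (\int[Pr]_w (H w * \1_([set w | L n.+1 w = j /\ T n w = t]) w)%:E =
   \int[Pr]_w (H w * (f [set t] w * p [set j] w))%:E)%E.
Proof.
case: t => // t _.
have mLT (B : set nat) : measurable [set w | L n.+1 w = j /\ B (T n w)].
  exact: (measurableI _ _ (mL [set j]) (mT B)).
have mI (B : set nat) :
    measurable_fun setT (\1_[set w | L n.+1 w = j /\ B (T n w)] : Omega -> R).
  exact: measurable_indic.
have := step_le_state t.+1 j.
have -> : (\int[Pr]_w (H w * \1_([set w | L n.+1 w = j /\ (T n w <= t.+1)%N]) w)%:E =
    \int[Pr]_w (H w * \1_([set w | L n.+1 w = j /\ T n w = t.+1]) w)%:E +
    \int[Pr]_w (H w * \1_([set w | L n.+1 w = j /\ (T n w <= t)%N]) w)%:E)%E.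
  rewrite -ge0_integralD//.
  - apply: eq_integral => w _; rewrite -EFinD -mulrDr; congr (H w * _)%:E.
    have memE b (B : set nat) : (forall u, reflect (B u) (b u)) ->
        (w \in [set w | L n.+1 w = j /\ B (T n w)]) = (L n.+1 w == j) && b (T n w).
      move=> bP; apply/idP/andP => [/set_mem[-> /bP ->]|[/eqP Lj /bP Tb]]; first by rewrite eqxx.
      exact/mem_set.
    have le_t x : (w \in [set w | L n.+1 w = j /\ (T n w <= x)%N]) =
        (L n.+1 w == j) && (T n w <= x)%N.
      exact: (memE (fun u => u <= x)%N [set u | (u <= x)%N] (fun u => idP)).
    have eq_t : (w \in [set w | L n.+1 w = j /\ T n w = t.+1]) =
        (L n.+1 w == j) && (T n w == t.+1).
      exact: (memE (fun u => u == t.+1) [set t.+1] (fun u => eqP)).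
    rewrite !indicE -natrD !le_t eq_t; congr _%:R.
    case: eqP => //= _; rewrite leq_eqVlt ltnS.
    by case: eqP => // ->; rewrite ltnn.
  - by move=> w _; rewrite lee_fin mulr_ge0.
  - by apply/measurable_EFinP; apply: measurable_funM => //; exact: (mI [set t.+1]).
  - by move=> w _; rewrite lee_fin mulr_ge0.
  - by apply/measurable_EFinP; apply: measurable_funM => //; exact: (mI [set u | (u <= t)%N]).
have -> : (\int[Pr]_w (H w * (f [set u | (u <= t.+1)%N] w * p [set j] w))%:E =
    \int[Pr]_w (H w * (f [set t.+1] w * p [set j] w))%:E +
    \int[Pr]_w (H w * (f [set u | (u <= t)%N] w * p [set j] w))%:E)%E.
  rewrite -ge0_integralD//.
  - apply: eq_integral => w _; rewrite -EFinD -mulrDr -mulrDl; congr (H w * (_ * _))%:E.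
    rewrite /f -pkerU//.
      congr (fine (F i w _)); apply/seteqP; split => u /=.
        by rewrite leq_eqVlt ltnS => /predU1P.
      by move=> [->//|/leqW].
    by apply/seteqP; split => u //= -[->]; rewrite ltnn.
  - by move=> w _; rewrite lee_fin !mulr_ge0.
  - by apply/measurable_EFinP; apply: measurable_funM => //; exact: measurable_funM.
  - by move=> w _; rewrite lee_fin !mulr_ge0.
  - by apply/measurable_EFinP; apply: measurable_funM => //; exact: measurable_funM.
rewrite (step_le_state t j); apply: addIe; apply: integral_itv01_fin.
  by apply: measurable_funM => //; exact: measurable_funM.
by move=> w; apply: mul01 => //; apply: mul01; exact: pker_itv01.
Qed.

(** Complement of [renewal_step_le] inside the total integral of [H]. *)
Lemma renewal_step_gt t :
  (\int[Pr]_w (H w * \1_([set w | (t < T n w)%N]) w)%:E =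
   \int[Pr]_w (H w * f [set u | (t < u)%N] w)%:E)%E.
Proof.
have mI (B : set nat) : measurable_fun setT (\1_[set w | B (T n w)] : Omega -> R).
  exact: measurable_indic.
have : (\int[Pr]_w (H w)%:E = \int[Pr]_w (H w * \1_([set w | (t < T n w)%N]) w)%:E +
    \int[Pr]_w (H w * \1_([set w | (T n w <= t)%N]) w)%:E)%E.
  rewrite -ge0_integralD//.
  - apply: eq_integral => w _; rewrite -EFinD -mulrDr -[in LHS](mulr1 (H w)); congr (H w * _)%:E.
    rewrite !indicE -natrD.
    have [tT|tT] := ltnP t (T n w).
      by rewrite mem_set// memNset//= leqNgt tT.
    by rewrite memNset ?mem_set//= ltnNge tT.
  - by move=> w _; rewrite lee_fin mulr_ge0.
  - by apply/measurable_EFinP; apply: measurable_funM => //; exact: (mI [set u | (t < u)%N]).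
  - by move=> w _; rewrite lee_fin mulr_ge0.
  - by apply/measurable_EFinP; apply: measurable_funM => //; exact: (mI [set u | (u <= t)%N]).
have -> : (\int[Pr]_w (H w)%:E = \int[Pr]_w (H w * f [set u | (t < u)%N] w)%:E +
    \int[Pr]_w (H w * f [set u | (u <= t)%N] w)%:E)%E.
  rewrite -ge0_integralD//.
  - apply: eq_integral => w _; rewrite -EFinD -mulrDr -[in LHS](mulr1 (H w)); congr (H w * _)%:E.
    rewrite /f -pkerU//.
      rewrite (_ : _ `|` _ = setT) ?prob_kernel//.
      by apply/seteqP; split => u //= _; case: (leqP u t); [right|left].
    by apply/seteqP; split => u //= -[]; case: leqP.
  - by move=> w _; rewrite lee_fin mulr_ge0.
  - by apply/measurable_EFinP; exact: measurable_funM.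
  - by move=> w _; rewrite lee_fin mulr_ge0.
  - by apply/measurable_EFinP; exact: measurable_funM.
rewrite renewal_step_le => /esym; apply: addIe; apply: integral_itv01_fin.
  exact: measurable_funM.
by move=> w; apply: mul01 => //; exact: pker_itv01.
Qed.
End step.
End markov_renewal_steps.

(** * Path probabilities as expectations over the random couple *)

Section path_probability.
Context (R : realType) d (Omega : measurableType d) (Pr : probability Omega R)
  dE (E : measurableType dE).
Hypotheses (E_countable : countable [set: E])
  (E_discrete : forall A : set E, measurable A).
Context (l0 : E) (P : E -> R.-pker Omega ~> E) (F : E -> R.-pker Omega ~> nat).
Hypothesis PF_couple : char_couple P F.

(** Conditional probability, given the couple, of the completed sojourns and jumps of a path from
    [l0]. The survival factor of the sojourn in progress is kept apart. *)
Fixpoint path_weight (s : nat -> E) (t : nat) (w : Omega) : R :=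
  if t is u.+1 then
    path_weight s u w *
    (if s u.+1 == s u then 1
     else fine (F (s u) w [set path_x s u]) * fine (P (s u) w [set s u.+1]))
  else 1.

Definition couple_events : set (set Omega) := family_events P `|` family_events F.

Lemma couple_events_measurable : <<s couple_events >> `<=` @measurable _ Omega.
Proof.
apply: smallest_sub; first exact: sigma_algebra_measurable.
by move=> A [[i _ /kernel_events_measurable//]|[i _ /kernel_events_measurable//]].
Qed.

Lemma measurable_couple_P i A :
  measurable_fun [set: g_sigma_algebraType couple_events] (fun w => fine (P i w A)).
Proof. by apply: measurable_pker => // B BP; left; exists i. Qed.

Lemma measurable_couple_F i A :
  measurable_fun [set: g_sigma_algebraType couple_events] (fun w => fine (F i w A)).
Proof. by apply: measurable_pker => // B BP; right; exists i. Qed.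

Section renewal.
Context (L : nat -> {RV Pr >-> E}) (T : nat -> {RV Pr >-> nat}).
Hypothesis LT : markov_renewal l0 P F L T.

Let hist n := renewal_history P F L T n.

Let T0 n w : (0 < T n w)%N. Proof. by case: LT. Qed.

Let C s t := [set w | jump_event (fun n => L n w) (fun n => T n w) s t].

Let C_jump s t : s t.+1 != s t -> C s t.+1 = C s t `&`
  [set w | L (path_jumps s t).+1 w = s t.+1 /\ T (path_jumps s t) w = path_x s t].
Proof.
move=> st; apply/seteqP; split => w /= [Cw]; first by move=> /(_ st).
by move=> ?; split.
Qed.

Let C_stay s t : s t.+1 = s t -> C s t.+1 = C s t.
Proof.
by move=> st; apply/seteqP; split => w /= => [[]//|Cw]; rewrite st eqxx.
Qed.

(** With n jumps so far, the event involves only L_0, ..., L_n and T_0, ..., T_(n-1). This is the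
    past given which the law of (L_(n+1), T_n) is prescribed. *)
Let jump_history s t : <<s hist (path_jumps s t) >> (C s t).
Proof.
have hX d' (T' : measurableType d') n (X : Omega -> T') B :
    rv_events X `<=` hist n -> measurable B -> <<s hist n >> (X @^-1` B).
  by move=> Xh mB; apply: sub_sigma_algebra; apply: Xh; exists B; rewrite ?setTI.
elim: t => [|t IH].
  apply: (hX _ _ _ (L 0%N) [set s 0%N]) => // A AL.
  by right; left; exists 0%N.
have [st|st] := eqVneq (s t.+1) (s t).
  by rewrite C_stay//= st eqxx addn0.
rewrite C_jump//= st addn1; set n := path_jumps s t.
apply: (@measurableI _ (g_sigma_algebraType (hist n.+1))).
  apply: sub_sigma_algebra2 IH => A [|[|]]; [by left|move=> [k /= kn Ak]|move=> [k /= kn Ak]].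
    by right; left; exists k => //=; exact: leqW.
  by right; right; exists k => //=; exact: leqW.
apply: (@measurableI _ (g_sigma_algebraType (hist n.+1)) (L n.+1 @^-1` [set s t.+1])
  (T n @^-1` [set path_x s t])).
  by apply: hX => // A AL; right; left; exists n.+1 => /=.
by apply: hX => // A AL; right; right; exists n => /=.
Qed.

Let mC s t : measurable (C s t).
Proof. by apply: renewal_history_measurable; exact: jump_history. Qed.

Let ae_L0 : {ae Pr, forall w, L 0%N w = l0}.
Proof.
have [L0 _ _] := LT; exists (L 0%N @^-1` ~` [set l0]); split.
- exact: measurable_funPTI.
- rewrite -preimage_setC probability_setC; last exact: measurable_funPTI.
  by rewrite L0 subee.
- by move=> w /=.
Qed.

(** The zero diagonal of the transition matrix excludes renewals that stay in place. State and
    holding time are fixed so that the one-step formula applies; both range over countable sets,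
    which then covers all cases. *)
Let negligible_stay n i x :
  Pr.-negligible [set w | [/\ L n w = i, L n.+1 w = i & T n w = x]].
Proof.
have mS : measurable [set w | L n.+1 w = i /\ T n w = x].
  apply: (measurableI (L n.+1 @^-1` [set i]) (T n @^-1` [set x])).
    exact: measurable_funPTI.
  exact: measurable_funPTI.
have mLi : measurable (L n @^-1` [set i]) by exact: measurable_funPTI.
rewrite (_ : mkset _ = L n @^-1` [set i] `&` [set w | L n.+1 w = i /\ T n w = x]); last first.
  by apply/seteqP; split=> w /= [? []] *; split.
apply/negligibleP; first exact: measurableI.
case: x mS => [|x] mS.
  rewrite (_ : _ `&` _ = set0) ?measure0//; apply/seteqP; split => w //= [_ [_ Tx]].
  by have := T0 n w; rewrite Tx.
have := @renewal_step_eq _ _ _ Pr _ _ E_discrete _ _ _ L T PF_couple LT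
  n i (\1_(L n @^-1` [set i])).
move=> /(_ _ _ _ x.+1 i isT) H.
transitivity (\int[Pr]_w (\1_(L n @^-1` [set i]) w *
  \1_([set w | L n.+1 w = i /\ T n w = x.+1]) w)%:E)%E.
  have mLS := measurableI _ _ mLi mS.
  have := integral_indic Pr measurableT mLS.
  by rewrite setIT indicI => /esym.
rewrite H.
- rewrite integral0_eq// => w _.
  by have [-> _] := PF_couple w i; rewrite !mulr0.
- apply: measurable_indic; apply: sub_sigma_algebra; right; left.
  by exists n => //=; exists [set i]; rewrite ?setTI.
- by move=> w; rewrite indicE ler0n lern1 leq_b1.
- by move=> w; rewrite indicE; have [/set_mem//|_] := boolP (w \in _); rewrite eqxx.
Qed.

Let ae_L_jump : {ae Pr, forall w, forall n, L n.+1 w != L n w}.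
Proof.
apply/ae_foralln => n.
have /countable_injP[g g_inj] := E_countable.
have {}g_inj : injective g by move=> x y; apply: g_inj; rewrite inE.
apply: (@negligibleS _ _ _ _ (\bigcup_k \bigcup_x
    [set w | [/\ g (L n w) = k, L n.+1 w = L n w & T n w = x]])).
  move=> w /= /negP; rewrite negbK => /eqP LL.
  by exists (g (L n w)) => //; exists (T n w).
apply: negligible_bigcup => k; apply: negligible_bigcup => x.
have [[i gi]|gN] := pselect (exists i, g i = k).
  apply: negligibleS (negligible_stay n i x) => w /= [gL LL Tx].
  have Li : L n w = i by apply: g_inj; rewrite gi.
  by split; rewrite ?LL.
apply: negligibleS (negligible_set0 _) => w /= [gL _ _].
by apply: gN; exists (L n w).
Qed.

Let C_hist_fun s t (X : Omega -> R) :
  measurable_fun [set: g_sigma_algebraType couple_events] X ->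
  measurable_fun [set: g_sigma_algebraType (hist (path_jumps s t))]
    (fun w => X w * \1_(C s t) w).
Proof.
move=> mX; apply: measurable_funM.
  move=> _ B mB; apply: sub_sigma_algebra2 (mX measurableT B mB).
  by move=> A PFA; left.
by apply: measurable_indic; exact: jump_history.
Qed.

Let C_state s t w (x : R) : x * \1_(C s t) w != 0 -> L (path_jumps s t) w = s t.
Proof.
rewrite indicE; have [/set_mem Cw _|_] := boolP (w \in C s t); last by rewrite mulr0 eqxx.
by have [] := jump_eventP Cw.
Qed.

Let X01 (X : Omega -> R) s t w : 0 <= X w <= 1 -> 0 <= X w * \1_(C s t) w <= 1.
Proof.
by rewrite indicE; case: (w \in _); rewrite ?mulr1// mulr0 lexx ler01.
Qed.

(** The weight [X] is arbitrary so that the induction can absorb into it the factor [G] of a jump: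
    both depend on the couple alone and take values in [0, 1]. *)
Lemma integral_path_weight s t (X : Omega -> R) : s 0%N = l0 ->
  measurable_fun [set: g_sigma_algebraType couple_events] X ->
  (forall w, 0 <= X w <= 1) ->
  (\int[Pr]_w (X w * \1_(C s t) w)%:E = \int[Pr]_w (X w * path_weight s t w)%:E)%E.
Proof.
move=> s0; elim: t X => [|t IH] X mX X_01.
  have mXO := measurable_fun_sub_sigma couple_events_measurable mX.
  apply: ge0_ae_eq_integral => //=.
  - by apply/measurable_EFinP; apply: measurable_funM => //; exact: measurable_indic.
  - by apply/measurable_EFinP; apply: measurable_funM.
  - by move=> w _; rewrite lee_fin; have /andP[] := X01 s 0 (X_01 w).
  - by move=> w _; rewrite lee_fin mulr1; have /andP[] := X_01 w.
  - by apply: filterS ae_L0 => w Lw _; rewrite indicE mem_set//= /C /= Lw s0.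
have [st|st] := eqVneq (s t.+1) (s t).
  rewrite C_stay// IH//; apply: eq_integral => w _.
  by rewrite /= st eqxx mulr1.
pose G w := fine (F (s t) w [set path_x s t]) * fine (P (s t) w [set s t.+1]).
have G01 w : 0 <= G w <= 1.
  have /andP[f0 f1] : 0 <= fine (F (s t) w [set path_x s t]) <= 1 by exact: pker_itv01.
  have /andP[p0 p1] : 0 <= fine (P (s t) w [set s t.+1]) <= 1 by exact: pker_itv01.
  by rewrite mulr_ge0// mulr_ile1.
transitivity (\int[Pr]_w (X w * G w * \1_(C s t) w)%:E)%E; last first.
  rewrite IH.
  - by apply: eq_integral => w _; rewrite /= (negPf st) -/(G w) -mulrA [G w * _]mulrC.
  - apply: measurable_funM => //; apply: measurable_funM.
      exact: measurable_couple_F.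
    exact: measurable_couple_P.
  - move=> w; have /andP[x0 x1] := X_01 w; have /andP[g0 g1] := G01 w.
    by rewrite mulr_ge0// mulr_ile1.
transitivity (\int[Pr]_w (X w * \1_(C s t) w * G w)%:E)%E; last first.
  by apply: eq_integral => w _; rewrite mulrAC.
rewrite -(renewal_step_eq E_discrete PF_couple LT (C_hist_fun (s := s) (t := t) mX))//.
- apply: eq_integral => w _; rewrite C_jump// -mulrA; congr (X w * _)%:E.
  by rewrite indicI.
- by move=> w; exact: X01.
- by move=> w; exact: C_state.
Qed.

Let integral_sojourn s t : s 0%N = l0 ->
  (\int[Pr]_w (\1_(C s t) w *
     \1_([set w | (path_l s t < T (path_jumps s t) w)%N]) w)%:E =
   \int[Pr]_w (path_weight s t w * fine (F (s t) w [set u | (path_l s t < u)%N]))%:E)%E.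
Proof.
move=> s0; under eq_integral do rewrite -[\1_(C s t) _]mul1r.
have m1 : measurable_fun [set: g_sigma_algebraType couple_events] (cst (1 : R)) by [].
have h01 w : 0 <= (1 : R) * \1_(C s t) w <= 1 by apply: X01; rewrite ler01 lexx.
have hC w : 1 * \1_(C s t) w != 0 :> R -> L (path_jumps s t) w = s t.
  exact: C_state.
rewrite (renewal_step_gt E_countable E_discrete PF_couple LT
  (C_hist_fun (s := s) (t := t) m1) h01 hC).
under eq_integral do rewrite mul1r mulrC.
rewrite integral_path_weight//.
- by apply: eq_integral => w _; rewrite mulrC.
- exact: measurable_couple_F.
- by move=> w; exact: pker_itv01.
Qed.

Lemma markov_renewal_path_prob (S : nat -> {RV Pr >-> E}) s t :
  {ae Pr, forall w, forall u : nat,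
    S u w = L (renewal_count (fun n => T n w) u) w} ->
  s 0%N = l0 ->
  (Pr [set w | forall u, (u <= t)%N -> S u w = s u] =
   \int[Pr]_w (path_weight s t w * fine (F (s t) w [set u | (path_l s t < u)%N]))%:E)%E.
Proof.
move=> SL s0; rewrite -integral_sojourn//.
have mS : measurable [set w | forall u, (u <= t)%N -> S u w = s u].
  rewrite (_ : mkset _ = \bigcap_(u in [set u | (u <= t)%N]) (S u @^-1` [set s u])).
    by apply: bigcap_measurable => [|u _]; [exists t => /=|exact: measurable_funPTI].
  by apply/seteqP; split.
have := integral_indic Pr measurableT mS; rewrite setIT => /esym PrS.
apply: (etrans PrS).
have mTl : measurable [set w | (path_l s t < T (path_jumps s t) w)%N].
  exact: (measurable_funPTI (T (path_jumps s t)) (Y := [set u | (path_l s t < u)%N])).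
apply: ge0_ae_eq_integral => //.
- exact/measurable_EFinP/measurable_indic.
- by apply/measurable_EFinP; apply: measurable_funM; exact: measurable_indic.
apply: filterS2 SL ae_L_jump => w SL LL _; congr EFin.
rewrite !indicE -natrM mulnb -in_setI; congr (nat_of_bool _)%:R.
(* Since [path_x] is the successor of [path_l], its condition on the age is the strict inequality on
   [path_l] under which the survival factor was integrated. *)
have PP := path_of_renewalP (fun n => T0 n w) s t LL.
apply/idP/idP => /set_mem wS; apply/mem_set.
  by have [] := PP.1 (fun u ut => etrans (esym (SL u)) (wS u ut)).
by move=> u ut; rewrite SL; apply: PP.2.
Qed.

Lemma markov_renewal_start (S : nat -> {RV Pr >-> E}) :
  {ae Pr, forall w, forall u : nat,
    S u w = L (renewal_count (fun n => T n w) u) w} ->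
  {ae Pr, forall w, S 0%N w = l0}.
Proof.
move=> SL; apply: filterS2 SL ae_L0 => w SL L0.
rewrite SL (_ : renewal_count _ _ = 0%N)//.
by apply: renewal_count_unique; rewrite /tau ?big_ord0// big_ord_recr big_ord0/= add0n.
Qed.

End renewal.
End path_probability.

(** * One-step ratios of the path probabilities *)

Section Dir_step.
Context (R : realType) d (Omega : measurableType d) (Pr : probability Omega R)
  dE (E : measurableType dE).
Hypothesis E_discrete : forall A : set E, measurable A.
Context (m : {measure set E -> \bar R}).
Hypotheses (m_gt0 : (0 < m [set: E])%E) (m_fin : (m [set: E] < +oo)%E).
Context (P : R.-pker Omega ~> E).
Hypothesis P_Dir : is_Dir Pr m P.

(** Dirichlet laws speak of finite partitions. The cells are the singletons of [V] and, at the last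
    index, the complement of [V] with exponent 0, which completes the total parameter to m(E). *)
Lemma Dir_moment_step (V : seq E) (n : E -> nat) (j : E) :
  uniq V -> j \in V ->
  ((fine (m [set: E]) + (\sum_(h <- V) n h)%:R)%:E *
     \int[Pr]_w (\prod_(h <- V) fine (P w [set h]) ^+ n h * fine (P w [set j]))%:E =
   (fine (m [set j]) + (n j)%:R)%:E *
     \int[Pr]_w (\prod_(h <- V) fine (P w [set h]) ^+ n h)%:E)%E.
Proof.
move=> uV jV; pose N := size V.
pose v (k : 'I_N.+1) := nth point V k.
pose A (k : 'I_N.+1) : set E := if (k < N)%N then [set v k] else ~` [set` V].
pose e (k : 'I_N.+1) := if (k < N)%N then n (v k) else 0%N.
have mfin (B : set E) : m B \is a fin_num.
  by rewrite ge0_fin_numE// (le_lt_trans _ m_fin)// le_measure// inE.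
have A_triv : trivIset [set: 'I_N.+1] A.
  move=> k k' _ _ [x []]; rewrite /A.
  case: ltnP => kN; case: ltnP => k'N /=.
  - move=> -> /eqP; rewrite nth_uniq// => /eqP kk'; exact/val_inj.
  - by move=> ->; rewrite /v mem_nth.
  - by move=> xV xk'; move: xV; rewrite xk' mem_nth.
  - have k1 : (k <= N)%N by rewrite -ltnS.
    have k2 : (k' <= N)%N by rewrite -ltnS.
    move=> _ _; apply/val_inj/eqP; rewrite eqn_leq.
    by rewrite (leq_trans k1 k'N) (leq_trans k2 kN).
have A_cover : \bigcup_k A k = [set: E].
  apply/seteqP; split => // x _; have [xV|xV] := boolP (x \in V).
    have xN : (index x V < N)%N by rewrite index_mem.
    exists (Ordinal (leq_trans xN (leqnSn N))) => //=.
    by rewrite /A /= xN /v /= nth_index.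
  by exists ord_max => //=; rewrite /A /= ltnn /=; exact/negP.
have Am k : measurable (A k) by [].
have Xdir := P_Dir Am A_triv A_cover.
have mX : measurable_fun [set: Omega] (fun w => [tuple fine (P w (A k)) | k < N.+1]).
  apply/measurable_fun_tnthP => k.
  rewrite (_ : _ \o _ = fun w => fine (P w (A k))); last first.
    by apply/funext => w /=; rewrite tnth_mktuple.
  apply: (@measurable_fun_sub_sigma _ _ (@measurable _ Omega)).
    by apply: smallest_sub => //; exact: sigma_algebra_measurable.
  by apply: measurable_pker => //; exact: kernel_events_measurable.
have sum_alpha : \sum_k fine (m (A k)) = fine (m [set: E]).
  have -> : [set: E] = \big[setU/set0]_(k < N.+1) A k.
    rewrite -bigcup_seq; apply/esym/seteqP; split => // x _.
    have : (\bigcup_k A k) x by rewrite A_cover.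
    by move=> [k _ Akx]; exists k => //=; rewrite mem_index_enum.
  rewrite measure_semi_additive_ord//.
  by rewrite sum_fine.
have big_split_V (T : Type) (idx : T) (op : Monoid.law idx) (g : 'I_N.+1 -> T) (h : E -> T) :
    (forall k : 'I_N.+1, (k < N)%N -> g k = h (v k)) -> g ord_max = idx ->
    \big[op/idx]_k g k = \big[op/idx]_(x <- V) h x.
  move=> gh gmax; rewrite big_ord_recr/= gmax Monoid.mulm1 (big_nth point) big_mkord.
  by apply: eq_bigr => k _; rewrite gh//=.
have monE e' n' : (forall k : 'I_N.+1, (k < N)%N -> e' k = n' (v k)) ->
    e' ord_max = 0%N -> forall w,
    tuple_monomial e' [tuple fine (P w (A k)) | k < N.+1] =
    \prod_(h <- V) fine (P w [set h]) ^+ n' h.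
  move=> en emax w; rewrite /tuple_monomial ger0_norm; last first.
    by apply: prodr_ge0 => k _; rewrite exprn_ge0// tnth_mktuple fine_ge0.
  apply: big_split_V => [k kN|]; rewrite tnth_mktuple; last by rewrite emax.
  by rewrite en// /A kN.
have jN : (index j V < N)%N by rewrite index_mem.
pose jj : 'I_N.+1 := Ordinal (leq_trans jN (leqnSn N)).
have vjj : v jj = j by rewrite /v nth_index.
have alpha_gt0 : 0 < \sum_(k < N.+1) fine (m (A k)).
  by rewrite sum_alpha fine_gt0// m_gt0.
have alpha_ge0 k : 0 <= fine (m (A k)) by exact: fine_ge0.
have jjN : (jj < N)%N by [].
have Aj : A jj = [set j] by rewrite /A jjN vjj.
have ej : e jj = n j by rewrite /e jjN vjj.
have esum : (\sum_k e k = \sum_(h <- V) n h)%N.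
  apply: big_split_V => [k kN|]; first by rewrite /e kN.
  by rewrite /e /= ltnn.
have := dirichlet_moment_step alpha_ge0 alpha_gt0 e jj mX Xdir.
rewrite sum_alpha esum Aj ej => step.
transitivity ((fine (m [set: E]) + (\sum_(h <- V) n h)%:R)%:E *
  \int[Pr]_w (tuple_monomial (fun k => e k + (k == jj))%N
    [tuple fine (P w (A k)) | k < N.+1])%:E)%E.
  congr (_ * _)%E; apply: eq_integral => w _.
  rewrite (monE _ (fun h => n h + (h == j))%N).
  - under [in RHS]eq_bigr do rewrite exprD.
    rewrite big_split/=; congr (_ * _)%:E.
    rewrite (bigD1_seq j)//= eqxx expr1 big1 ?mulr1//.
    by move=> h /negPf ->.
  - move=> k kN; rewrite /e kN; congr addn; congr nat_of_bool.
    apply/eqP/eqP => [->|vk]; first exact: vjj.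
    by apply/val_inj/eqP; rewrite -(nth_uniq point kN jN uV) -/(v k) vk /= nth_index.
  - rewrite /e ltnn /= add0n; apply/eqP; rewrite eqb0; apply/eqP => /(congr1 val) /= NE.
    by have := jN; rewrite -NE ltnn.
rewrite step; congr (_ * _)%E; apply: eq_integral => w _.
by rewrite (monE _ n)//= => [k kN|]; rewrite /e ?kN// ltnn.
Qed.
End Dir_step.

(** With [h] the point masses of F^i, this collects the factors of [path_weight] that come from
    F^i. *)
Fixpoint sojourn_prod (R : pzSemiRingType) (E : eqType) (s : nat -> E) (i : E)
    (h : nat -> R) (t : nat) : R :=
  if t is u.+1 then
    sojourn_prod s i h u *
    (if (s u == i) && (s u.+1 != s u) then h (path_x s u) else 1)
  else 1.

Section sojourn_prodE.
Context (R : comPzRingType) (U : nat -> R).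

Let survival t := \prod_(1 <= k < t.+1) (1 - U k).

(** Here and in [prod_expr_le], indicator exponents spread factors over the whole range 1, ..., T,
    so that they merge with a monomial by adding exponents. *)
Lemma prod_expr_eq T x : (0 < x <= T)%N ->
  \prod_(1 <= y < T.+1) U y ^+ (x == y) = U x.
Proof.
move=> /andP[x0 xT]; rewrite (bigD1_seq x) ?iota_uniq//=; last first.
  by rewrite mem_index_iota x0 ltnS.
rewrite eqxx expr1 big1 ?mulr1// => y yx.
by rewrite eq_sym (negPf yx) expr0.
Qed.

Lemma prod_expr_le T x : (x <= T)%N ->
  \prod_(1 <= y < T.+1) (1 - U y) ^+ (y <= x)%N = survival x.
Proof.
move=> xT; rewrite /survival (big_cat_nat (n := x.+1))//=.
rewrite [X in _ * X]big_nat [X in _ * X]big1 ?mulr1; last first.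
  by move=> y /andP[xy _]; rewrite leqNgt xy expr0.
rewrite big_nat [RHS]big_nat; apply: eq_bigr => y /andP[_ yx].
by rewrite -ltnS yx expr1.
Qed.

(** A completed visit of length x contributes U_x and one factor 1 - U_y for each y < x. Collected
    over the visits to [i], U_y is counted by the visits of length y, and 1 - U_y by the longer
    ones. *)
Lemma sojourn_prodE (E : eqType) (s : nat -> E) i (h : nat -> R) T t :
  (forall y, h y.+1 = U y.+1 * survival y) -> (t <= T)%N ->
  sojourn_prod s i h t = \prod_(1 <= y < T.+1)
    (U y ^+ path_N s t i [set y] * (1 - U y) ^+ path_N s t i [set u | (y < u)%N]).
Proof.
move=> hU; elim: t => [_|t IH tT] /=.
  by rewrite big1// => y _; rewrite !path_N0 !expr0 mulr1.
have lT : (path_l s t < T)%N by have [lt _ _] := path_lP s t; exact: leq_ltn_trans lt tT.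
rewrite IH ?(ltnW tT)//.
have [sti|sti] := eqVneq (s t) i; last first.
  rewrite mulr1; apply: eq_bigr => y _.
  by rewrite !path_NS (negPf sti)/= !addn0.
have [st|st] := eqVneq (s t.+1) (s t).
  rewrite mulr1; apply: eq_bigr => y _.
  by rewrite !path_NS st sti eqxx !addn0.
rewrite /= /path_x hU -(prod_expr_eq (T := T) (x := (path_l s t).+1))//.
rewrite -(prod_expr_le (T := T) (x := path_l s t)) ?(ltnW lT)//.
rewrite -!big_split/=; apply: eq_bigr => y _.
rewrite !path_NS -sti eqxx st/= /path_x.
have -> : ((path_l s t).+1 \in [set y]) = ((path_l s t).+1 == y).
  by apply/idP/eqP => [/set_mem|->]//; exact/mem_set.
have -> : ((path_l s t).+1 \in [set u | (y < u)%N]) = (y <= path_l s t)%N.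
  by apply/idP/idP => [/set_mem|?]//; exact/mem_set.
by rewrite !exprD mulrACA.
Qed.

End sojourn_prodE.

(** * The one-step ratio for the sojourn laws *)

Section BS_step.
Context (R : realType) d (Omega : measurableType d) (Pr : probability Omega R)
  (c : nat -> R) (F0 : probability nat R) (F : R.-pker Omega ~> nat).
Hypotheses (c_gt0 : forall t, (0 < t)%N -> 0 < c t)
  (F0_tail : forall t : nat, (0 < F0 [set u | (t < u)%N])%E).
Hypothesis F_BS : is_BS Pr c F0 F.

Lemma BS_moment_step (E : eqType) (s : nat -> E) (t : nat) :
  let x := path_x s t in
  let N := path_N s t (s t) in
  let a w := sojourn_prod s (s t) (fun y => fine (F w [set y])) t in
  let D := c x * fine (F0 [set u | (x <= u)%N]) + (N [set u | (x <= u)%N])%:R in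
  let I g := (\int[Pr]_w (a w * g w)%:E)%E in
  (D%:E * I (fun w => fine (F w [set u | (x < u)%N])) =
   (c x * fine (F0 [set u | (x < u)%N]) + (N [set u | (x < u)%N])%:R)%:E *
     I (fun w => fine (F w [set u | (path_l s t < u)%N])))%E /\
  (D%:E * I (fun w => fine (F w [set x])) =
   (c x * fine (F0 [set x]) + (N [set x])%:R)%:E *
     I (fun w => fine (F w [set u | (path_l s t < u)%N])))%E.
Proof.
move=> x N a D I.
have [U [indepU lawU FU]] := F_BS.
have xt : (x <= t.+1)%N by rewrite /x /path_x ltnS; have [] := path_lP s t.
have ge_split : [set u | (x <= u)%N] = [set x] `|` [set u | (x < u)%N].
  apply/seteqP; split => u /=; first by rewrite leq_eqVlt eq_sym => /predU1P.
  by move=> [->//|/ltnW].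
have eq_gt0 : [set x] `&` [set u | (x < u)%N] = set0.
  by apply/seteqP; split => u //= [->]; rewrite ltnn.
have DE : D = c x * fine (F0 [set x]) + c x * fine (F0 [set u | (x < u)%N]) +
    (N [set x] + N [set u | (x < u)%N])%:R.
  rewrite /D ge_split measureU// /N path_NU// fineD ?fin_num_measure//.
  by rewrite mulrDr.
pose e y p q := (\int[Pr]_w (beta_monomial p q (U y w))%:E)%E.
have expect (p q : nat -> nat) : (\int[Pr]_w (\prod_(1 <= y < t.+2)
    beta_monomial (p y) (q y) (U y w))%:E = \prod_(1 <= y < t.+2) e y (p y) (q y))%E.
  have -> // := @indep_integral_prod R _ Omega Pr nat [set t | (0 < t)%N]
    (fun y => rv_events (U y)) indepU _
    (fun y w => beta_monomial (p y) (q y) (U y w)) (index_iota 1 t.+2).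
  - move=> y _; apply: smallest_sub; first exact: sigma_algebra_measurable.
    by move=> _ [B mB <-]; rewrite setTI; exact: measurable_funPTI.
  - exact: iota_uniq.
  - by move=> y; rewrite mem_index_iota => /andP[].
  - move=> y _ _ B mB; rewrite setTI; apply: sub_sigma_algebra.
    exists (beta_monomial (p y) (q y) @^-1` B).
      by rewrite -[X in measurable X]setTI; exact: measurable_beta_monomial.
    by rewrite setTI.
  - by move=> y w; have /andP[] := beta_monomial_itv01 (p y) (q y) (U y w).
  - move=> y _; rewrite ltey_eq; apply/orP; left; exact: beta_moment_fin.
(* As [beta_monomial] carries the indicator of [0, 1], it agrees with the plain monomial in U_y only
   almost surely. *)
have aeU : {ae Pr, forall w, forall y : nat, (0 < y)%N -> 0 <= U y w <= 1}.
  apply/ae_foralln => y; case: y => [|y]; first exact: aeW.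
  apply: filterS (beta_law_itv01 (fun A => lawU y.+1 A isT)) => w Uw _ //.
pose p0 y := N [set y]; pose q0 y := N [set u | (y < u)%N].
have mF B : measurable_fun [set: Omega] (fun w => fine (F w B)).
  apply: (@measurable_fun_sub_sigma _ _ (@measurable _ Omega)).
    by apply: smallest_sub => //; exact: sigma_algebra_measurable.
  by apply: measurable_pker => //; exact: kernel_events_measurable.
have ma_ i u : measurable_fun [set: Omega]
    (fun w => sojourn_prod s i (fun y => fine (F w [set y])) u).
  elim: u => [|u IH] /=; first exact: measurable_cst.
  apply: measurable_funM => //; case: (_ && _); last exact: measurable_cst.
  exact: mF.
have a0_ i u w : 0 <= sojourn_prod s i (fun y => fine (F w [set y])) u.
  elim: u => [|u IH] /=; first exact: ler01.
  by rewrite mulr_ge0//; case: ifP => _; rewrite ?ler01 ?fine_ge0.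
have ma : measurable_fun [set: Omega] a by exact: ma_.
have a0 w : 0 <= a w by exact: a0_.
have IE B (p q : nat -> nat) : {ae Pr, forall w, a w * fine (F w B) =
      \prod_(1 <= y < t.+2) beta_monomial (p y) (q y) (U y w)} ->
    I (fun w => fine (F w B)) = (\prod_(1 <= y < t.+2) e y (p y) (q y))%E.
  move=> H; rewrite -expect; apply: ge0_ae_eq_integral => //.
  - by apply/measurable_EFinP; exact: measurable_funM.
  - apply/measurable_EFinP; apply: measurable_prod => y _.
    by apply: measurableT_comp => //; exact: measurable_beta_monomial.
  - by move=> w _; rewrite lee_fin mulr_ge0// fine_ge0.
  - move=> w _; rewrite lee_fin; apply: prodr_ge0 => y _.
    by have /andP[] := beta_monomial_itv01 (p y) (q y) (U y w).
  - by apply: filterS H => w -> _.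
have aeF : {ae Pr, forall w, forall y, fine (F w [set y.+1]) =
    U y.+1 w * \prod_(1 <= k < y.+1) (1 - U k w)}.
  apply: filterS FU => w Fw y.
  have FyS : F w [set u | (y < u)%N] = (F w [set y.+1] + F w [set u | (y.+1 < u)%N])%E.
    rewrite -measureU//.
      congr (F w _); apply/seteqP; split => u /=; rewrite leq_eqVlt.
        by rewrite eq_sym => /predU1P.
      by move=> [->|/predU1P[<-|]]; rewrite ?eqxx// => yu; rewrite (ltn_trans _ yu) ?orbT.
    by apply/seteqP; split => u //= [->]; rewrite ltnn.
  have : fine (F w [set u | (y < u)%N]) =
      fine (F w [set y.+1]) + fine (F w [set u | (y.+1 < u)%N]).
    by rewrite FyS fineD// pker_fin.
  rewrite !Fw/= [in X in _ + X]big_nat_recr//= => /eqP.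
  by rewrite -subr_eq => /eqP <-; ring.
have aE : {ae Pr, forall w, a w = \prod_(1 <= y < t.+2)
    (U y w ^+ p0 y * (1 - U y w) ^+ q0 y)}.
  by apply: filterS aeF => w Fw; apply: (sojourn_prodE (U := fun y => U y w)).
(* The tail beyond [l] adds 1 to the exponent of 1 - U_y for each y <= l. It is used with l = x - 1
   before the step and l = x after a stay; the range up to t + 1 contains x. *)
have Igt l : (l <= t.+1)%N -> I (fun w => fine (F w [set u | (l < u)%N])) =
    (\prod_(1 <= y < t.+2) e y (p0 y) (q0 y + (y <= l)%N)%N)%E.
  move=> lt1; apply: IE; apply: filterS3 aE FU aeU => w -> Fw Uw.
  rewrite Fw/= -(prod_expr_le _ lt1) -big_split/=.
  rewrite big_nat [RHS]big_nat; apply: eq_bigr => y /andP[y0 _].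
  rewrite /beta_monomial indicE mem_set ?mulr1/=; last by rewrite in_itv/= Uw.
  by rewrite -mulrA -exprD.
have xl : x = (path_l s t).+1 by [].
have Ieq : I (fun w => fine (F w [set x])) =
    (\prod_(1 <= y < t.+2) e y (p0 y + (x == y))%N (q0 y + (y <= path_l s t)%N)%N)%E.
  apply: IE; apply: filterS3 aE aeF aeU => w -> Fw Uw.
  rewrite xl Fw -(prod_expr_le (fun k => U k w) (T := t.+1) (x := path_l s t)); last first.
    by rewrite ltnW.
  rewrite -(prod_expr_eq (fun k => U k w) (T := t.+1) (x := (path_l s t).+1))//.
  rewrite -!big_split/= big_nat [RHS]big_nat; apply: eq_bigr => y /andP[y0 _].
  rewrite /beta_monomial indicE mem_set ?mulr1/=; last by rewrite in_itv/= Uw.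
  by rewrite !exprD mulrACA.
have lt1 : (path_l s t <= t.+1)%N by rewrite ltnW// -xl.
have xI : x \in index_iota 1 t.+2 by rewrite mem_index_iota xl /= -xl ltnS.
rewrite Ieq !Igt//.
have uI : uniq (index_iota 1 t.+2) by exact: iota_uniq.
(* The three products differ only at y = x, where the exponents are (p0 x, q0 x) before the step,
   (p0 x, q0 x + 1) after a stay and (p0 x + 1, q0 x) after a jump. *)
rewrite !(bigD1_seq x xI uI).
have rest (f : nat -> \bar R) g : (forall y, y != x -> f y = g y) ->
    (\prod_(1 <= y < t.+2 | y != x) f y = \prod_(1 <= y < t.+2 | y != x) g y)%E.
  by move=> fg; apply: eq_bigr.
rewrite (rest (fun y => e y (p0 y) (q0 y + (y <= x)%N)%N)
  (fun y => e y (p0 y) (q0 y + (y <= path_l s t)%N)%N)); last first.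
  by move=> y yx; rewrite leq_eqVlt (negPf yx) xl ltnS.
rewrite (rest (fun y => e y (p0 y + (x == y))%N (q0 y + (y <= path_l s t)%N)%N)
  (fun y => e y (p0 y) (q0 y + (y <= path_l s t)%N)%N)); last first.
  by move=> y yx; rewrite eq_sym (negPf yx) addn0.
have xl0 : (x <= path_l s t)%N = false by rewrite xl ltnn.
rewrite leqnn eqxx xl0 !addn0 !addn1 !muleA.
have x0 : (0 < x)%N by [].
have [||stepP stepQ] := beta_moment_step _ _ (fun A => lawU x A x0) (p0 x) (q0 x).
- by rewrite mulr_ge0// ?fine_ge0// ltW// c_gt0.
- rewrite mulr_gt0 ?c_gt0// fine_gt0// F0_tail/=.
  by rewrite (le_lt_trans (probability_le1 _ _))// ltry.
by split; congr (_ * _)%E; rewrite DE; [exact: stepQ|exact: stepP].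
Qed.

End BS_step.

Fixpoint jump_prod (R : pzSemiRingType) (E : eqType) (s : nat -> E) (i : E)
    (h : E -> R) (t : nat) : R :=
  if t is u.+1 then
    jump_prod s i h u *
    (if (s u == i) && (s u.+1 != s u) then h (s u.+1) else 1)
  else 1.

(* path_M s t i i counts the steps during which the path stays in i. *)
Definition jump_count (E : eqType) (s : nat -> E) (t : nat) (i j : E) : nat :=
  if j == i then 0%N else path_M s t i j.

Lemma prod_seq_if (R : comPzSemiRingType) (E : eqType) (V : seq E) (k : E) (x : R) :
  uniq V -> k \in V -> \prod_(i <- V) (if k == i then x else 1) = x.
Proof.
move=> uV kV; rewrite (bigD1_seq k)//= eqxx big1 ?mulr1// => i ik.
by rewrite eq_sym (negPf ik).
Qed.

Lemma jump_prodE (R : comPzSemiRingType) (E : eqType) (s : nat -> E) (i : E)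
    (h : E -> R) (t : nat) (V : seq E) :
  uniq V -> (forall u, (u <= t)%N -> s u \in V) ->
  jump_prod s i h t = \prod_(j <- V) h j ^+ jump_count s t i j.
Proof.
move=> uV; elim: t => [_|t IH sV] /=.
  by rewrite big1// => j _; rewrite /jump_count path_M0; case: ifP.
rewrite IH; last by move=> u ut; apply: sV; exact: leqW.
rewrite /jump_count; have [sti|sti] := eqVneq (s t) i; last first.
  by rewrite mulr1; apply: eq_bigr => j _; rewrite path_MS (negPf sti) addn0.
have [st|st] := eqVneq (s t.+1) (s t).
  rewrite mulr1; apply: eq_bigr => j _; rewrite path_MS sti eqxx/= st sti.
  by rewrite [i == j]eq_sym; case: eqP => //; rewrite addn0.
rewrite /= -(prod_seq_if (h (s t.+1)) uV (sV t.+1 (leqnn _))) -big_split/=.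
apply: eq_bigr => j _; rewrite path_MS sti eqxx/=.
have [<-|jst] := eqVneq (s t.+1) j.
  by rewrite -sti (negPf st) addn1 exprSr.
by rewrite mulr1 addn0.
Qed.

(** The path never enters a state outside [V], so its counts vanish there and the sum over all
    states reduces to [V]. *)
Lemma sum_jump_count (R : numDomainType) (E : choiceType) (s : nat -> E) t i (V : seq E) :
  uniq V -> (forall u, (u <= t)%N -> s u \in V) ->
  \sum_(h \in [set h | h != i]) ((path_M s t i h)%:R : R) =
  (\sum_(h <- V) jump_count s t i h)%:R.
Proof.
move=> uV sV.
have M0 j : j \notin V -> path_M s t i j = 0%N.
  move=> jV; elim: t sV => [|t IH] sV; first by rewrite path_M0.
  rewrite path_MS IH; last by move=> u ut; apply: sV; exact: leqW.
  have [jE|_] := eqVneq (s t.+1) j; last by rewrite andbF.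
  by move: jV; rewrite -jE sV.
rewrite (fsbigE [seq h <- V | h != i]) ?filter_uniq//.
- rewrite big_filter_cond natr_sum [RHS](bigID (fun h => h != i))/=.
  rewrite [X in _ = _ + X]big1 ?addr0; last first.
    by move=> h; rewrite negbK /jump_count => ->.
  rewrite (eq_bigl (fun h => h != i)); last first.
    by move=> h; apply/andP/idP => [[]//|hi]; split => //; exact/mem_set.
  by apply: eq_bigr => h /negPf hi; rewrite /jump_count hi.
- by move=> h /=; rewrite mem_filter => /andP[].
- move=> h /= hi; rewrite mem_filter hi/= => hV; by rewrite M0.
Qed.

(** * Factorization over the visited states and the one-step identity *)

Section factorization.
Context (R : realType) d (Omega : measurableType d) (Pr : probability Omega R)
  dE (E : measurableType dE).
Hypothesis E_discrete : forall A : set E, measurable A.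
Context (m : E -> {measure set E -> \bar R}) (c : E -> nat -> R)
  (F0 : E -> probability nat R).
Hypotheses (m_gt0 : forall i, (0 < m i [set: E])%E)
  (m_fin : forall i, (m i [set: E] < +oo)%E)
  (c_gt0 : forall i t, (0 < t)%N -> 0 < c i t)
  (F0_tail : forall i (t : nat), (0 < F0 i [set u | (t < u)%N])%E).
Context (P : E -> R.-pker Omega ~> E) (F : E -> R.-pker Omega ~> nat).
Hypothesis PF_SMBS : SMBS Pr m c F0 P F.
Variable s : nat -> E.

Let p i w j := fine (P i w [set j]).
Let f i w y := fine (F i w [set y]).
Let a i t w := sojourn_prod s i (f i w) t.
Let b i t w := jump_prod s i (p i w) t.
(** The survival factor belongs to the law of the current state, hence the test on [s t]: each
    [A i t] depends on a single F^i. *)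
Let A i t w := a i t w * (if s t == i then fine (F i w [set u | (path_l s t < u)%N]) else 1).

Lemma path_weightE (V : seq E) t w : uniq V ->
  (forall u, (u <= t)%N -> s u \in V) ->
  path_weight P F s t w * fine (F (s t) w [set u | (path_l s t < u)%N]) =
  (\prod_(i <- V) b i t w) * \prod_(i <- V) A i t w.
Proof.
move=> uV sV; rewrite /A big_split/= mulrA; congr (_ * _); last first.
  rewrite (eq_bigr (fun i => if s t == i then
    fine (F (s t) w [set u | (path_l s t < u)%N]) else 1)); last first.
    by move=> i _; case: eqP => // ->.
  by rewrite prod_seq_if// sV.
rewrite -big_split/=; elim: t sV => [|t IH] sV /=; first by rewrite big1// => i _; rewrite mulr1.
rewrite IH; last by move=> u ut; apply: sV; exact: leqW.
rewrite /a /b/= -(prod_seq_if (if s t.+1 == s t then 1 else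
  fine (F (s t) w [set path_x s t]) * fine (P (s t) w [set s t.+1])) uV (sV t (leqnSn t))).
rewrite -big_split/=; apply: eq_bigr => i _.
have [<-|_] := eqVneq (s t) i; last by rewrite !mulr1.
have [_|_] := eqVneq (s t.+1) (s t); first by rewrite /= !mulr1.
by rewrite /= [fine _ * fine _]mulrC mulrACA.
Qed.

Let expect_b i t := (\int[Pr]_w (b i t w)%:E)%E.
Let expect_A i t := (\int[Pr]_w (A i t w)%:E)%E.

(** Independence is used in two layers: the rows against the sojourn laws, indexed by booleans, then
    inside each family over the states of [V]. All factors lie in [0, 1], so the expectations are
    finite. *)
Lemma path_prob_factor (V : seq E) t : uniq V ->
  (forall u, (u <= t)%N -> s u \in V) ->
  (\int[Pr]_w (path_weight P F s t w * fine (F (s t) w [set u | (path_l s t < u)%N]))%:E =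
   (\prod_(i <- V) expect_b i t) * \prod_(i <- V) expect_A i t)%E.
Proof.
move=> uV sV; under eq_integral do rewrite (path_weightE _ uV sV).
have fe_meas d' (T : measurableType d') (k : E -> R.-pker Omega ~> T) :
    <<s family_events k >> `<=` @measurable _ Omega.
  apply: smallest_sub; first exact: sigma_algebra_measurable.
  by move=> B [i _ /kernel_events_measurable].
have ke_meas d' (T : measurableType d') (k : E -> R.-pker Omega ~> T) i :
    <<s kernel_events (k i) >> `<=` @measurable _ Omega.
  by apply: smallest_sub; [exact: sigma_algebra_measurable|exact: kernel_events_measurable].
have mb_ (G : set (set Omega)) i u : kernel_events (P i) `<=` G ->
    measurable_fun [set: g_sigma_algebraType G] (b i u).
  move=> PG; rewrite /b; elim: u => [|u IH] /=; first exact: measurable_cst.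
  apply: measurable_funM => //; case: (_ && _); last exact: measurable_cst.
  exact: measurable_pker.
have ma_ (G : set (set Omega)) i u : kernel_events (F i) `<=` G ->
    measurable_fun [set: g_sigma_algebraType G] (a i u).
  move=> FG; rewrite /a; elim: u => [|u IH] /=; first exact: measurable_cst.
  apply: measurable_funM => //; case: (_ && _); last exact: measurable_cst.
  exact: measurable_pker.
have mA_ (G : set (set Omega)) i : kernel_events (F i) `<=` G ->
    measurable_fun [set: g_sigma_algebraType G] (A i t).
  move=> FG; apply: measurable_funM; first exact: ma_.
  case: eqP => _; last exact: measurable_cst.
  exact: measurable_pker.
have mul01 (x y : R) : 0 <= x <= 1 -> 0 <= y <= 1 -> 0 <= x * y <= 1.
  by move=> /andP[x0 x1] /andP[y0 y1]; rewrite mulr_ge0// mulr_ile1.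
have b01 i w : 0 <= b i t w <= 1.
  rewrite /b; elim: (t) => [|u IH] /=; first by rewrite ler01 lexx.
  apply: mul01 => //; case: ((s u == i) && _); last by rewrite ler01 lexx.
  exact: pker_itv01.
have a01 i u w : 0 <= a i u w <= 1.
  rewrite /a; elim: u => [|u IH] /=; first by rewrite ler01 lexx.
  apply: mul01 => //; case: ((s u == i) && _); last by rewrite ler01 lexx.
  exact: pker_itv01.
have A01 i w : 0 <= A i t w <= 1.
  by apply: mul01 => //; case: eqP => _; [exact: pker_itv01|rewrite ler01 lexx].
have prod01 (g : E -> Omega -> R) w : (forall i, 0 <= g i w <= 1) ->
    0 <= \prod_(i <- V) g i w <= 1.
  move=> g01; elim/big_ind: _ => [|x y|i _]; last exact: g01.
    by rewrite ler01 lexx.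
  exact: mul01.
have fin01 (g : Omega -> R) : measurable_fun [set: Omega] g ->
    (forall w, 0 <= g w <= 1) -> (\int[Pr]_w (g w)%:E < +oo)%E.
  move=> mg g01; apply: (@le_lt_trans _ _ (\int[Pr]_w (cst 1%E w))%E); last first.
    by rewrite integral_cst//= mul1e (le_lt_trans (probability_le1 _ _))// ltry.
  apply: ge0_le_integral => //.
  - by move=> w _; rewrite lee_fin; have /andP[] := g01 w.
  - exact/measurable_EFinP.
  - by move=> w _; rewrite lee_fin; have /andP[] := g01 w.
pose X (z : bool) w := if z then \prod_(i <- V) b i t w else \prod_(i <- V) A i t w.
have mX z : measurable_fun
    [set: g_sigma_algebraType (if z then family_events P else family_events F)] (X z).
  case: z; apply: measurable_prod => i _.
    by apply: mb_ => B PB; exists i.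
  by apply: mA_ => B PB; exists i.
have X01 z w : 0 <= X z w <= 1.
  by case: z; [apply: (prod01 (fun i => b i t))|apply: (prod01 (fun i => A i t))].
have sG z : setT z -> <<s if z then family_events P else family_events F >> `<=`
    @measurable _ Omega by case: z.
have := @indep_integral_prod R _ Omega Pr bool _ _ (SMBS_indep_PF PF_SMBS) sG X
  [:: true; false] isT.
rewrite !big_cons !big_nil mule1 => H.
transitivity (\int[Pr]_w (X true w)%:E * \int[Pr]_w (X false w)%:E)%E.
  rewrite -H//.
  - by apply: eq_integral => w _; rewrite !big_cons big_nil mulr1.
  - by move=> z w; have /andP[] := X01 z w.
  - move=> z _; apply: fin01 => //; exact: (measurable_fun_sub_sigma (sG z I)).
congr (_ * _)%E.
  rewrite /X (indep_integral_prod (SMBS_indep_rows PF_SMBS))//.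
  - by move=> i _; exact: mb_.
  - by move=> i w; have /andP[] := b01 i w.
  - move=> i _; apply: fin01 => //.
    by apply: (measurable_fun_sub_sigma (@ke_meas _ _ P i)); exact: mb_.
rewrite /X (indep_integral_prod (SMBS_indep_F PF_SMBS))//.
- by move=> i _; exact: mA_.
- by move=> i w; have /andP[] := A01 i w.
- move=> i _; apply: fin01 => //.
  by apply: (measurable_fun_sub_sigma (@ke_meas _ _ F i)); exact: mA_.
Qed.

Lemma path_prob_step t :
  (\int[Pr]_w (path_weight P F s t.+1 w * fine (F (s t.+1) w [set u | (path_l s t.+1 < u)%N]))%:E =
   (RSM_kernel m c F0 t s (s t.+1))%:E *
   \int[Pr]_w (path_weight P F s t w * fine (F (s t) w [set u | (path_l s t < u)%N]))%:E)%E.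
Proof.
(* [V] also contains the state at t + 1, so one index set serves at both times. *)
pose V := undup [seq s u | u <- iota 0 t.+2].
have uV : uniq V by exact: undup_uniq.
have sV u : (u <= t.+1)%N -> s u \in V.
  by move=> ut; rewrite mem_undup; apply: map_f; rewrite mem_iota.
have sV' u : (u <= t)%N -> s u \in V by move=> ut; apply: sV; exact: leqW.
rewrite (path_prob_factor uV sV) (path_prob_factor uV sV').
have [] := BS_moment_step (c_gt0 (s t)) (F0_tail (s t)) (SMBS_BS PF_SMBS (s t)) s t.
set x := path_x s t; set D := _ + _ => stepG stepE.
have x0 : (0 < x)%N by [].
have D0 : 0 < D.
  rewrite ltr_pwDl// mulr_gt0 ?c_gt0// fine_gt0//.
  rewrite (lt_le_trans (F0_tail (s t) x)); last first.
    by apply: le_measure; rewrite ?inE// => u /ltnW.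
  by rewrite (le_lt_trans (probability_le1 _ _))// ltry.
have divD (y z : \bar R) (n D' : R) : 0 < D' ->
    (D'%:E * y = n%:E * z -> y = (n / D')%:E * z)%E.
  move=> D'0 yz; rewrite mulrC EFinM -muleA -yz muleA -EFinM mulVf ?gt_eqF//.
  by rewrite mul1e.
have EA : expect_A (s t) t = (\int[Pr]_w (a (s t) t w *
    fine (F (s t) w [set u | (path_l s t < u)%N]))%:E)%E.
  by apply: eq_integral => w _; rewrite /A eqxx.
have stV : s t \in V by exact: sV'.
rewrite /RSM_kernel -/x -/D; have [st|st] := eqVneq (s t.+1) (s t).
  (* After a stay the tail starts beyond x instead of x - 1, and no row factor changes. *)
  have lx : path_l s t.+1 = x.
    by have := path_xS s t; rewrite st eqxx => -[].
  have -> : (\prod_(i <- V) expect_b i t.+1 = \prod_(i <- V) expect_b i t)%E.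
    apply: eq_bigr => i _; apply: eq_integral => w _.
    by rewrite /b /= st eqxx andbF mulr1.
  rewrite muleCA; congr (_ * _)%E.
  rewrite (bigD1_seq (s t))//= [in RHS](bigD1_seq (s t))//= muleA; congr (_ * _)%E.
    rewrite EA -(divD _ _ _ _ D0 stepG); apply: eq_integral => w _.
    by rewrite /A /a /= st eqxx /= mulr1 lx.
  apply: eq_bigr => i /negPf ist; apply: eq_integral => w _.
  by rewrite /A /a /= st eqxx andbF mulr1 eq_sym ist.
have lx : path_l s t.+1 = 0%N.
  by have := path_xS s t; rewrite (negPf st) => -[].
have stepM := Dir_moment_step E_discrete (m_gt0 (s t)) (m_fin (s t))
  (SMBS_Dir PF_SMBS (s t)) (jump_count s t (s t)) uV (sV t.+1 (leqnn _)).
have -> : fine (m (s t) [set: E]) + \sum_(h \in [set h | h != s t])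
    ((path_M s t (s t) h)%:R : R) =
    fine (m (s t) [set: E]) + (\sum_(h <- V) jump_count s t (s t) h)%:R.
  by rewrite (sum_jump_count R (s t) uV sV').
set Dm := _ + _ in stepM *.
have Dm0 : 0 < Dm by rewrite ltr_pwDl// fine_gt0// m_gt0 m_fin.
have Ejc : jump_count s t (s t) (s t.+1) = path_M s t (s t) (s t.+1).
  by rewrite /jump_count (negPf st).
rewrite Ejc in stepM.
have -> : (\prod_(i <- V) expect_A i t.+1 =
    ((c (s t) x * fine (F0 (s t) [set x]) + (path_N s t (s t) [set x])%:R) / D)%:E *
    \prod_(i <- V) expect_A i t)%E.
  rewrite (bigD1_seq (s t))//= [in RHS](bigD1_seq (s t))//= muleA; congr (_ * _)%E.
    rewrite EA -(divD _ _ _ _ D0 stepE); apply: eq_integral => w _.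
    by rewrite /A /a /= eqxx st (negPf st) mulr1.
  apply: eq_bigr => i /negPf ist; apply: eq_integral => w _.
  rewrite /A /a /= [s t == i]eq_sym ist /= !mulr1 lx.
  case: eqP => [_|_]; last by rewrite mulr1.
  (* The sojourn that begins with the jump contributes the tail beyond 0, of mass 1 since F^i does
     not charge 0. *)
  rewrite (_ : fine _ = 1) ?mulr1//.
  have [_ Fi0] := SMBS_couple PF_SMBS w i.
  have FU : (F i w setT = F i w [set 0%N] + F i w [set u | (0 < u)%N])%E.
    rewrite -measureU//; last by apply/seteqP; split => u //= [->].
    congr (F i w _); apply/seteqP; split => // -[|u] _; first by left.
    by right.
  by move: FU; rewrite Fi0 add0e prob_kernel => <-.
have -> : (\prod_(i <- V) expect_b i t.+1 =
    ((fine (m (s t) [set s t.+1]) + (path_M s t (s t) (s t.+1))%:R) / Dm)%:E *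
    \prod_(i <- V) expect_b i t)%E.
  rewrite (bigD1_seq (s t))//= [in RHS](bigD1_seq (s t))//= muleA; congr (_ * _)%E.
    have Eb : expect_b (s t) t =
        (\int[Pr]_w (\prod_(h <- V) fine (P (s t) w [set h]) ^+ jump_count s t (s t) h)%:E)%E.
      by apply: eq_integral => w _; rewrite /b (jump_prodE _ _ uV sV').
    rewrite Eb -(divD _ _ _ _ Dm0 stepM); apply: eq_integral => w _.
    by rewrite /b /= eqxx st /= (jump_prodE _ _ uV sV').
  apply: eq_bigr => i /negPf ist; apply: eq_integral => w _.
  by rewrite /b /= [s t == i]eq_sym ist /= mulr1.
by rewrite muleACA -EFinM [X in (X%:E * _)%E]mulrC.
Qed.
End factorization.

(** * Conditional probabilities given the history *)

Section RSM_kernel_properties.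
Context (R : realType) dE (E : measurableType dE)
  (m : E -> {measure set E -> \bar R}) (c : E -> nat -> R)
  (F0 : E -> probability nat R).
Hypothesis c_gt0 : forall i t, (0 < t)%N -> 0 < c i t.

Lemma eq_RSM_kernel t (s s' : nat -> E) j :
  (forall u, (u <= t)%N -> s u = s' u) ->
  RSM_kernel m c F0 t s j = RSM_kernel m c F0 t s' j.
Proof.
move=> ss'; rewrite /RSM_kernel (eq_path_x ss') (ss' t)//.
have N i A : path_N s t i A = path_N s' t i A by exact: eq_path_N.
have M i h : path_M s t i h = path_M s' t i h by exact: eq_path_M.
by rewrite !N M; under eq_fsbigr do rewrite M.
Qed.

Lemma RSM_kernel_ge0 t (s : nat -> E) j : 0 <= RSM_kernel m c F0 t s j.
Proof.
have x0 : 0 <= c (s t) (path_x s t) by rewrite ltW// c_gt0.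
have M0 : 0 <= \sum_(h \in [set h | h != s t]) ((path_M s t (s t) h)%:R : R).
  by apply: fsumr_ge0.
rewrite /RSM_kernel; case: eqP => _.
  by rewrite divr_ge0// addr_ge0// mulr_ge0// fine_ge0.
by rewrite mulr_ge0// divr_ge0// addr_ge0// ?mulr_ge0// fine_ge0.
Qed.

End RSM_kernel_properties.

Section process_history.
Context (R : realType) d (Omega : measurableType d) (Pr : probability Omega R)
  dE (E : measurableType dE).
Hypotheses (E_countable : countable [set: E])
  (E_discrete : forall A : set E, measurable A).
Context (S : nat -> {RV Pr >-> E}) (t : nat).

Definition process_events : set (set Omega) :=
  \bigcup_(k in [set k | (k <= t)%N]) rv_events (S k).

Definition same_history (w w' : Omega) : Prop :=
  forall u, (u <= t)%N -> S u w = S u w'.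

Lemma process_events_measurable : <<s process_events >> `<=` @measurable _ Omega.
Proof.
apply: smallest_sub; first exact: sigma_algebra_measurable.
by move=> A [k _ [B mB <-]]; rewrite setTI; exact: measurable_funPTI.
Qed.

(** A history is a finite sequence in a countable set, so one natural number codes it and the
    classes of [same_history] are countably many. *)
Lemma history_code : exists code : Omega -> nat,
  forall w w', code w = code w' <-> same_history w w'.
Proof.
have /countable_injP[g g_inj] := E_countable.
exists (fun w => choice.pickle [seq g (S u w) | u <- iota 0 t.+1]) => w w'; split.
  move=> /(pcan_inj choice.pickleK) /eq_in_map gS u ut.
  by apply: g_inj; rewrite ?inE// gS// mem_iota.
move=> ww'; congr choice.pickle; apply/eq_in_map => u.
rewrite mem_iota add0n ltnS => /andP[_ ut].
by rewrite ww'.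
Qed.

Lemma history_class_sigma w0 : <<s process_events >> [set w | same_history w w0].
Proof.
rewrite (_ : mkset _ = \bigcap_(u in [set u | (u <= t)%N]) S u @^-1` [set S u w0]); last first.
  by apply/seteqP; split.
apply: (@bigcap_measurable _ (g_sigma_algebraType process_events)).
  by exists t => /=.
move=> u ut; apply: sub_sigma_algebra; exists u => //.
by exists [set S u w0]; rewrite ?setTI.
Qed.

(** Each class of equal histories is measurable, and a saturated set is a countable union of
    classes. Measurability becomes dependence on the history alone. *)
Lemma process_sigmaP B : <<s process_events >> B <->
  (forall w w', same_history w w' -> B w -> B w').
Proof.
split=> [|Bsat].
  have sym w w' : same_history w w' -> same_history w' w.
    by move=> ww' u ut; rewrite ww'.
  suff : <<s process_events >> `<=`
      [set B | forall w w', same_history w w' -> B w -> B w'] by apply.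
  apply: smallest_sub.
    split.
    - by [].
    - by move=> A Asat w w' ww' [_ Aw]; split => // Aw'; apply: Aw; apply: Asat Aw'; exact: sym.
    - by move=> A Asat w w' ww' [k _ Akw]; exists k => //; exact: Asat Akw.
  move=> A [k /= kt [C mC <-]]; rewrite setTI => w w' ww' /=.
  by rewrite ww'.
have [code codeP] := history_code.
pose At n := [set w | B w /\ code w = n].
rewrite (_ : B = \bigcup_n At n); last first.
  by apply/seteqP; split => [w Bw|w [n _ []]//]; exists (code w).
apply: (@bigcup_measurable _ (g_sigma_algebraType process_events)) => n _.
have [[w0 [Bw0 w0n]]|N] := pselect (exists w0, B w0 /\ code w0 = n).
  rewrite (_ : At n = [set w | same_history w w0]); first exact: history_class_sigma.
  apply/seteqP; split => w /=.
    by move=> [_ wn]; apply/codeP; rewrite wn.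
  move=> ww0; split; last by rewrite -w0n; apply/codeP.
  by apply: Bsat Bw0 => u ut; rewrite ww0.
rewrite (_ : At n = set0); first exact: sigma_algebra0.
by apply/seteqP; split => // w Bw; apply: N; exists w.
Qed.

End process_history.

Section atomic_cond_prob.
Context (R : realType) d (Omega : measurableType d) (Pr : probability Omega R)
  dE (E : measurableType dE).
Hypotheses (E_countable : countable [set: E])
  (E_discrete : forall A : set E, measurable A).
Context (S : nat -> {RV Pr >-> E}) (t : nat).

(** Both sides of the defining identity are countably additive in the conditioning event, so it is
    enough to test it on single classes, where [Y] is constant. *)
Lemma is_cond_prob_history (A : set Omega) (Y : Omega -> R) :
  measurable A -> (forall w, 0 <= Y w) ->
  (forall w w', same_history S t w w' -> Y w = Y w') ->
  (forall w0, Pr (A `&` [set w | same_history S t w w0]) =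
    ((Y w0)%:E * Pr [set w | same_history S t w w0])%E) ->
  is_cond_prob Pr (process_events S t) A (fun w => (Y w)%:E).
Proof.
move=> mA Y0 Ysat Ycond.
have mYG : measurable_fun [set: g_sigma_algebraType (process_events S t)]
    (fun w => (Y w)%:E).
  move=> _ B mB; rewrite setTI; apply/(process_sigmaP E_countable E_discrete) => w w' ww' /=.
  by rewrite (Ysat _ _ ww').
have sG := @process_events_measurable _ _ _ Pr _ _ S t.
have mY := measurable_fun_sub_sigma sG mYG.
have intY B : <<s process_events S t >> B -> (\int[Pr]_(w in B) (Y w)%:E = Pr (A `&` B))%E.
  move=> GB; have Bsat := (process_sigmaP E_countable E_discrete S t B).1 GB.
  have mB := sG _ GB.
  have [code codeP] := history_code E_countable S t.
  pose At n := [set w | B w /\ code w = n].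
  have BAt : B = \bigcup_n At n.
    by apply/seteqP; split => [w Bw|w [n _ []]//]; exists (code w).
  have AtP n : At n = set0 \/ exists w0, At n = [set w | same_history S t w w0].
    have [[w0 [Bw0 w0n]]|N] := pselect (exists w0, B w0 /\ code w0 = n).
      right; exists w0; apply/seteqP; split => w /=.
        by move=> [_ wn]; apply/codeP; rewrite wn.
      move=> ww0; split; last by rewrite -w0n; apply/codeP.
      by apply: Bsat Bw0 => u ut; rewrite ww0.
    by left; apply/seteqP; split => // w Bw; apply: N; exists w.
  have mAt n : measurable (At n).
    have [->//|[w0 ->]] := AtP n; apply: sG; exact: history_class_sigma.
  have tAt : trivIset setT At by move=> k k' _ _ [w [[_ <-] [_ <-]]].
  rewrite [in LHS]BAt ge0_integral_bigcup//; last 2 first.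
  - exact: measurable_funTS.
  - by move=> w _; rewrite lee_fin.
  rewrite [in RHS]BAt setI_bigcupr measure_bigcup//; last 2 first.
  - by move=> n _; exact: measurableI.
  - exact: trivIset_setIl.
  rewrite [RHS]eseries_mkcond; apply: eq_eseriesr => n _; rewrite in_setT.
  have [->|[w0 Atw0]] := AtP n; first by rewrite integral_set0 setI0 measure0.
  rewrite Atw0; apply: (etrans _ (esym (Ycond w0))).
  rewrite (eq_integral (cst (Y w0)%:E)); last first.
    by move=> w /set_mem /Ysat ->.
  by rewrite integral_cst// -Atw0.
split => //.
(* Integrability comes from the identity itself: over the whole space the integral of [Y] is Pr A <=
   1. *)
apply/integrableP; split; first exact: mY.
rewrite (eq_integral (fun w => (Y w)%:E)); last first.
  by move=> w _; rewrite gee0_abs// lee_fin.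
rewrite intY; last exact: (@measurableT _ (g_sigma_algebraType (process_events S t))).
by rewrite (le_lt_trans (probability_le1 _ _)) ?ltry//; exact: measurableI.
Qed.

End atomic_cond_prob.

Theorem corollary5p1 (R : realType)
  (dE : measure_display) (E : measurableType dE)
  (E_countable : countable [set: E])
  (E_discrete : forall A : set E, measurable A)
  (l0 : E)
  (m : E -> {measure set E -> \bar R})
  (m_gt0 : forall i, (0 < m i [set: E])%E)
  (m_fin : forall i, (m i [set: E] < +oo)%E)
  (m_diag : forall i, m i [set i] = 0%E)
  (c : E -> nat -> R)
  (c_gt0 : forall i t, (0 < t)%N -> 0 < c i t)
  (F0 : E -> probability nat R)
  (F0_pos : forall i, F0 i [set 0%N] = 0%E)
  (F0_tail : forall i (t : nat), (0 < F0 i [set u | (t < u)%N])%E)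
  (d : measure_display) (Omega : measurableType d) (Pr : probability Omega R)
  (P : E -> R.-pker Omega ~> E) (F : E -> R.-pker Omega ~> nat)
  (PF_SMBS : SMBS Pr m c F0 P F)
  (S : nat -> {RV Pr >-> E})
  (S_SM : cond_SM l0 P F S) :
  RSM l0 m c F0 S.
Proof.
case: S_SM => L [T [LT SL]].
have PF_couple := SMBS_couple PF_SMBS.
have mS0 : measurable (S 0%N @^-1` [set l0]) by exact: measurable_funPTI.
have S0null : Pr (~` (S 0%N @^-1` [set l0])) = 0%E.
  apply/negligibleP; first exact: measurableC.
  exact: markov_renewal_start LT _ SL.
split.
  by rewrite -[X in Pr X]setCK probability_setC ?S0null ?sube0//; exact: measurableC.
move=> t j; apply: (is_cond_prob_history E_countable E_discrete).
- exact: measurable_funPTI.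
- by move=> w; exact: RSM_kernel_ge0.
- by move=> w w' ww'; exact: eq_RSM_kernel.
(* The path [s] follows the history of [w0] up to [t] and then takes the value [j], so that both
   probabilities become path probabilities of the same [s]. *)
move=> w0; pose s u := if (u <= t)%N then S u w0 else j.
have st1 : s t.+1 = j by rewrite /s ltnn.
have histE : [set w | same_history S t w w0] =
    [set w | forall u, (u <= t)%N -> S u w = s u].
  by apply/seteqP; split => w ww0 u ut; have := ww0 u ut; rewrite /s ut.
have histSE : S t.+1 @^-1` [set j] `&` [set w | same_history S t w w0] =
    [set w | forall u, (u <= t.+1)%N -> S u w = s u].
  rewrite histE; apply/seteqP; split => w /=.
    move=> [Sj Ss] u; rewrite leq_eqVlt ltnS => /predU1P[->|]; last exact: Ss.
    by rewrite st1.
  by move=> Ss; split => [|u ut]; [rewrite -st1 Ss|apply: Ss; exact: leqW].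
rewrite histSE histE.
have kE : RSM_kernel m c F0 t (fun u => S u w0) j = RSM_kernel m c F0 t s (s t.+1).
  by rewrite st1; apply: eq_RSM_kernel => u ut; rewrite /s ut.
have [s0|s0] := eqVneq (s 0%N) l0.
  have path_prob := markov_renewal_path_prob E_countable E_discrete PF_couple LT _ SL s0.
  rewrite !path_prob kE.
  exact: path_prob_step.
(* A path that does not start at [l0] has probability 0 at both times, so the identity reads 0 =
   0. *)
have null k : Pr [set w | forall u, (u <= k)%N -> S u w = s u] = 0%E.
  apply/eqP; rewrite eq_le measure_ge0 andbT -S0null.
  apply: le_measure; rewrite ?inE.
  - rewrite (_ : mkset _ = \bigcap_(u in [set u | (u <= k)%N]) (S u @^-1` [set s u])).
      by apply: bigcap_measurable => [|u _]; [exists k => /=|exact: measurable_funPTI].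
    by apply/seteqP; split.
  - exact: measurableC.
  - by move=> w Ss /= Sl0; move/eqP: s0; apply; rewrite -(Ss 0%N).
by rewrite !null mule0.
Qed.
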